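(* Let $(A,B,C,D)$ be an impedance passive regular linear system on $X$ with transfer function $P$, which is strongly stable and satisfies $i\mathbb{R}\subset\rho(A)$. Let $(A_c,B_c,C_c,D_c)$ be an impedance passive regular linear system on $Z$ with transfer function $G$ and with $D_c\ge 0$. Assume that for some index set $\mathcal{I}\subset\mathbb{Z}$ and real numbers $\{\omega_k\}_{k\in\mathcal{I}}$ the following hold. (1) $\sigma(A_c)\cap i\mathbb{R}=\{i\omega_k\}_{k\in\mathcal{I}}$ and $\mathrm{Re}\,P(i\omega_k)>0$ for all $k\in\mathcal{I}$. (2) $I+P(i\omega)G(i\omega)$ has a bounded inverse for every $\omega\in\mathbb{R}\setminus\{\omega_k\}_{k\in\mathcal{I}}$ for which $\mathrm{Re}\,G(i\omega)$ is not boundedly invertible. (3) $\{i\omega_k\}_{k\in\mathcal{I}}\subset\rho\bigl(A_c-B_cD_0(I+D_cD_0)^{-1}C_{c\Lambda}\bigr)$ whenever $D_0\in\mathcal{L}(U)$ satisfies $\mathrm{Re}\,D_0>0$. Then $i\mathbb{R}\subset\rho(A_e)$ and the closed-loop system is strongly stable (i.e. the semigroup $T_e(t)$ generated by $A_e$ is strongly stable). Assume in addition that $\mathcal{I}$ is finite, $(A,B,C,D)$ is exponentially stable, and $\sup_{|\omega|\ge R}\|R(i\omega,A_c)\|<\infty$ for some $R>0$. If either $\limsup_{|\omega|\to\infty}\|G(i\omega)P(i\omega)\|<1$, or if $\mathrm{Re}\,P(i\omega)\ge\eta(\omega)\ge 0$ and $\mathrm{Re}\,G(i\omega)\ge d_c(\omega)\ge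 0$ with $\eta(\omega)+d_c(\omega)\ge\eta_0>0$ for some constant $\eta_0>0$ and for all sufficiently large $|\omega|$, then the closed-loop system is exponentially stable.
   Context: All Hilbert spaces are complex, $R(\lambda,A)=(\lambda-A)^{-1}$, and $\mathrm{Re}\,T=\frac12(T+T^* )$ for bounded $T$. For a bounded operator, $T\ge 0$ means self-adjoint and nonnegative; $T>0$ means $T\ge cI$ for some constant $c>0$. Regular linear systems. Let $A$ generate a strongly continuous semigroup $T(t)$ on a Hilbert space $X$. $X_1=D(A)$ with the graph norm; $X_{-1}$ is the completion of $X$ in the norm $\|R(\lambda_0,A)x\|$ for a fixed $\lambda_0\in\rho(A)$. $A$ and its resolvents extend to $X\to X_{-1}$ and $X_{-1}\to X$, denoted by the same symbols. $(A,B,C,D)$ is a regular linear system on $X$ with input space $U$ and output space $Y$ if $B\in\mathcal{L}(U,X_{-1})$ and $C\in\mathcal{L}(X_1,Y)$ are admissible for $T(t)$, $D\in\mathcal{L}(U,Y)$, $\mathrm{ran}(R(\lambda,A)B)\subset D(C_\Lambda)$ for $\lambda\in\rho(A)$, and $\lambda\mapsto C_\Lambda R(\lambda,A)B$ is bounded on some right half-plane. Here $C_\Lambda x=\lim_{\lambda\to\infty}\lambda CR(\lambda,A)x$ ($\lambda$ real) with domain the set of $x\in X$ for which the limit exists. Its transfer function is $P(\lambda)=C_\Lambda R(\lambda,A)B+D$, $\lambda\in\rho(A)$. The system is strongly/exponentially stable if $T(t)$ is. If $Y=U$, it is impedance passive if $\mathrm{Re}\langle Ax+Bu,x\rangle\le\mathrm{Re}\langle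 C_\Lambda x+Du,u\rangle$ for all $x\in X$, $u\in U$ with $Ax+Bu\in X$. An operator of the form $A-BQC_\Lambda$ has domain $\{x\in D(C_\Lambda): (A-BQC_\Lambda)x\in X\}$. Closed-loop system. Both systems have input and output space $U=Y$. The transfer function of the second is $G(\lambda)=C_{c\Lambda}R(\lambda,A_c)B_c+D_c$, $\lambda\in\rho(A_c)$. They are coupled by the power-preserving interconnection in which the input of the first system is the output of the second, and the input of the second is minus the output of the first. With $Q_1=(I+DD_c)^{-1}$, $Q_2=(I+D_cD)^{-1}$, $X_B=D(A)+\mathrm{ran}(R(\lambda_0,A)B)$ and $Z_{B_c}=D(A_c)+\mathrm{ran}(R(\lambda_0,A_c)B_c)$, the closed-loop system $\dot x_e=A_ex_e$ on $X_e=X\times Z$ has $$A_e=\begin{bmatrix}A-BD_cQ_1C_\Lambda & BQ_2C_{c\Lambda}\\ -B_cQ_1C_\Lambda & A_c-B_cQ_1DC_{c\Lambda}\end{bmatrix},$$ with domain the set of $(x,z)\in X_B\times Z_{B_c}$ for which $A_e(x,z)$ (computed in $X_{-1}\times Z_{-1}$) lies in $X\times Z$. $A_e$ generates a contraction semigroup $T_e(t)$. *)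

(* Defs.v *)
From HB Require Import structures.
From mathcomp Require Import all_boot all_order all_algebra.
From mathcomp Require Import all_classical all_reals all_analysis.
From mathcomp Require Import complex.

Set Implicit Arguments.
Unset Strict Implicit.
Unset Printing Implicit Defensive.

Import Order.TTheory GRing.Theory Num.Theory.
Import numFieldNormedType.Exports.

Local Open Scope classical_set_scope.
Local Open Scope ring_scope.
Local Open Scope complex_scope.

(* The inner product is linear in its first argument. *)
HB.mixin Record isHilbert (R : realType) H & CompleteNormedModule R[i] H := {
  inner : {dot H for (@Num.conj R[i])} ;
  inner_norm : forall x : H, inner x x = `|x| ^+ 2
}.

#[short(type="hilbertType")]
HB.structure Definition Hilbert (R : realType) :=
  { H of isHilbert R H & CompleteNormedModule R[i] H }.

Section Operators.
Context {R : realType}.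
Implicit Types V W E : normedModType R[i].

(* The norm of a normedModType over R[i] takes its values in R[i]. *)
Definition nrm V (x : V) : R := complex.Re `|x|.

Definition bounded_operator V W (f : V -> W) : Prop :=
  linear f /\ exists M : R, forall x, nrm (f x) <= M * nrm x.

Definition opnorm V W (f : V -> W) : \bar R :=
  ereal_sup [set (nrm (f x))%:E | x in [set x | nrm x <= 1]].

Definition boundedly_invertible V W (f : V -> W) : Prop :=
  exists g : W -> V, [/\ bounded_operator g, cancel f g & cancel g f].

Definition inv_op V W (f : V -> W) (y : W) : V := xget 0 [set x | f x = y].

(* A possibly unbounded operator; its values outside [dom] are irrelevant. *)
Record operator V W := Operator { dom : set V ; app :> V -> W }.

Definition rho V (A : operator V V) : set R[i] :=
  [set l | exists S : V -> V, [/\ bounded_operator S,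
     forall y, dom A (S y) /\ l *: S y - A (S y) = y &
     forall x, dom A x -> S (l *: x - A x) = x]].

Definition sigma V (A : operator V V) : set R[i] := ~` rho A.

Definition resolvent V (A : operator V V) (l : R[i]) (y : V) : V :=
  xget 0 [set x | dom A x /\ l *: x - A x = y].

(* Extension by continuity, to the points w of W, of the map j v |-> f v given
   for v in D: the limit of f v as v in D is such that j v tends to w. *)
Definition extension V W E (D : set V) (j : V -> W) (f : V -> E) (w : W) : E :=
  lim (f @ within D (filter_from (nbhs w) (fun N => j @^-1` N))).

Definition c0_semigroup V (T : R -> V -> V) : Prop :=
  [/\ forall t, 0 <= t -> bounded_operator (T t),
      forall x, T 0 x = x,
      forall s t x, 0 <= s -> 0 <= t -> T (s + t) x = T s (T t x) &
      forall x, T t x @[t --> 0^'+] --> x].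

Definition generator V (T : R -> V -> V) : operator V V :=
  let quotient x h := (h%:C)^-1 *: (T h x - x) in
  Operator [set x | cvg (quotient x h @[h --> 0^'+])]
           (fun x => lim (quotient x h @[h --> 0^'+])).

Definition generates V (A : operator V V) (T : R -> V -> V) : Prop :=
  [/\ c0_semigroup T, dom A = dom (generator T) &
      forall x, dom A x -> A x = generator T x].

Definition strongly_stable V (T : R -> V -> V) : Prop :=
  forall x, T t x @[t --> +oo] --> 0.

Definition exponentially_stable V (T : R -> V -> V) : Prop :=
  exists M a : R, 0 < a /\
    forall t x, 0 <= t -> nrm (T t x) <= M * expR (- (a * t)) * nrm x.

End Operators.

Section HilbertOperators.
Context {R : realType} (H : hilbertType R).
Implicit Types T : H -> H.

Definition adjoint T (y : H) : H :=
  xget 0 [set z | forall x, inner (T x) y = inner x z].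

Definition re_op T (x : H) : H := 2^-1 *: (T x + adjoint T x).

(* T >= 0; in R[i], 0 <= z means that z is real and nonnegative. *)
Definition nonneg_op T : Prop :=
  (forall x y, inner (T x) y = inner x (T y)) /\
  (forall x, 0 <= inner (T x) x).

Definition ge_scalar T (c : R) : Prop := nonneg_op (fun x => T x - c%:C *: x).

Definition pos_op T : Prop := exists2 c : R, 0 < c & ge_scalar T c.

End HilbertOperators.

Section BochnerIntegral.
Context {R : realType} {E : normedModType R[i]}.
Implicit Types (D : set R) (f : R -> E).

Let mu := @lebesgue_measure R.

Definition simple_function (s : R -> E) : Prop :=
  finite_set (range s) /\ forall v, measurable (s @^-1` [set v]).

Definition simple_integral D (s : R -> E) : E :=
  \sum_(v \in range s) ((fine (mu (D `&` s @^-1` [set v])))%:C *: v).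

Definition approximates D (s : nat -> R -> E) f : Prop :=
  (forall n, simple_function (s n)) /\
  {ae mu, forall t, D t -> s n t @[n --> \oo] --> f t}.

Definition is_bochner_integral D f (y : E) : Prop :=
  exists s : nat -> R -> E,
  [/\ approximates D s f,
      (\int[mu]_(t in D) (nrm (f t - s n t))%:E)%E @[n --> \oo] --> 0%E &
      simple_integral D (s n) @[n --> \oo] --> y].

Definition square_integrable D (u : R -> E) : Prop :=
  (exists s, approximates D s u) /\
  (\int[mu]_(t in D) (nrm (u t) ^+ 2)%:E < +oo)%E.

End BochnerIntegral.

Section Systems.
Context {R : realType}.
Implicit Types X U Y Z : hilbertType R.

(* A completion X_{-1} of X for the norm |R(l0, A) x|. *)
Record extrapolation_space X (A : operator X X) := ExtrapolationSpace {
  ext_space :> completeNormedModType R[i] ;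
  embed : {linear X -> ext_space} ;
  base_point : R[i] ;
  base_pointP : rho A base_point ;
  norm_embed : forall x, `|embed x| = `|resolvent A base_point x| ;
  dense_embed : dense (range embed)
}.

(* The values of the output operator [opC] matter only on the domain of
   [opA]. *)
Record system X U Y := System {
  opA : operator X X ;
  sgT : R -> X -> X ;
  extX : extrapolation_space opA ;
  opB : U -> extX ;
  opC : X -> Y ;
  opD : U -> Y
}.

Section OneSystem.
Context {X U Y : hilbertType R} (S : system X U Y).

Definition emb : X -> extX S := embed (extX S).
Definition lambda0 : R[i] := base_point (extX S).

Definition A_ext : X -> extX S := extension (dom (opA S)) id (emb \o opA S).

Definition R_ext (l : R[i]) : extX S -> X :=
  extension setT emb (resolvent (opA S) l).

Definition T_ext (t : R) : extX S -> extX S :=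
  extension setT emb (emb \o sgT S t).

(* The element of X represented by an element of X_{-1}. *)
Definition restrict (v : extX S) : X := xget 0 [set x | emb x = v].

Definition C_Lambda : operator X Y :=
  let approx x (l : R) := l%:C *: opC S (resolvent (opA S) l%:C x) in
  Operator [set x | cvg (approx x l @[l --> +oo])]
           (fun x => lim (approx x l @[l --> +oo])).

Definition transfer (l : R[i]) (u : U) : Y :=
  C_Lambda (R_ext l (opB S u)) + opD S u.

Definition bounded_output_operator : Prop :=
  (forall (a : R[i]) x y, dom (opA S) x -> dom (opA S) y ->
     opC S (a *: x + y) = a *: opC S x + opC S y) /\
  exists M : R, forall x, dom (opA S) x ->
    nrm (opC S x) <= M * (nrm x + nrm (opA S x)).

Definition admissible_input : Prop :=
  exists2 tau : R, 0 < tau & forall u : R -> U,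
    square_integrable `[0, tau] u ->
    exists x : X, is_bochner_integral `[0, tau]
      (fun s => T_ext (tau - s) (opB S (u s))) (emb x).

Definition admissible_output : Prop :=
  exists2 tau : R, 0 < tau & exists M : R, forall x, dom (opA S) x ->
    (\int[lebesgue_measure]_(t in `[0%R, tau])
        (nrm (opC S (sgT S t x)) ^+ 2)%:E <= (M * nrm x ^+ 2)%:E)%E.

Definition regular : Prop :=
  [/\ generates (opA S) (sgT S),
      [/\ bounded_operator (opB S), bounded_output_operator &
          bounded_operator (opD S)],
      admissible_input /\ admissible_output,
      forall l u, rho (opA S) l -> dom C_Lambda (R_ext l (opB S u)) &
      exists a M : R, forall l, a < complex.Re l ->
        rho (opA S) l /\
        forall u, nrm (C_Lambda (R_ext l (opB S u))) <= M * nrm u].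

(* A - B Q C_Lambda *)
Definition feedback (Q : Y -> U) : operator X X :=
  let value x := A_ext x - opB S (Q (C_Lambda x)) in
  Operator [set x | dom C_Lambda x /\ range emb (value x)]
           (restrict \o value).

(* D(A) + ran R(lambda0, A) B *)
Definition X_B : set X :=
  [set x | exists y u, dom (opA S) y /\ x = y + R_ext lambda0 (opB S u)].

End OneSystem.

Definition impedance_passive X U (S : system X U U) : Prop :=
  forall (x : X) (u : U) (w : X), A_ext S x + opB S u = emb S w ->
    complex.Re (inner w x) <= complex.Re (inner (C_Lambda S x + opD S u) u).

Section ClosedLoop.
Context {X Z U : hilbertType R} (S : system X U U) (Sc : system Z U U).

Let Q1 : U -> U := inv_op (fun u => u + opD S (opD Sc u)).
Let Q2 : U -> U := inv_op (fun u => u + opD Sc (opD S u)).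

Definition closed_loop : operator (X * Z)%type (X * Z)%type :=
  let first (p : X * Z) : extX S :=
    A_ext S p.1 - opB S (opD Sc (Q1 (C_Lambda S p.1)))
    + opB S (Q2 (C_Lambda Sc p.2)) in
  let second (p : X * Z) : extX Sc :=
    - opB Sc (Q1 (C_Lambda S p.1))
    + (A_ext Sc p.2 - opB Sc (Q1 (opD S (C_Lambda Sc p.2)))) in
  Operator [set p | [/\ X_B S p.1, X_B Sc p.2,
                        range (emb S) (first p) & range (emb Sc) (second p)]]
           (fun p => (restrict (first p), restrict (second p))).

(* The library norm of a product is the maximum norm. It is equivalent to the
   Hilbert norm, and only contractivity depends on the choice. *)
Definition contractive (T : R -> X * Z -> X * Z) : Prop :=
  forall t p, 0 <= t ->
    nrm (T t p).1 ^+ 2 + nrm (T t p).2 ^+ 2 <= nrm p.1 ^+ 2 + nrm p.2 ^+ 2.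

End ClosedLoop.

End Systems.

Section ImaginaryAxis.
Context {R : realType}.

Definition imag (w : R) : R[i] := Complex 0 w.

Definition imaginary_axis : set R[i] := range imag.

(* The filter |w| --> +oo. *)
Definition abs_infty : set_system R :=
  filter_from (nbhs +oo) (fun N => [set w : R | N `|w|]).

End ImaginaryAxis.

(* Main.v *)
From HB Require Import structures.
Require Import Defs.
From mathcomp Require Import all_boot all_order all_algebra.
From mathcomp Require Import all_classical all_reals all_analysis.
From mathcomp Require Import complex ring lra zify.

(** Off the spectrum of A_c the closed loop is solved by its signals. If y is
    the output of the first system and u that of the second, then the equation
    (i w - A_e)(x, z) = (f, g) says
    [[
      x = R f + R B u,         y = C R f + P u,
      z = R_c g - R_c B_c y,   u = C_c R_c g - G y,
    ]]
    all resolvents and transfer functions being taken at i w. Elimination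
    leaves (I + P G) y = C R f + P C_c R_c g, so i w lies in the resolvent set
    of A_e as soon as I + P G has a bounded inverse ([loop_rho]). Passivity
    makes P and G accretive on the imaginary axis, so the inverse exists when
    Re G is invertible ([loop_invertible]); where Re G is singular the inverse
    is assumed. At an eigenfrequency w_k there is no resolvent R_c. The first
    system is then replaced by its transfer function D_0 = P(i w_k), the
    feedback operator built from D_0, whose resolvent exists by assumption,
    takes the place of A_c, and the unbounded right-hand side B_c v is removed beforehand with the
    resolvent of A_c at a point mu of the right half-plane ([input_lift],
    [resonant_rho]).

    Strong stability: for a contraction semigroup the limit of
    <T(t) x, T(t) y> is a semi-inner product Q for which T(t) is isometric, so
    A^-1 is Q-skew. If A^-1 had a positive Q-norm kappa, vectors almost
    attaining it would be almost annihilated by A^-2 + kappa^2. But that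
    operator has an inverse, bounded for Q, because the imaginary axis consists
    of resolvent points. Hence Q vanishes on the dense domain of A
    ([Q_resolvent0], [strong_stability]).

    Exponential stability is the theorem of Gearhart and Pruess for
    contractions. Let J be an implicit Euler step of length h. A bound on the
    resolvent of A on the imaginary axis bounds the resolvent of J by a multiple
    of 1/h on the unit circle ([euler_low]). The discrete Fourier transform of
    the orbit J^j x, cut off by a trapezoidal weight, and Parseval's identity
    turn this into a decay of J^N ([power_decay]). Since J^N x tends to T(N h) x
    as h tends to 0, some T(t) is a strict contraction ([strict_time]).

    The bound on the resolvent of A_e at high frequencies follows from uniform
    bounds on R B, C R and P ([axis_bounds]). On a vertical line far to the right
    they are consequences of the passivity inequality alone
    ([shifted_bounds]), and the resolvent identity carries them to the axis.
    There either alternative of the theorem bounds I + P G from below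
    ([gap_limsup], [gap_passive]). Low frequencies are handled by compactness. *)

Set Implicit Arguments.
Unset Strict Implicit.
Unset Printing Implicit Defensive.

Import Order.TTheory GRing.Theory Num.Theory.
Import numFieldNormedType.Exports.

Local Open Scope classical_set_scope.
Local Open Scope ring_scope.
Local Open Scope complex_scope.

(** * Identities in modules *)
Section LmodTactic.
Context {K : comNzRingType} {V : lmodType K}.

(** Linear combinations are compared coefficient by coefficient: [lmod] reifies
    both sides of an equation between vectors and leaves ring identities. *)
Inductive vexpr :=
  | VAtom of nat | VZero | VAdd of vexpr & vexpr | VOpp of vexpr
  | VScale of K & vexpr.

Fixpoint veval (s : seq V) (e : vexpr) : V :=
  match e with
  | VAtom n => nth 0 s n
  | VZero => 0
  | VAdd e1 e2 => veval s e1 + veval s e2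
  | VOpp e1 => - veval s e1
  | VScale a e1 => a *: veval s e1
  end.

Fixpoint vcoef (e : vexpr) (i : nat) : K :=
  match e with
  | VAtom n => if Nat.eqb i n then 1 else 0
  | VZero => 0
  | VAdd e1 e2 => vcoef e1 i + vcoef e2 i
  | VOpp e1 => - vcoef e1 i
  | VScale a e1 => a * vcoef e1 i
  end.

Lemma vevalE (s : seq V) (e : vexpr) :
  veval s e = \sum_(i < size s) vcoef e i *: nth 0 s i.
Proof.
elim: e => [n||e1 IH1 e2 IH2|e1 IH1|a e1 IH1] /=; rewrite ?IH1 ?IH2.
- have [ns|sn] := ltnP n (size s).
    rewrite (bigD1 (Ordinal ns)) //= (introT (PeanoNat.Nat.eqb_spec n n)) //.
    rewrite scale1r big1 ?addr0 // => i /eqP ni.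
    case: (PeanoNat.Nat.eqb_spec i n) => [e|_]; last by rewrite scale0r.
    by case: ni; apply: val_inj.
  rewrite nth_default // big1 // => i _.
  case: (PeanoNat.Nat.eqb_spec i n) => [e|_]; last by rewrite scale0r.
  by have := ltn_ord i; rewrite e ltnNge sn.
- by rewrite big1 // => i _; rewrite scale0r.
- by rewrite -big_split; apply: eq_bigr => i _; rewrite scalerDl.
- by rewrite -sumrN; apply: eq_bigr => i _; rewrite scaleNr.
- by rewrite scaler_sumr; apply: eq_bigr => i _; rewrite scalerA.
Qed.

Fixpoint vall (P : nat -> Prop) (n : nat) : Prop :=
  if n is m.+1 then vall P m /\ P m else True.

Lemma veval_eq (s : seq V) (e1 e2 : vexpr) :
  vall (fun i => vcoef e1 i = vcoef e2 i) (size s) -> veval s e1 = veval s e2.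
Proof.
move=> h; rewrite !vevalE; apply: eq_bigr => i _; congr (_ *: _).
elim: (size s) h i => [_ []//|n IH /= [hn h] i].
have := ltn_ord i; rewrite ltnS leq_eqVlt => /orP[/eqP -> //|lin].
exact: (IH hn (Ordinal lin)).
Qed.

End LmodTactic.

Ltac vhead x := lazymatch x with ?f _ => vhead f | _ => x end.
(* Two paths through the structure hierarchy may lead to the same vector, so
   atoms with the same head are compared up to conversion. *)
Ltac vsame x y :=
  first [ constr_eq x y
        | let f := vhead x in let g := vhead y in constr_eq f g; unify x y ].
Ltac vmem x l :=
  match l with
  | nil => constr:(false)
  | cons ?y _ =>
    let _ := match goal with _ => vsame x y end in constr:(true)
  | cons _ ?l' => vmem x l'
  end.
Ltac vadd x l := match vmem x l with true => l | false => constr:(cons x l) end.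
Ltac vindex x l :=
  match l with
  | cons ?y _ => let _ := match goal with _ => vsame x y end in constr:(O)
  | cons _ ?l' => let n := vindex x l' in constr:(S n)
  end.
Ltac vatoms e l :=
  lazymatch e with
  | (?a + ?b)%R => let l1 := vatoms a l in vatoms b l1
  | (- ?a)%R => vatoms a l
  | (?k *: ?a)%R => vatoms a l
  | 0%R => l
  | _ => vadd e l
  end.
Ltac vreify K e l :=
  lazymatch e with
  | (?a + ?b)%R =>
    let x := vreify K a l in let y := vreify K b l in constr:(@VAdd K x y)
  | (- ?a)%R => let x := vreify K a l in constr:(@VOpp K x)
  | (?k *: ?a)%R => let x := vreify K a l in constr:(@VScale K k x)
  | 0%R => constr:(@VZero K)
  | _ => let n := vindex e l in constr:(@VAtom K n)
  end.

Ltac lmod_pre K V :=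
  lazymatch goal with
  | |- ?e1 = ?e2 =>
    let l1 := vatoms e1 (@nil V) in
    let l := vatoms e2 l1 in
    let x := vreify K e1 l in
    let y := vreify K e2 l in
    refine (@veval_eq K V l x y _);
    cbv [vall size vcoef Nat.eqb]; repeat split
  end.


Ltac lmod_split :=
  lazymatch goal with
  | R : realType |- @eq ?T _ _ => lmod_pre (complex R) T
  end.
Ltac lmod := lmod_split; ring.

(** * Real-valued norms and bounded operators *)
Section Nrm.
Context {R : realType}.
Implicit Types V W E : normedModType R[i].

Lemma normE V (x : V) : `|x| = (nrm x)%:C.
Proof. by rewrite /nrm RRe_real // ger0_real. Qed.

Lemma nrm_ge0 V (x : V) : 0 <= nrm x.
Proof. by rewrite -(@lecR R) -normE; apply: normr_ge0. Qed.

Lemma ler_nrmD V (x y : V) : nrm (x + y) <= nrm x + nrm y.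
Proof. by rewrite -lecR rmorphD /= -!normE ler_normD. Qed.

Lemma nrmN V (x : V) : nrm (- x) = nrm x.
Proof. by rewrite /nrm normrN. Qed.

Lemma nrmBC V (x y : V) : nrm (x - y) = nrm (y - x).
Proof. by rewrite -nrmN opprB. Qed.

Lemma ler_nrmB V (x y : V) : nrm (x - y) <= nrm x + nrm y.
Proof. by rewrite -(nrmN y) ler_nrmD. Qed.

Lemma ler_nrm_dist V (x y z : V) : nrm (x - z) <= nrm (x - y) + nrm (y - z).
Proof. by apply: le_trans (ler_nrmD _ _); rewrite addrA subrK. Qed.

Definition cabs (a : R[i]) : R := complex.Re `|a|.

Lemma cabsE (a : R[i]) : `|a| = (cabs a)%:C.
Proof. by rewrite /cabs RRe_real // ger0_real. Qed.

Lemma cabs_ge0 (a : R[i]) : 0 <= cabs a.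
Proof. by rewrite -(@lecR R) -cabsE; apply: normr_ge0. Qed.

Lemma cabsM (a b : R[i]) : cabs (a * b) = cabs a * cabs b.
Proof. by apply: (@complexI R); rewrite rmorphM /= -!cabsE normrM. Qed.

Lemma cabs_real (a : R) : cabs a%:C = `|a|.
Proof. by apply: (@complexI R); rewrite -cabsE normc_def /= expr0n /= addr0 sqrtr_sqr. Qed.

Lemma cabsN (a : R[i]) : cabs (- a) = cabs a.
Proof. by rewrite /cabs normrN. Qed.

Lemma cabsV (a : R[i]) : cabs a^-1 = (cabs a)^-1.
Proof. by apply: (@complexI R); rewrite -cabsE normfV cabsE fmorphV. Qed.

Lemma cabs_eq0 (a : R[i]) : (cabs a == 0) = (a == 0).
Proof. by rewrite -[RHS]normr_eq0 cabsE -(inj_eq (@complexI R)). Qed.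

Lemma sqr_cabs (a : R[i]) : cabs a ^+ 2 = complex.Re a ^+ 2 + complex.Im a ^+ 2.
Proof. by apply: (@complexI R); rewrite rmorphXn /= -cabsE add_Re2_Im2. Qed.

Lemma nrmZ V (a : R[i]) (x : V) : nrm (a *: x) = cabs a * nrm x.
Proof. by apply: (@complexI R); rewrite rmorphM /= -cabsE -!normE normrZ. Qed.

Lemma nrm0 V : nrm (0 : V) = 0.
Proof. by rewrite /nrm normr0. Qed.

Lemma nrm_eq0 V (x : V) : (nrm x == 0) = (x == 0).
Proof. by rewrite -[RHS]normr_eq0 normE -(inj_eq (@complexI R)). Qed.

Lemma nrm_le0 V (x : V) : nrm x <= 0 -> x = 0.
Proof. by move=> h; apply/eqP; rewrite -nrm_eq0 eq_le h nrm_ge0. Qed.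

Lemma cvg_nrmP V T (F : set_system T) {FF : Filter F} (f : T -> V) (l : V) :
  f t @[t --> F] --> l <->
  forall e : R, 0 < e -> \forall t \near F, nrm (f t - l) < e.
Proof.
split=> [/cvgrPdist_lt h e e0|h].
  have := h e%:C; rewrite ltcR => /(_ e0); apply: filterS => t.
  by rewrite distrC normE ltcR.
apply/cvgrPdist_lt => e e0.
have er : e = (complex.Re e)%:C by rewrite RRe_real // gtr0_real.
have : 0 < complex.Re e by rewrite -(@ltcR R) -er.
move=> /h; apply: filterS => t; rewrite er distrC normE ltcR //.
Qed.

Lemma cvg_nrm0P V T (F : set_system T) {FF : Filter F} (f : T -> V) (l : V) :
  f t @[t --> F] --> l <-> nrm (f t - l) @[t --> F] --> (0 : R).
Proof.
split=> [/cvg_nrmP h|/cvgrPdist_lt h].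
  apply/cvgrPdist_lt => e /h; apply: filterS => t.
  by rewrite sub0r normrN ger0_norm ?nrm_ge0.
apply/cvg_nrmP => e /h; apply: filterS => t.
by rewrite sub0r normrN ger0_norm ?nrm_ge0.
Qed.

Lemma squeeze_nrm V T (F : set_system T) {FF : Filter F} (f : T -> V) (l : V)
    (g : T -> R) :
  (\forall t \near F, nrm (f t - l) <= g t) -> g t @[t --> F] --> (0 : R) ->
  f t @[t --> F] --> l.
Proof.
move=> fg g0; apply/cvg_nrm0P; apply: (@squeeze_cvgr _ _ _ _ (fun=> 0) g) => //.
  by near=> t; rewrite nrm_ge0 /=; near: t.
exact: cvg_cst.
Unshelve. all: by end_near. Qed.

Lemma cauchy_nrm_cvg (E : completeNormedModType R[i]) (u : nat -> E) :
  (forall e : R, 0 < e -> exists N, forall n m, (N <= n)%N -> (N <= m)%N ->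
     nrm (u n - u m) < e) ->
  exists l : E, u n @[n --> \oo] --> l.
Proof.
move=> h; suff: cvgn u by move=> /cvg_ex.
apply/cauchy_cvgP/cauchyP => /= e e0.
have er : e = (complex.Re e)%:C by rewrite RRe_real // gtr0_real.
have : 0 < complex.Re e by rewrite -(@ltcR R) -er.
move=> /h[N hN]; exists (u N); exists N => // n /= Nn.
by rewrite -ball_normE /ball_ /= normE er ltcR; apply: hN.
Qed.

End Nrm.
#[global] Hint Extern 0 (is_true (0 <= nrm _)) => exact: nrm_ge0 : core.
#[global] Hint Extern 0 (is_true (0 <= cabs _)) => exact: cabs_ge0 : core.

Section LinearProp.
Context {R : realType} {V W : lmodType R[i]} (f : V -> W) (lf : linear f).

Lemma linP_D x y : f (x + y) = f x + f y.
Proof. by have := lf 1 x y; rewrite !scale1r. Qed.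
Lemma linP_0 : f 0 = 0.
Proof. by apply: (addrI (f 0)); rewrite -linP_D !addr0. Qed.
Lemma linP_Z a x : f (a *: x) = a *: f x.
Proof. by have := lf a x 0; rewrite linP_0 !addr0. Qed.
Lemma linP_N x : f (- x) = - f x.
Proof. by rewrite -scaleN1r linP_Z scaleN1r. Qed.
Lemma linP_B x y : f (x - y) = f x - f y.
Proof. by rewrite linP_D linP_N. Qed.
End LinearProp.

Section BoundedOps.
Context {R : realType}.
Implicit Types V W E : normedModType R[i].

Lemma bounded_pos V W (f : V -> W) : bounded_operator f ->
  linear f /\ exists2 M : R, 1 <= M & forall x, nrm (f x) <= M * nrm x.
Proof.
move=> [lf [M hM]]; split => //; exists (Num.max 1 M); first by rewrite le_max lexx.
move=> x; apply: le_trans (hM x) _; apply: ler_wpM2r => //.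
by rewrite le_max lexx orbT.
Qed.

Lemma bounded_comp V W E (g : W -> E) (f : V -> W) :
  bounded_operator g -> bounded_operator f -> bounded_operator (fun x => g (f x)).
Proof.
move=> /bounded_pos[lg [M M1 hM]] [lf [N hN]]; split.
  by move=> a x y; rewrite lf lg.
exists (M * N) => x; apply: le_trans (hM _) _; rewrite -mulrA.
by apply: ler_wpM2l => //; rewrite (le_trans _ M1).
Qed.

Lemma bounded_add V W (g f : V -> W) :
  bounded_operator g -> bounded_operator f -> bounded_operator (fun x => g x + f x).
Proof.
move=> [lg [M hM]] [lf [N hN]]; split.
  by move=> a x y; rewrite lf lg; lmod.
exists (M + N) => x; apply: le_trans (ler_nrmD _ _) _; rewrite mulrDl; exact: lerD.
Qed.

Lemma bounded_scale V W (a : R[i]) (f : V -> W) :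
  bounded_operator f -> bounded_operator (fun x => a *: f x).
Proof.
move=> [lf [N hN]]; split; first by move=> b x y; rewrite lf; lmod.
by exists (cabs a * N) => x; rewrite nrmZ -mulrA; apply: ler_wpM2l.
Qed.

Lemma bounded_opp V W (f : V -> W) :
  bounded_operator f -> bounded_operator (fun x => - f x).
Proof.
move=> [lf [N hN]]; split; first by move=> b x y; rewrite lf; lmod.
by exists N => x; rewrite nrmN.
Qed.

Lemma bounded_sub V W (g f : V -> W) :
  bounded_operator g -> bounded_operator f -> bounded_operator (fun x => g x - f x).
Proof. by move=> bg bf; apply: bounded_add => //; apply: bounded_opp. Qed.

Lemma bounded_id V : bounded_operator (@id V).
Proof. by split=> //; exists 1 => x; rewrite mul1r. Qed.

Lemma bounded_cvg V W (f : V -> W) T (F : set_system T) {FF : Filter F} (u : T -> V) l :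
  bounded_operator f -> u t @[t --> F] --> l -> f (u t) @[t --> F] --> f l.
Proof.
move=> /bounded_pos[lf [M M1 hM]] /cvg_nrmP ul; apply/cvg_nrmP => e e0.
have M0 : 0 < M by rewrite (lt_le_trans _ M1).
have := ul (e / M); rewrite divr_gt0 // => /(_ isT); apply: filterS => t.
rewrite -(linP_B lf) ltr_pdivlMr // => h.
by rewrite (le_lt_trans (hM _)) // mulrC.
Qed.

End BoundedOps.

Section RealCvg.
Context {R : realType} {T : Type} (F : set_system T) {FF : Filter F}.
Implicit Types f g : T -> R.

Lemma squeeze_real f (l : R) g :
  (\forall t \near F, `|f t - l| <= g t) -> g t @[t --> F] --> (0 : R) ->
  f t @[t --> F] --> l.
Proof.
move=> fg /cvgrPdist_lt g0; apply/cvgrPdist_lt => e /g0; apply: filterS2 fg => t.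
rewrite sub0r normrN distrC => h1 /(le_lt_trans (ler_norm _)); exact: le_lt_trans.
Qed.

Lemma cvg_mul0 (c : R) g : g t @[t --> F] --> (0 : R) ->
  c * g t @[t --> F] --> (0 : R).
Proof. by move=> g0; rewrite -[X in _ --> X](mulr0 c); apply: cvgM g0; exact: cvg_cst. Qed.

Lemma cvg_add0 f g : f t @[t --> F] --> (0 : R) -> g t @[t --> F] --> (0 : R) ->
  f t + g t @[t --> F] --> (0 : R).
Proof. by move=> f0 g0; rewrite -[X in _ --> X](addr0 0); apply: cvgD. Qed.
End RealCvg.

Lemma cvg_nrm_lt (R : realType) (V : normedModType R[i]) T (F : set_system T)
    {FF : Filter F} (u : T -> V) l (e : R) :
  u t @[t --> F] --> l -> 0 < e -> \forall t \near F, nrm (u t - l) < e.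
Proof. by move=> /cvg_nrmP h /h. Qed.

Lemma cvg_nrm_seq (R : realType) (V : normedModType R[i]) (u : nat -> V) l (e : R) :
  u t @[t --> \oo] --> l -> 0 < e ->
  exists N, forall n, (N <= n)%N -> nrm (u n - l) < e.
Proof. by move=> ul e0; have [N _ h] := cvg_nrm_lt ul e0; exists N => n; exact: h. Qed.

(** * Inner products *)

(** An inner product that is only equivalent to the norm. On the product space
    the norm is the maximum norm, whereas the contraction property refers to the
    sum of squares; the factor 2 is the one relating the two. *)
Record hform (R : realType) (E : normedModType R[i]) := HForm {
  ip :> E -> E -> R[i];
  ip_linl : forall a x y z, ip (a *: x + y) z = a * ip x z + ip y z;
  ip_herm : forall x y, ip y x = conjc (ip x y);
  ip_lb : forall x, nrm x ^+ 2 <= complex.Re (ip x x);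
  ip_ub : forall x, complex.Re (ip x x) <= 2 * nrm x ^+ 2 }.

Section HForm.
Context {R : realType} {E : normedModType R[i]} (h : hform E).

Definition rp (x y : E) : R := complex.Re (h x y).

Lemma ipDl x y z : h (x + y) z = h x z + h y z.
Proof. by have := ip_linl h 1 x y z; rewrite scale1r mul1r. Qed.
Lemma ip0l z : h 0 z = 0.
Proof. by apply: (addrI (h 0 z)); rewrite -ipDl !addr0. Qed.
Lemma ipZl a x z : h (a *: x) z = a * h x z.
Proof. by have := ip_linl h a x 0 z; rewrite ip0l !addr0. Qed.
Lemma ipZr a x z : h x (a *: z) = conjc a * h x z.
Proof. by rewrite ip_herm ipZl rmorphM /= -ip_herm. Qed.
Lemma ipDr x y z : h x (y + z) = h x y + h x z.
Proof. by rewrite ip_herm ipDl rmorphD /= -!ip_herm. Qed.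
Lemma ip0r z : h z 0 = 0.
Proof. by apply: (addrI (h z 0)); rewrite -ipDr !addr0. Qed.
Lemma ip_suml z n (f : 'I_n -> E) : h (\sum_i f i) z = \sum_i h (f i) z.
Proof. by elim/big_ind2 : _ => [|x a y b <- <-|//]; rewrite ?ip0l ?ipDl. Qed.
Lemma ip_sumr z n (f : 'I_n -> E) : h z (\sum_i f i) = \sum_i h z (f i).
Proof. by elim/big_ind2 : _ => [|x a y b <- <-|//]; rewrite ?ip0r ?ipDr. Qed.

Lemma rpC x y : rp x y = rp y x.
Proof. by rewrite /rp ip_herm; case: (h y x). Qed.
Lemma rpDl x y z : rp (x + y) z = rp x z + rp y z.
Proof. by rewrite /rp ipDl; case: (h x z) (h y z) => [? ?] []. Qed.
Lemma rpDr x y z : rp x (y + z) = rp x y + rp x z.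
Proof. by rewrite rpC rpDl !(rpC x). Qed.
Lemma rp0l x : rp 0 x = 0.
Proof. by rewrite /rp ip0l. Qed.
Lemma rp0r x : rp x 0 = 0.
Proof. by rewrite rpC rp0l. Qed.
Lemma rpNl x y : rp (- x) y = - rp x y.
Proof. by apply/eqP; rewrite -addr_eq0 -rpDl addNr rp0l. Qed.
Lemma rpNr x y : rp x (- y) = - rp x y.
Proof. by rewrite rpC rpNl rpC. Qed.
Lemma rpBl x y z : rp (x - y) z = rp x z - rp y z.
Proof. by rewrite rpDl rpNl. Qed.
Lemma rpBr x y z : rp x (y - z) = rp x y - rp x z.
Proof. by rewrite rpDr rpNr. Qed.
Lemma rpZl (a : R) x y : rp (a%:C *: x) y = a * rp x y.
Proof. by rewrite /rp ipZl; case: (h x y) => u v /=; rewrite mul0r subr0. Qed.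
Lemma rpZr (a : R) x y : rp x (a%:C *: y) = a * rp x y.
Proof. by rewrite rpC rpZl rpC. Qed.
Lemma rpZZ (a : R[i]) x y : rp (a *: x) (a *: y) = cabs a ^+ 2 * rp x y.
Proof.
rewrite /rp ipZl ipZr mulrA sqr_cabs.
by case: a (h x y) => a b [c d] /=; ring.
Qed.
Lemma rp_Zl (a : R[i]) x : rp (a *: x) x = complex.Re a * rp x x.
Proof.
rewrite /rp ipZl; have := ip_herm h x x.
case: (h x x) => c d /= [/eqP]; rewrite -subr_eq0 opprK -mulr2n mulrn_eq0 /= => /eqP->.
by case: a => p q /=; rewrite mulr0 subr0.
Qed.
Lemma rp_ge0 x : 0 <= rp x x.
Proof. by rewrite (le_trans _ (ip_lb h x)) // exprn_ge0. Qed.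
Lemma rp_lb x : nrm x ^+ 2 <= rp x x. Proof. exact: ip_lb. Qed.
Lemma rp_ub x : rp x x <= 2 * nrm x ^+ 2. Proof. exact: ip_ub. Qed.

(** Rewriting with this collection expands a real inner product of linear
    combinations into products of atoms. *)
Definition rpE := (rpDl, rpDr, rpNl, rpNr, rpZl, rpZr).

Lemma rp_eq0 x : rp x x <= 0 -> x = 0.
Proof.
move=> x0; apply: nrm_le0; have := le_trans (rp_lb x) x0.
by rewrite -[X in _ <= X -> _](@expr0n _ 2) ler_pXn2r // nnegrE.
Qed.

(** The squared norm of [x] minus its projection onto [y] is nonnegative. *)
Lemma rp_CS x y : rp x y ^+ 2 <= rp x x * rp y y.
Proof.
have [y0|y0] := eqVneq (rp y y) 0.
  have -> : y = 0 by apply: rp_eq0; rewrite y0.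
  by rewrite !rp0r expr0n mulr0.
have yp : 0 < rp y y by rewrite lt_neqAle eq_sym y0 rp_ge0.
have := rp_ge0 (x - (rp x y / rp y y)%:C *: y).
rewrite !rpE (rpC y x) => H.
have : 0 <= (rp x x * rp y y - rp x y ^+ 2) / rp y y.
  by apply: le_trans H _; rewrite le_eqVlt; apply/orP; left; apply/eqP; field.
by rewrite pmulr_lge0 ?invr_gt0 // subr_ge0.
Qed.

Lemma rp_bound x y : `|rp x y| <= 2 * nrm x * nrm y.
Proof.
rewrite -(@ler_pXn2r _ 2) ?nnegrE ?mulr_ge0 // real_normK ?num_real //.
apply: le_trans (rp_CS x y) _.
apply: le_trans (ler_pM (rp_ge0 x) (rp_ge0 y) (rp_ub x) (rp_ub y)) _.
by rewrite le_eqVlt; apply/orP; left; apply/eqP; ring.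
Qed.

Lemma rp_cvgl T (F : set_system T) {FF : Filter F} (u : T -> E) l y :
  u t @[t --> F] --> l -> rp (u t) y @[t --> F] --> rp l y.
Proof.
move=> /cvg_nrm0P ul.
apply: (@squeeze_real _ _ _ _ _ _ (fun t => (2 * nrm y) * nrm (u t - l))).
  by near=> t; rewrite -rpBl mulrAC rp_bound.
exact: cvg_mul0.
Unshelve. all: by end_near. Qed.

End HForm.

Section HilbertForm.
Context {R : realType} {H : hilbertType R}.

Lemma inner_linl (a : R[i]) (x y z : H) : inner (a *: x + y) z = a * inner x z + inner y z.
Proof. exact: linearPl. Qed.

Lemma inner_herm (x y : H) : inner y x = conjc (inner x y).
Proof. by rewrite hermC expr0 mul1r. Qed.

Lemma re_inner (x : H) : complex.Re (inner x x) = nrm x ^+ 2.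
Proof. by rewrite inner_norm normE -rmorphXn. Qed.

Lemma inner_ub (x : H) : complex.Re (inner x x) <= 2 * nrm x ^+ 2.
Proof. by rewrite re_inner ler_peMl ?exprn_ge0 // ler1n. Qed.

Lemma inner_lb (x : H) : nrm x ^+ 2 <= complex.Re (inner x x).
Proof. by rewrite re_inner. Qed.

Definition hil : hform H := HForm inner_linl inner_herm inner_lb inner_ub.

Lemma innerDl (x y z : H) : inner (x + y) z = inner x z + inner y z.
Proof. exact: (ipDl hil). Qed.
Lemma innerDr (x y z : H) : inner x (y + z) = inner x y + inner x z.
Proof. exact: (ipDr hil). Qed.
Lemma innerZl a (x z : H) : inner (a *: x) z = a * inner x z.
Proof. exact: (ipZl hil). Qed.
Lemma innerZr a (x z : H) : inner x (a *: z) = conjc a * inner x z.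
Proof. exact: (ipZr hil). Qed.
Lemma inner0r (z : H) : inner z 0 = 0.
Proof. exact: (ip0r hil). Qed.

Lemma rp_hil (x : H) : rp hil x x = nrm x ^+ 2.
Proof. exact: re_inner. Qed.

Lemma rp_hil_bound (x y : H) : `|rp hil x y| <= nrm x * nrm y.
Proof.
rewrite -(@ler_pXn2r _ 2) ?nnegrE ?mulr_ge0 // real_normK ?num_real //.
by apply: le_trans (rp_CS _ x y) _; rewrite !rp_hil exprMn.
Qed.

Lemma rp_hil_le (x y : H) : rp hil x y <= nrm x * nrm y.
Proof. exact: le_trans (ler_norm _) (rp_hil_bound _ _). Qed.

End HilbertForm.

(** * The product space as a Hilbert space *)
Section ProductForm.
Context {R : realType} {X Z : hilbertType R}.
Implicit Types p q : (X * Z)%type.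

Lemma nrm_pair p : nrm p = Num.max (nrm p.1) (nrm p.2).
Proof.
apply: (@complexI R); rewrite -normE prod_normE.
rewrite !normE /Order.max /= ltcR; by case: ifP.
Qed.

Lemma nrm_pair_le p (M : R) : (nrm p <= M) = (nrm p.1 <= M) && (nrm p.2 <= M).
Proof. by rewrite nrm_pair ge_max. Qed.

Definition pip p q : R[i] := inner p.1 q.1 + inner p.2 q.2.

Lemma pip_linl a p q r : pip (a *: p + q) r = a * pip p r + pip q r.
Proof. by rewrite /pip /= !inner_linl; ring. Qed.
Lemma pip_herm p q : pip q p = conjc (pip p q).
Proof. by rewrite /pip (inner_herm p.1) (inner_herm p.2) rmorphD. Qed.
Lemma re_pip p : complex.Re (pip p p) = nrm p.1 ^+ 2 + nrm p.2 ^+ 2.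
Proof. by rewrite -!re_inner /pip; case: (inner p.1 p.1) (inner p.2 p.2) => ? ? []. Qed.
Lemma pip_lb p : nrm p ^+ 2 <= complex.Re (pip p p).
Proof.
rewrite re_pip nrm_pair; case: (leP (nrm p.1) (nrm p.2)) => _.
  by rewrite lerDr exprn_ge0.
by rewrite lerDl exprn_ge0.
Qed.
Lemma pip_ub p : complex.Re (pip p p) <= 2 * nrm p ^+ 2.
Proof.
rewrite re_pip (_ : 2 * _ = nrm p ^+ 2 + nrm p ^+ 2); last by ring.
have := lexx (nrm p); rewrite {1}nrm_pair_le => /andP[h1 h2].
by rewrite lerD // ler_pXn2r // nnegrE.
Qed.
Definition prodform : hform (X * Z)%type := HForm pip_linl pip_herm pip_lb pip_ub.

Lemma rp_prodE p q : rp prodform p q = rp hil p.1 q.1 + rp hil p.2 q.2.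
Proof. by rewrite /rp /= /pip; case: (inner p.1 q.1) (inner p.2 q.2) => ? ? []. Qed.
End ProductForm.

(* Makes the pointed topology of a product canonical. *)
HB.saturate prod.
Section ProductComplete.
Context {K : numFieldType} (X Z : completeNormedModType K).

Lemma prod_cauchy_cvg (F : set_system (X * Z)%type) : ProperFilter F ->
  cauchy F -> cvg F.
Proof.
move=> FF /cauchyP cF.
have c1 : cvg (fst p @[p --> F]).
  apply/cauchy_cvgP/cauchyP => e e0; have [p Fp] := cF e e0.
  by exists p.1; rewrite /fmap /=; apply: filterS Fp => q [].
have c2 : cvg (snd p @[p --> F]).
  apply/cauchy_cvgP/cauchyP => e e0; have [p Fp] := cF e e0.
  by exists p.2; rewrite /fmap /=; apply: filterS Fp => q [].
apply/cvg_ex; exists (lim (fst p @[p --> F]), lim (snd p @[p --> F])).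
move=> N hN; have := cvg_pair c1 c2 hN.
move=> /(_ _ _ _) h.
suff : nbhs F ((fun x : X * Z => (x.1, x.2)) @^-1` N) by
  apply: (@filterS _ _ (FF : Filter F)) => -[a b].
exact: h.
Qed.

HB.instance Definition _ := Uniform_isComplete.Build (X * Z)%type prod_cauchy_cvg.
End ProductComplete.

(** * Projections, functionals and adjoints *)
Section Projection.
Context {R : realType} {E : completeNormedModType R[i]} (h : hform E).
Local Notation rp := (rp h).

Definition linear_subset (M : set E) := M 0 /\ forall a x y, M x -> M y -> M (a *: x + y).
Definition seq_closed (M : set E) :=
  forall (u : nat -> E) l, (forall n, M (u n)) -> u n @[n --> \oo] --> l -> M l.

(** Maximizing the left-hand side over [t] gives [b ^+ 2 / c]. *)
Lemma quad_bound (b c d : R) : 0 <= c -> 0 <= d ->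
  (forall t, 2 * t * b - t ^+ 2 * c <= d) -> b ^+ 2 <= c * d.
Proof.
move=> c0 d0 H; have [cz|cz] := eqVneq c 0.
  have [->|b0] := eqVneq b 0; first by rewrite expr0n mulr_ge0.
  have := H ((d + 1) / (2 * b)); rewrite cz mulr0 subr0.
  have -> : 2 * ((d + 1) / (2 * b)) * b = d + 1 by field.
  by move=> ?; lra.
have cp : 0 < c by rewrite lt_neqAle eq_sym cz.
have := H (b / c).
have -> : 2 * (b / c) * b - (b / c) ^+ 2 * c = b ^+ 2 / c by field.
by rewrite ler_pdivrMr // mulrC.
Qed.

(** A minimizing sequence is a Cauchy sequence by the parallelogram identity,
    and its limit is orthogonal to the subspace by [quad_bound]. *)
Lemma projection (M : set E) (x : E) : linear_subset M -> seq_closed M ->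
  exists2 m, M m & forall v, M v -> rp (x - m) v = 0.
Proof.
move=> [M0 Mlin] Mcl.
pose A := [set r | exists2 m, M m & r = rp (x - m) (x - m)].
have hA : has_inf A.
  split; first by exists (rp (x - 0) (x - 0)), 0.
  by exists 0 => _ [m _ ->]; exact: rp_ge0.
have dA m : M m -> inf A <= rp (x - m) (x - m).
  by move=> Mm; apply: inf_lbound; [case: hA|exists m].
have d0 : 0 <= inf A.
  apply: lb_le_inf; first by case: hA.
  by move=> _ [m _ ->]; exact: rp_ge0.
have /choice[u hu] : forall n : nat, exists m, M m /\
    rp (x - m) (x - m) < inf A + n.+1%:R^-1.
  move=> n; have n0 : (0 : R) < n.+1%:R^-1 by rewrite invr_gt0 ltr0n.
  by have [_ [m Mm ->] lt] := inf_adherent n0 hA; exists m.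
have Mu n : M (u n) by case: (hu n).
have half n k : rp (u n - u k) (u n - u k) <= 2 * (n.+1%:R^-1 + k.+1%:R^-1).
  have [_ hn] := hu n; have [_ hk] := hu k.
  (* The midpoint of two almost minimizers is no better than the infimum. *)
  have := dA ((2^-1)%:C *: u n + (2^-1)%:C *: u k).
  have hm : M ((2^-1)%:C *: u n + (2^-1)%:C *: u k).
    by apply: (Mlin) => //; rewrite -[_ *: _]addr0; apply: (Mlin).
  move=> /(_ hm); move: hn hk.
  rewrite !rpE !(rpC h (u n) x) !(rpC h (u k) x) !(rpC h (u k) (u n)).
  move: (n.+1%:R^-1) (k.+1%:R^-1) (inf A) => rn rk iA; lra.
have [n_inv|l ul] := @cauchy_nrm_cvg _ _ u.
  move=> e0; have e4 : 0 < n_inv ^+ 2 / 4 by rewrite divr_gt0 ?exprn_gt0.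
  have [N _ hN] := near_infty_natSinv_lt (PosNum e4).
  exists N => n m Nn Nm.
  rewrite -(@ltr_pXn2r _ 2) ?nnegrE //; last exact: ltW.
  apply: le_lt_trans (rp_lb h _) _; apply: le_lt_trans (half n m) _.
  have := hN _ Nn; have := hN _ Nm; rewrite /=.
  by move: (n.+1%:R^-1) (m.+1%:R^-1) => rn rm *; lra.
exists l; first exact: (Mcl u).
move=> v Mv.
have bd n : rp (x - u n) v ^+ 2 <= rp v v * n.+1%:R^-1.
  apply: quad_bound; rewrite ?rp_ge0 // => t.
  have [_ hn] := hu n.
  have hm : M (t%:C *: v + u n) by apply: Mlin.
  have := dA _ hm; move: hn.
  rewrite !rpE !(rpC h (u n) x) !(rpC h v x) !(rpC h v (u n)).
  by move: (n.+1%:R^-1) (inf A) => rn iA *; lra.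
have c1 : rp (x - u n) v @[n --> \oo] --> rp (x - l) v.
  by apply: rp_cvgl; apply: cvgB ul; exact: cvg_cst.
have c2 : rp (x - u n) v @[n --> \oo] --> (0 : R).
  have c3 : rp v v * n.+1%:R^-1 @[n --> \oo] --> (0 : R).
    by apply: (@cvg_mul0 R nat \oo _ (rp v v) (@harmonic R)); exact: cvg_harmonic.
  apply/cvgrPdist_lt => e e0.
  have e2 : 0 < e ^+ 2 by rewrite exprn_gt0.
  near=> n.
  have : `|0 - rp v v * n.+1%:R^-1| < e ^+ 2.
    by near: n; exact: ((cvgrPdist_lt _ _).1 c3 _ e2).
  rewrite !sub0r !normrN => lt.
  rewrite -(@ltr_pXn2r _ 2) ?nnegrE ?(ltW e0) // real_normK ?num_real //.
  by apply: le_lt_trans (bd n) _; apply: le_lt_trans (ler_norm _) lt.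
exact: (cvg_unique _ c1 c2).
Unshelve. all: by end_near. Qed.

End Projection.

Section Riesz.
Context {R : realType} {H : hilbertType R}.

(** The representing vector is a multiple of the component [e], orthogonal to
    the kernel, of any vector outside the kernel. *)
Lemma riesz (f : H -> R[i]) (M : R) :
  (forall a x y, f (a *: x + y) = a * f x + f y) ->
  (forall x, cabs (f x) <= M * nrm x) ->
  exists z, forall x, f x = inner x z.
Proof.
move=> fl fb.
have f0 : f 0 = 0 by have := fl (-1) 0 0; rewrite scaler0 addr0 mulN1r addNr.
have fD x y : f (x + y) = f x + f y by have := fl 1 x y; rewrite scale1r mul1r.
have fZ a x : f (a *: x) = a * f x by have := fl a x 0; rewrite f0 !addr0.
pose K := [set x | f x = 0].
have Ksub : linear_subset K.
  by split=> // a x y /= fx fy; rewrite /K /= fl fx fy mulr0 addr0.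
have Kcl : seq_closed K.
  move=> u l Ku ul; rewrite /K /=; apply/eqP; rewrite -cabs_eq0 eq_le cabs_ge0 andbT.
  have b n : cabs (f l) <= `|M| * nrm (u n - l).
    have -> : f l = - f (u n - l).
      by rewrite (_ : u n - l = -1 *: l + u n) ?fl ?(Ku n : f (u n) = 0); [ring|lmod].
    by rewrite cabsN (le_trans (fb _)) // ler_wpM2r // ler_norm.
  have c : `|M| * nrm (u n - l) @[n --> \oo] --> (0 : R).
    by apply: cvg_mul0; apply/cvg_nrm0P.
  by apply: (ler_cvg_to (cvg_cst _) c); exact: nearW.
have [[x0 x0P]|] := pselect (exists x, f x <> 0); last first.
  move=> /forallNP hn; exists 0 => x.
  by rewrite inner0r; exact: contrapT (hn x).
have [m Km mo] := projection hil x0 Ksub Kcl.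
set e := x0 - m in mo.
have fe : f e = f x0 by rewrite (_ : e = -1 *: m + x0) ?fl ?(Km : f m = 0); [ring|rewrite /e; lmod].
have oi v : K v -> inner e v = 0.
  move=> Kv; have h1 := mo v Kv.
  have Kiv : K ('i *: v) by rewrite /K /= fZ (Kv : f v = 0) mulr0.
  have h2 := mo _ Kiv; move: h1 h2; rewrite /rp /= innerZr.
  case: (inner e v) => a b /=; rewrite !mul0r !mulN1r sub0r opprK => -> ->.
  by [].
have e0 : inner e e != 0.
  rewrite inner_norm expf_neq0 // normr_eq0.
  by apply/eqP => ez; move: fe; rewrite ez f0 => /esym.
exists (conjc (f e / inner e e) *: e) => x; rewrite innerZr conjcK.
have Kx : K (x - (f x / f e) *: e).
  by rewrite /K /= -scaleNr fD fZ mulNr divfK ?subrr // fe; apply/eqP.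
have := oi _ Kx; move=> /(congr1 conjc).
rewrite -inner_herm conjc0 -scaleNr addrC inner_linl.
move/eqP; rewrite mulNr addrC subr_eq0 => /eqP ->.
have fe0 : f e != 0 by rewrite fe; apply/eqP.
by field; apply/andP; split.
Qed.

End Riesz.

Section Adjoint.
Context {R : realType} {H : hilbertType R}.
Implicit Types T : H -> H.

Lemma cabs_inner (x y : H) : cabs (inner x y) <= 2 * nrm x * nrm y.
Proof.
have h1 := rp_hil_bound x y.
have h2 := rp_hil_bound x ('i *: y).
rewrite nrmZ in h2; have ci : cabs ('i : R[i]) = 1.
  by apply: (@complexI R); rewrite -cabsE normc_def /= expr0n expr1n add0r sqrtr1.
rewrite ci mul1r in h2.
have nn : 0 <= nrm x * nrm y by rewrite mulr_ge0.
have p : 0 <= 2 * nrm x * nrm y by rewrite !mulr_ge0.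
rewrite -(@ler_pXn2r _ 2) ?nnegrE // sqr_cabs.
have -> : complex.Im (inner x y) = rp hil x ('i *: y).
  rewrite /rp /= innerZr; case: (inner x y) => a b /=.
  by rewrite mul0r sub0r mulN1r opprK.
have -> : complex.Re (inner x y) = rp hil x y by [].
have s (t : R) : `|t| <= nrm x * nrm y -> t ^+ 2 <= (nrm x * nrm y) ^+ 2.
  by move=> tl; rewrite -real_normK ?num_real // ler_pXn2r // nnegrE.
by apply: le_trans (lerD (s _ h1) (s _ h2)) _; nra.
Qed.

(** Until the functional is represented, [adjoint] might be its default value 0;
    boundedness lets [riesz] apply. *)
Lemma adjointP T : bounded_operator T ->
  forall x y, inner (T x) y = inner x (adjoint T y).
Proof.
move=> [lT [M hM]] x y; move: x.
apply: (@xgetPex _ 0 [set z | forall x, inner (T x) y = inner x z]).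
apply: (@riesz _ _ _ (2 * M * nrm y)).
  by move=> a x z; rewrite lT inner_linl.
move=> x; apply: le_trans (cabs_inner _ _) _.
rewrite (mulrAC _ (nrm y)) ler_wpM2r // -mulrA; apply: ler_wpM2l => //.
Qed.

Lemma rp_re_op T x : bounded_operator T -> rp hil (re_op T x) x = rp hil (T x) x.
Proof.
move=> bT; have h := adjointP bT x x; rewrite inner_herm in h.
have -> : re_op T x = (2^-1)%:C *: (T x + adjoint T x).
  by rewrite /re_op fmorphV rmorph_nat.
rewrite rpZl rpDl.
have -> : rp hil (adjoint T x) x = rp hil (T x) x.
  by rewrite [RHS]/rp /= inner_herm h rpC.
by field.
Qed.

Lemma ge_scalar_re_op T c : bounded_operator T -> ge_scalar (re_op T) c ->
  forall x, c * nrm x ^+ 2 <= rp hil (T x) x.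
Proof.
move=> bT [_ h] x; have := h x; rewrite lecE => /andP[_] /=.
have -> : complex.Re (inner (re_op T x - c%:C *: x) x) =
  rp hil (re_op T x - c%:C *: x) x by [].
by rewrite rpBl rpZl rp_re_op // rp_hil subr_ge0.
Qed.

Lemma re_op_sym T : bounded_operator T ->
  forall x y, inner (re_op T x) y = inner x (re_op T y).
Proof.
move=> bT x y; rewrite /re_op innerZl innerZr innerDl innerDr -!adjointP //.
have -> : inner (adjoint T x) y = inner x (T y).
  by rewrite inner_herm -adjointP // -inner_herm.
rewrite addrC; congr (_ * _).
by rewrite -(rmorph_nat (real_complex R) 2) -fmorphV conjc_real.
Qed.

Lemma adjoint_bound T m : bounded_operator T -> (forall x, nrm (T x) <= m * nrm x) ->
  forall x, nrm (adjoint T x) <= m * nrm x.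
Proof.
move=> bT hm x; set z := adjoint T x.
have := rp_hil z; have -> : rp hil z z = rp hil (T z) x.
  by rewrite /rp /= /z -adjointP.
move=> e; have := rp_hil_le (T z) x; rewrite e => h1.
have [z0|z0] := eqVneq (nrm z) 0.
  rewrite z0 in hm *; have := hm x; have := nrm_ge0 (T x); exact: le_trans.
have zp : 0 < nrm z by rewrite lt_neqAle eq_sym z0 nrm_ge0.
rewrite -(ler_pM2l zp) -expr2; apply: le_trans h1 _.
by rewrite mulrCA mulrA; apply: ler_wpM2r => //; rewrite mulrC.
Qed.

Lemma re_op_bound T m : bounded_operator T -> (forall x, nrm (T x) <= m * nrm x) ->
  forall x, nrm (re_op T x) <= m * nrm x.
Proof.
move=> bT hm x; have h1 := hm x; have h2 := adjoint_bound bT hm x.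
have -> : re_op T x = (2^-1)%:C *: (T x + adjoint T x).
  by rewrite /re_op fmorphV rmorph_nat.
rewrite nrmZ cabs_real ger0_norm ?invr_ge0 //.
by have := ler_nrmD (T x) (adjoint T x); lra.
Qed.

(** Nonnegativity at [x - T x / m], where the term of second order is absorbed
    by the bound [m] of [T]. *)
Lemma sym_cocoercive T m : 0 < m ->
  (forall x y, inner (T x) y = inner x (T y)) ->
  (forall x, 0 <= rp hil (T x) x) ->
  (forall x, nrm (T x) <= m * nrm x) ->
  forall x, m^-1 * nrm (T x) ^+ 2 <= rp hil (T x) x.
Proof.
move=> m0 sT pT hm x.
have rs a b : rp hil (T a) b = rp hil a (T b) by rewrite /rp /= sT.
have := pT (x - m^-1%:C *: T x).
rewrite rpBr rpZr (rs _ x) (rs _ (T x)) !rpBl !rpZl -(rs x (T x)) rp_hil.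
rewrite (rpC _ x) (rpC _ (T x) (T (T x))).
have b : rp hil (T (T x)) (T x) <= m * nrm (T x) ^+ 2.
  apply: le_trans (rp_hil_le _ _) _; rewrite expr2 mulrA.
  exact: ler_wpM2r.
move: b; set a := rp hil (T (T x)) (T x); set c := rp hil (T x) x; set d := _ ^+ 2.
move=> b h.
have : m^-1 * (m^-1 * a) <= m^-1 * d.
  rewrite ler_pM2l ?invr_gt0 //.
  by rewrite -(ler_pM2l m0) mulrA divff ?mul1r // gt_eqF.
by move: h; lra.
Qed.

Lemma nonneg_cocoercive T : bounded_operator T -> nonneg_op T ->
  exists2 g, 0 < g & forall x, g * nrm (T x) ^+ 2 <= rp hil (T x) x.
Proof.
move=> /bounded_pos[_ [m m1 hm]] [sT pT].
have m0 : 0 < m by rewrite (lt_le_trans _ m1).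
exists m^-1; first by rewrite invr_gt0.
apply: sym_cocoercive => // x.
by have := pT x; rewrite lecE => /andP[].
Qed.

(** An invertible nonnegative real part is bounded away from 0: by
    cocoercivity its form dominates the square of its norm. *)
Lemma accretive_inv T : bounded_operator T -> (forall x, 0 <= rp hil (T x) x) ->
  boundedly_invertible (re_op T) ->
  exists2 c, 0 < c & forall x, c * nrm x ^+ 2 <= rp hil (T x) x.
Proof.
move=> bT pT [g [/bounded_pos[_ [k k1 hk]] gf _]].
have [_ [m m1 hm]] := bounded_pos bT.
have m0 : 0 < m by rewrite (lt_le_trans _ m1).
have k0 : 0 < k by rewrite (lt_le_trans _ k1).
have cc := @sym_cocoercive (re_op T) m m0 (re_op_sym bT) _ (re_op_bound bT hm).
exists (m^-1 * (k ^+ 2)^-1); first by rewrite mulr_gt0 // invr_gt0 // exprn_gt0.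
move=> x; rewrite -rp_re_op //; apply: le_trans (cc _ x) => //; last first.
  by move=> y; rewrite rp_re_op.
rewrite -mulrA ler_pM2l ?invr_gt0 // ler_pdivrMl ?exprn_gt0 //.
rewrite -exprMn ler_pXn2r ?nnegrE ?mulr_ge0 // ?(ltW k0) //.
by rewrite -{1}(gf x).
Qed.

End Adjoint.

(** * Neumann series and the continuity method *)
Section Neumann.
Context {R : realType} {E : completeNormedModType R[i]}.

(** The fixed point is the limit of the Picard iterates started at 0. *)
Lemma neumann (K : E -> E) (q : R) : linear K -> 0 <= q < 1 ->
  (forall x, nrm (K x) <= q * nrm x) -> forall y, exists x, x = y + K x.
Proof.
move=> lK /andP[q0 q1] hK y.
have q1' : 0 < 1 - q by rewrite subr_gt0.
pose u n := iter n (fun x => y + K x) 0.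
pose c := nrm y / (1 - q).
have c0 : 0 <= c by rewrite divr_ge0 // ltW.
have ub k : nrm (u k) <= c.
  elim: k => [|k IH]; first by rewrite nrm0.
  rewrite /u iterS -/(u k); apply: le_trans (ler_nrmD _ _) _.
  have -> : c = nrm y + q * c by rewrite /c; field; rewrite gt_eqF.
  by apply: lerD => //; apply: le_trans (hK _) _; apply: ler_wpM2l.
have ud n k : nrm (u (n + k)%N - u n) <= q ^+ n * c.
  elim: n => [|n IH]; first by rewrite subr0 expr0 mul1r.
  rewrite addSn /u !iterS -/(u _) -/(u n).
  have -> : y + K (u (n + k)%N) - (y + K (u n)) = K (u (n + k)%N - u n).
    by rewrite (linP_B lK); lmod.
  by apply: le_trans (hK _) _; rewrite exprS -mulrA; apply: ler_wpM2l.
have qc : q ^+ n * c @[n --> \oo] --> (0 : R).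
  under eq_fun do rewrite mulrC.
  by apply: cvg_mul0; apply: cvg_expr; rewrite ger0_norm.
have [l ul] : exists l : E, u n @[n --> \oo] --> l.
  apply: cauchy_nrm_cvg => e e0.
  have e2 : 0 < e / 2 by rewrite divr_gt0.
  have [N _ hN] := (cvgrPdist_lt _ _).1 qc _ e2.
  have := hN N (leqnn _); rewrite /= sub0r normrN => /(le_lt_trans (ler_norm _)) lt.
  exists N => n m Nn Nm.
  apply: le_lt_trans (ler_nrm_dist _ (u N) _) _; rewrite (nrmBC (u N)).
  have := ud N (n - N)%N; have := ud N (m - N)%N; rewrite !subnKC //.
  by move: lt; lra.
exists l.
have bK : bounded_operator K by split=> //; exists q.
have c1 : u n.+1 @[n --> \oo] --> y + K l.
  by apply: cvgD; [exact: cvg_cst|exact: bounded_cvg bK ul].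
have c2 : u n.+1 @[n --> \oo] --> l by rewrite (cvg_shiftS u).
exact: (cvg_unique _ c2 c1).
Qed.

End Neumann.

Section Operators.
Context {R : realType}.

(** The values of an unbounded operator outside its domain are arbitrary, so
    linearity is asked on the domain only. *)
Definition lin_op (V W : normedModType R[i]) (D : set V) (A : V -> W) : Prop :=
  D 0 /\ forall a x y, D x -> D y -> D (a *: x + y) /\ A (a *: x + y) = a *: A x + A y.

Section LinOp.
Context {V W : normedModType R[i]} (D : set V) (A : V -> W) (lA : lin_op D A).

Lemma lin_op0 : A 0 = 0.
Proof.
have [D0 h] := lA; have [_] := h (-1) _ _ D0 D0.
by rewrite scaler0 addr0 => ->; lmod.
Qed.
Lemma lin_opD x y : D x -> D y -> D (x + y) /\ A (x + y) = A x + A y.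
Proof. by move=> Dx Dy; have [_ h] := lA; have := h 1 x y Dx Dy; rewrite !scale1r. Qed.
Lemma lin_opZ a x : D x -> D (a *: x) /\ A (a *: x) = a *: A x.
Proof.
by move=> Dx; have [D0 h] := lA; have := h a x 0 Dx D0; rewrite lin_op0 !addr0.
Qed.
Lemma lin_opB x y : D x -> D y -> D (x - y) /\ A (x - y) = A x - A y.
Proof.
move=> Dx Dy; have [_ h] := lA; have := h (-1) y x Dy Dx.
by rewrite !scaleN1r !(addrC (- _)).
Qed.
End LinOp.

(** If [A + s K] is surjective for one [s], then for every [s'] whose distance
    to [s] is less than a step depending only on the a priori bound and on [K],
    by a Neumann series; finitely many steps lead from 0 to 1. *)
Lemma continuity_method (V : completeNormedModType R[i]) (D : set V)
    (A : V -> V) (K : V -> V) (M : R) :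
  lin_op D A -> bounded_operator K ->
  (forall s x, 0 <= s <= 1 -> D x -> nrm x <= M * nrm (A x + s%:C *: K x)) ->
  (forall y, exists2 x, D x & A x = y) ->
  forall y, exists2 x, D x & A x + K x = y.
Proof.
move=> lA /bounded_pos[lK [k k1 hk]] lb0 surj.
have k0 : 0 < k by rewrite (lt_le_trans _ k1).
pose m := Num.max 1 M.
have m1 : 1 <= m by rewrite le_max lexx.
have m0 : 0 < m by rewrite (lt_le_trans _ m1).
have lb s x : 0 <= s <= 1 -> D x -> nrm x <= m * nrm (A x + s%:C *: K x).
  move=> hs Dx; apply: le_trans (lb0 s x hs Dx) _; apply: ler_wpM2r => //.
  by rewrite le_max lexx orbT.
pose B s x := A x + s%:C *: K x.
have lB s : lin_op D (B s).
  split; first by case: lA.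
  move=> a x y Dx Dy; have [_ h] := lA; have [D1 e] := h a x y Dx Dy.
  by split=> //; rewrite /B e lK; lmod.
have inj s x y : 0 <= s <= 1 -> D x -> D y -> B s x = B s y -> x = y.
  move=> hs Dx Dy e; apply/eqP; rewrite -subr_eq0; apply/eqP/nrm_le0.
  have [Dd ed] := lin_opB (lB s) Dx Dy.
  by have := lb s _ hs Dd; rewrite -/(B s _) ed e subrr nrm0 mulr0.
pose sur s := forall y, exists2 x, D x & B s x = y.
have step s t : 0 <= s <= 1 -> `|t - s| * (m * k) < 1 -> sur s -> sur t.
  move=> hs lt ss y.
  have /choice[S hS] : forall y, exists x, D x /\ B s x = y.
    by move=> z; have [x Dx e] := ss z; exists x.
  have lS : linear S.
    move=> a u v; have [Du eu] := hS u; have [Dv ev] := hS v.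
    have [_ h] := lB s; have [D1 e1] := h a _ _ Du Dv.
    have [D2 e2] := hS (a *: u + v).
    by apply: (inj s) => //; rewrite e2 e1 eu ev.
  have bS z : nrm (S z) <= m * nrm z.
    by have [Dz ez] := hS z; rewrite -{2}ez; exact: lb.
  (* With S the inverse at s, the equation at t is a fixed point problem. *)
  have [z zE] : exists z, z = y + (- (t - s)%:C) *: K (S z).
    apply: (@neumann _ _ (fun z => (- (t - s)%:C) *: K (S z)) (`|t - s| * (m * k))) => //.
    - by move=> a u v; rewrite lS lK; lmod.
    - by rewrite lt mulr_ge0 // mulr_ge0 // ltW.
    - move=> x; rewrite nrmZ cabsN cabs_real -mulrA ler_wpM2l //.
      apply: le_trans (hk _) _; rewrite (mulrC m) -mulrA.
      by apply: ler_wpM2l; [exact: ltW|exact: bS].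
  have [Dz ez] := hS z; exists (S z) => //.
  have -> : B t (S z) = B s (S z) + (t - s)%:C *: K (S z).
    by rewrite /B rmorphB /=; lmod.
  by rewrite ez {1}zE; lmod.
have [n hn] : exists n : nat, m * k < n.+1%:R.
  have mk : 0 < (m * k)^-1 by rewrite invr_gt0 mulr_gt0.
  have [N _ hN] := near_infty_natSinv_lt (PosNum mk).
  have := hN N (leqnn _) => /=; rewrite ltf_pV2 ?posrE ?mulr_gt0 // => lt.
  by exists N.
have n0 : (0 : R) < n.+1%:R by rewrite ltr0n.
have all_s j : (j <= n.+1)%N -> sur (j%:R / n.+1%:R).
  elim: j => [_|j IH jn].
    by move=> y; have [x Dx e] := surj y; exists x => //; rewrite /B mul0r scale0r addr0.
  apply: (step (j%:R / n.+1%:R)); last exact: IH (ltnW jn).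
    rewrite divr_ge0 //= ler_pdivrMr // mul1r ler_nat; exact: ltnW.
  rewrite -mulrBl -natrB // subSnn mul1r ger0_norm ?invr_ge0 ?ltW //.
  by rewrite mulrC ltr_pdivrMr // mul1r.
have := all_s n.+1 (leqnn _); rewrite divff ?gt_eqF // => s1 y.
by have [x Dx e] := s1 y; exists x => //; rewrite -e /B scale1r.
Qed.

(** * Resolvents *)
Section Rho.
Context {V : completeNormedModType R[i]} (A : operator V V).

Lemma rho_intro l M : lin_op (dom A) A ->
  (forall x, dom A x -> nrm x <= M * nrm (l *: x - A x)) ->
  (forall y, exists2 x, dom A x & l *: x - A x = y) -> rho A l.
Proof.
move=> lA lb surj.
have /choice[S hS] : forall y, exists x, dom A x /\ l *: x - A x = y.
  by move=> z; have [x Dx e] := surj z; exists x.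
have inj x y : dom A x -> dom A y -> l *: x - A x = l *: y - A y -> x = y.
  move=> Dx Dy e; apply/eqP; rewrite -subr_eq0; apply/eqP/nrm_le0.
  have [Dd ed] := lin_opB lA Dx Dy.
  have := lb _ Dd; rewrite ed.
  have -> : l *: (x - y) - (A x - A y) = (l *: x - A x) - (l *: y - A y) by lmod.
  by rewrite e subrr nrm0 mulr0.
exists S; split.
- split; last first.
    by exists M => y; have [Dy ey] := hS y; rewrite -{2}ey; exact: lb.
  move=> a u v; have [Du eu] := hS u; have [Dv ev] := hS v.
  have [_ h] := lA; have [D1 e1] := h a _ _ Du Dv.
  have [D2 e2] := hS (a *: u + v).
  by apply: inj => //; rewrite e2 e1 -{1}eu -{1}ev; lmod.
- exact: hS.
- move=> x Dx; have [D1 e1] := hS (l *: x - A x); exact: inj.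
Qed.

Lemma resolventE l S : (forall y, dom A (S y) /\ l *: S y - A (S y) = y) ->
  (forall x, dom A x -> S (l *: x - A x) = x) -> resolvent A l = S.
Proof.
move=> h1 h2; apply/funext => y.
have [Dx ex] := @xgetPex _ 0 [set x | dom A x /\ l *: x - A x = y] (ex_intro _ _ (h1 y)).
by rewrite -[LHS]h2 // ex.
Qed.

Context (l : R[i]) (rl : rho A l).

Lemma res_bounded : bounded_operator (resolvent A l).
Proof. by have [S [bS h1 h2]] := rl; rewrite (resolventE h1 h2). Qed.
Lemma res_dom y : dom A (resolvent A l y).
Proof. by have [S [bS h1 h2]] := rl; rewrite (resolventE h1 h2); case: (h1 y). Qed.
Lemma res_right y : l *: resolvent A l y - A (resolvent A l y) = y.
Proof. by have [S [bS h1 h2]] := rl; rewrite (resolventE h1 h2); case: (h1 y). Qed.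
Lemma res_left x : dom A x -> resolvent A l (l *: x - A x) = x.
Proof. by have [S [bS h1 h2]] := rl; rewrite (resolventE h1 h2); exact: h2. Qed.
Lemma res_app y : A (resolvent A l y) = l *: resolvent A l y - y.
Proof. by rewrite -{3}(res_right y); lmod. Qed.
Lemma res_lin : linear (resolvent A l). Proof. by case: res_bounded. Qed.

(** An operator with a resolvent is linear, being l minus the inverse of a
    bounded linear operator. *)
Lemma rho_lin : lin_op (dom A) A.
Proof.
split; first by rewrite -(linP_0 res_lin); exact: res_dom.
move=> a x y Dx Dy.
have e : a *: x + y = resolvent A l (a *: (l *: x - A x) + (l *: y - A y)).
  by rewrite res_lin !res_left.
by split; rewrite e; [exact: res_dom|rewrite res_app -e; lmod].
Qed.

Lemma rho_lower : exists2 M, 1 <= M &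
  forall x, dom A x -> nrm x <= M * nrm (l *: x - A x).
Proof.
have [_ [M M1 hM]] := bounded_pos res_bounded.
by exists M => // x Dx; rewrite -{1}(res_left Dx).
Qed.

End Rho.

Lemma res_identity (V : completeNormedModType R[i]) (A : operator V V) l m y :
  rho A l -> rho A m ->
  resolvent A l y = resolvent A m y + (m - l) *: resolvent A l (resolvent A m y).
Proof.
move=> rl rm; have := res_left rl (res_dom rm y); rewrite res_app // => e.
move: e; have -> : l *: resolvent A m y - (m *: resolvent A m y - y) =
   y + (l - m) *: resolvent A m y by lmod.
rewrite (linP_D (res_lin rl)) (linP_Z (res_lin rl)) => e.
by rewrite -{1}e; lmod.
Qed.

Definition dissipative (E : normedModType R[i]) (h : hform E) (A : operator E E) :=
  forall x, dom A x -> rp h (A x) x <= 0.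

(** Pairing the resolvent equation with its solution leaves only the real part
    of [l], as [A] contributes a term of the right sign. *)
Lemma dissipative_contr (E : hilbertType R) (A : operator E E) l x :
  rho A l -> dissipative hil A -> complex.Re l * nrm (resolvent A l x) <= nrm x.
Proof.
move=> rl dA; set y := resolvent A l x; have Dy : dom A y by exact: res_dom.
have := dA y Dy; rewrite res_app // rpBl rp_Zl rp_hil => h.
have := rp_hil_le x y; rewrite -/y in h * => h2.
have h3 : complex.Re l * nrm y * nrm y <= nrm x * nrm y by rewrite -mulrA -expr2; lra.
have [->|z] := eqVneq (nrm y) 0; first by rewrite mulr0.
by rewrite -(@ler_pM2r _ (nrm y)) // lt_neqAle eq_sym z nrm_ge0.
Qed.

(** A vector orthogonal to the domain is [l w - A w] for some [w] in the domain.
    Orthogonality to [w] makes [w] vanish. *)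
Lemma dissipative_dense (E : completeNormedModType R[i]) (h : hform E)
    (A : operator E E) (l : R) :
  0 < l -> rho A l%:C -> dissipative h A ->
  forall x e, 0 < e -> exists2 v, dom A v & nrm (v - x) < e.
Proof.
move=> l0 rl dA x e e0; have lA := rho_lin rl; have [D0 _] := lA.
pose M := [set x | forall e, 0 < e -> exists2 v, dom A v & nrm (v - x) < e].
have ME u : M u -> forall e, 0 < e -> exists2 v, dom A v & nrm (v - u) < e by [].
have Msub : linear_subset M.
  split; first by rewrite /M /= => d d0; exists 0 => //; rewrite subrr nrm0.
  move=> a u v Mu Mv; rewrite /M /= => d d0.
  have c0 : 0 < cabs a + 1 by rewrite ltr_wpDl.
  have dc : 0 < d / (2 * (cabs a + 1)) by rewrite divr_gt0 // mulr_gt0.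
  have d2 : 0 < d / 2 by rewrite divr_gt0.
  have [u' Du' hu'] := ME u Mu _ dc.
  have [v' Dv' hv'] := ME v Mv _ d2.
  exists (a *: u' + v'); first by have [_ H] := lA; case: (H a u' v' Du' Dv').
  have -> : a *: u' + v' - (a *: u + v) = a *: (u' - u) + (v' - v) by lmod.
  apply: le_lt_trans (ler_nrmD _ _) _; rewrite nrmZ.
  rewrite ltr_pdivlMr ?mulr_gt0 // in hu'.
  have := nrm_ge0 (u' - u); have := cabs_ge0 a; move: hu' hv'.
  by move: (nrm _) (nrm _) (cabs a) => p q r *; nra.
have Mcl : seq_closed M.
  move=> u y Mu /cvg_nrmP uy; rewrite /M /= => d d0; have d2 : 0 < d / 2 by rewrite divr_gt0.
  have [N _ hN] := uy _ d2.
  have [v Dv hv] := ME _ (Mu N) _ d2.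
  exists v => //; have := hN N (leqnn _) => /= hN'.
  by apply: le_lt_trans (ler_nrm_dist _ (u N) _) _; lra.
have [m Mm mo] := projection h x Msub Mcl.
have DM v : dom A v -> M v by rewrite /M /= => Dv d d0; exists v => //; rewrite subrr nrm0.
pose w := resolvent A l%:C (x - m).
have Dw : dom A w by exact: res_dom.
have w0 : w = 0.
  apply: (@rp_eq0 _ _ h); have := mo w (DM w Dw).
  rewrite -(res_right rl (x - m)) -/w rpBl rpZl.
  have := dA w Dw => d1 d2.
  by rewrite -(ler_pM2l l0) mulr0; lra.
have xm : x - m = 0.
  by rewrite -(res_right rl (x - m)) -/w w0 (lin_op0 lA) scaler0 subrr.
have -> : x = m by apply/eqP; rewrite -subr_eq0 xm.
exact: Mm.
Qed.

End Operators.

(** * Invertibility of feedback loops *)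
Section InvOp.
Context {R : realType}.

Lemma bounded_lin_op (V W : normedModType R[i]) (f : V -> W) :
  linear f -> lin_op setT f.
Proof. by move=> lf; split=> // a x y _ _; split=> //; exact: lf. Qed.

Lemma boundedly_invertible_intro (V : normedModType R[i]) (f : V -> V) M :
  linear f -> (forall x, nrm x <= M * nrm (f x)) -> (forall y, exists x, f x = y) ->
  boundedly_invertible f.
Proof.
move=> lf lb surj; have /choice[g hg] := surj.
have inj x y : f x = f y -> x = y.
  move=> e; apply/eqP; rewrite -subr_eq0; apply/eqP/nrm_le0.
  by have := lb (x - y); rewrite (linP_B lf) e subrr nrm0 mulr0.
exists g; split=> [|x|//]; last exact: inj.
split; last by exists M => y; rewrite -{2}(hg y).
by move=> a u v; apply: inj; rewrite hg lf !hg.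
Qed.

Section InvOpP.
Context {V W : normedModType R[i]} (f : V -> W) (fi : boundedly_invertible f).

Lemma inv_op_spec : exists g, [/\ inv_op f = g, bounded_operator g, cancel f g & cancel g f].
Proof.
have [g [bg fg gf]] := fi; exists g; split=> //.
apply/funext => y.
have := @xgetPex _ 0 [set x | f x = y] (ex_intro _ (g y) (gf y)) => /= e.
by rewrite -[LHS]fg e.
Qed.
Lemma inv_op_bounded : bounded_operator (inv_op f).
Proof. by have [g [-> ]] := inv_op_spec. Qed.
Lemma inv_opK : cancel f (inv_op f).
Proof. by have [g [-> ]] := inv_op_spec. Qed.
Lemma inv_opVK : cancel (inv_op f) f.
Proof. by have [g [-> ]] := inv_op_spec. Qed.
Lemma inv_op_lin : linear (inv_op f).
Proof. by case: inv_op_bounded. Qed.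
End InvOpP.

(** The inverse of [1 + b a] is [1 - b (1 + a b)^-1 a]. *)
Lemma swap_invertible (V : normedModType R[i]) (a b : V -> V) :
  bounded_operator a -> bounded_operator b ->
  boundedly_invertible (fun u => u + a (b u)) ->
  boundedly_invertible (fun u => u + b (a u)).
Proof.
move=> ba bb [g [bg gK Kg]].
have [la _] := ba; have [lb _] := bb; have [lg _] := bg.
exists (fun u => u - b (g (a u))); split.
- by apply: bounded_sub; [exact: bounded_id|do 2!apply: bounded_comp => //].
- move=> u /=; have := gK (a u); rewrite (linP_D la) => ->; lmod.
- move=> u /=; rewrite (linP_B la).
  rewrite -[in RHS](subr0 u); set v := g (a u).
  have := Kg (a u); rewrite -/v => <-.
  by rewrite (linP_B lb) !(linP_D lb); lmod.
Qed.

Context {H : hilbertType R}.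
Implicit Types P G : H -> H.

(** Pair [y + P (G y)] with [G y]: together the two terms are coercive in [G y], which
    bounds [G y], and then [y] is recovered from the equation. *)
Lemma loop_bound P G (p g e k : R) : linear P -> linear G ->
  (forall x, nrm (P x) <= k * nrm x) -> 0 <= k ->
  (forall x, p * nrm x ^+ 2 <= rp hil (P x) x) ->
  (forall x, g * nrm (G x) ^+ 2 <= rp hil (G x) x) -> 0 < e -> e <= p + g ->
  forall y, nrm y <= (1 + k / e) * nrm (y + P (G y)).
Proof.
move=> lP lG hk k0 hp hg e0 epg y; set f := y + _.
have h1 : e * nrm (G y) ^+ 2 <= nrm f * nrm (G y).
  apply: le_trans (rp_hil_le f (G y)); rewrite rpDl (rpC _ y).
  have := hp (G y); have := hg y; have := sqr_ge0 (nrm (G y)).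
  by move: (nrm (G y) ^+ 2) => *; nra.
have h2 : nrm (G y) <= nrm f / e.
  rewrite ler_pdivlMr //.
  have [->|z] := eqVneq (nrm (G y)) 0; first by rewrite mul0r.
  have zp : 0 < nrm (G y) by rewrite lt_neqAle eq_sym z nrm_ge0.
  by rewrite -(ler_pM2r zp); apply: le_trans h1; rewrite expr2; nra.
have -> : y = f - P (G y) by rewrite /f; lmod.
apply: le_trans (ler_nrmB _ _) _; rewrite mulrDl mul1r lerD2l.
apply: le_trans (hk _) _; rewrite -mulrA ler_wpM2l // mulrC //.
Qed.

(** [loop_bound] holds for [s P] uniformly in [s], so the continuity method leads
    from the identity to the loop. *)
Lemma loop_invertible P G (g : R) : bounded_operator P -> bounded_operator G ->
  (forall x, 0 <= rp hil (P x) x) -> 0 < g ->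
  (forall x, g * nrm (G x) ^+ 2 <= rp hil (G x) x) ->
  boundedly_invertible (fun u => u + P (G u)).
Proof.
move=> bP bG hp g0 hg.
have [lP [k k1 hk]] := bounded_pos bP; have [lG _] := bG.
have k0 : 0 <= k by rewrite (le_trans _ k1).
have lb s y : 0 <= s <= 1 -> nrm y <= (1 + k / g) * nrm (y + s%:C *: P (G y)).
  move=> /andP[s0 s1].
  apply: (@loop_bound (fun x => s%:C *: P x) G 0 g g k) => //.
  - by move=> a x z; rewrite lP; lmod.
  - move=> x; rewrite nrmZ cabs_real ger0_norm //; apply: le_trans (hk x).
    by rewrite ler_piMl.
  - by move=> x; rewrite mul0r rpZl mulr_ge0.
  - by rewrite add0r.
apply: (@boundedly_invertible_intro _ _ (1 + k / g)).
- by move=> a x y; rewrite lG lP; lmod.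
- by move=> y; have := lb 1 y; rewrite scale1r; apply; rewrite ler01 lexx.
move=> y.
have [x _ e] := @continuity_method R H setT id (fun u => P (G u)) (1 + k / g)
   (@bounded_lin_op H H id (fun _ _ _ => erefl)) (bounded_comp bP bG)
   (fun s x hs _ => lb s x hs) (fun y => ex_intro2 _ _ y I erefl) y.
by exists x.
Qed.

Lemma strict_cocoercive G c : bounded_operator G -> 0 < c ->
  (forall x, c * nrm x ^+ 2 <= rp hil (G x) x) ->
  exists2 g, 0 < g & forall x, g * nrm (G x) ^+ 2 <= rp hil (G x) x.
Proof.
move=> /bounded_pos[_ [m m1 hm]] c0 hc; have m0 : 0 < m by rewrite (lt_le_trans _ m1).
exists (c / m ^+ 2); first by rewrite divr_gt0 ?exprn_gt0.
move=> x; apply: le_trans (hc x); rewrite -mulrA ler_pM2l // ler_pdivrMl ?exprn_gt0 //.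
by rewrite -exprMn ler_pXn2r ?nnegrE ?mulr_ge0 // ltW.
Qed.

End InvOp.

Lemma cvg_scale (R : realType) (V : normedModType R[i]) T (F : set_system T)
    {FF : Filter F} (a : R[i]) (u : T -> V) l :
  u t @[t --> F] --> l -> a *: u t @[t --> F] --> a *: l.
Proof. by move=> ul; apply: cvgZ ul; exact: cvg_cst. Qed.

(** * Extension by continuity *)
Section Extension.
Context {R : realType} {V W : normedModType R[i]} {E : completeNormedModType R[i]}.
Context (D : set V) (j : V -> W) (f : V -> E) (c : R) (c0 : 0 <= c).
Context (lip : forall v v', D v -> D v' -> nrm (f v - f v') <= c * nrm (j v - j v')).
Local Notation ext := (extension D j f).

Lemma natSinv_cvg0 : n.+1%:R^-1 @[n --> \oo] --> (0 : R).
Proof. exact: cvg_harmonic. Qed.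

Lemma dense_seq w : (forall e, 0 < e -> exists2 v, D v & nrm (j v - w) < e) ->
  exists u : nat -> V, (forall n, D (u n)) /\ j (u n) @[n --> \oo] --> w.
Proof.
move=> dw; have /choice[u hu] : forall n : nat, exists v, D v /\ nrm (j v - w) < n.+1%:R^-1.
  move=> n; have n0 : (0 : R) < n.+1%:R^-1 by rewrite invr_gt0 ltr0n.
  by have [v Dv h] := dw _ n0; exists v.
exists u; split=> [n|]; first by case: (hu n).
apply: squeeze_nrm natSinv_cvg0; apply: nearW => n.
by case: (hu n) => _ /ltW.
Qed.

(** This estimate characterizes the extension, since the points of [D] come
    arbitrarily close; linearity, boundedness and continuity follow from it. *)
Lemma extension_near w : (forall e, 0 < e -> exists2 v, D v & nrm (j v - w) < e) ->
  forall v, D v -> nrm (f v - ext w) <= c * nrm (j v - w).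
Proof.
move=> dw; have [u [Du ju]] := dense_seq dw.
have [l ul] : exists l : E, f (u n) @[n --> \oo] --> l.
  apply: cauchy_nrm_cvg => e e0.
  have e2 : 0 < e / (2 * (c + 1)) by rewrite divr_gt0 // mulr_gt0 // ltr_wpDl.
  have [N hN] := cvg_nrm_seq ju e2.
  exists N => n m /hN /= hn /hN /= hm.
  apply: le_lt_trans (lip (Du _) (Du _)) _.
  rewrite !ltr_pdivlMr ?mulr_gt0 ?ltr_wpDl // in hn hm.
  have := ler_nrm_dist (j (u n)) w (j (u m)); rewrite (nrmBC w).
  have := nrm_ge0 (j (u n) - w); have := nrm_ge0 (j (u m) - w).
  move: hn hm c0; move: (nrm _) (nrm _) (nrm _) => p q r *; nra.
have key v : D v -> nrm (f v - l) <= c * nrm (j v - w).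
  move=> Dv; apply/ler_addgt0Pr => e e0.
  have e2 : 0 < e / (c + 1) by rewrite divr_gt0 // ltr_wpDl.
  have [N1 h1] := cvg_nrm_seq ju e2; have [N2 h2] := cvg_nrm_seq ul e2.
  pose N := maxn N1 N2; have k1 := h1 N (leq_maxl _ _).
  have k2 := h2 N (leq_maxr _ _).
  rewrite !ltr_pdivlMr ?ltr_wpDl // in k1 k2.
  have := lip Dv (Du N).
  have := ler_nrm_dist (f v) (f (u N)) l; have := ler_nrm_dist (j v) w (j (u N)).
  rewrite (nrmBC w); have := nrm_ge0 (j (u N) - w); have := nrm_ge0 (f (u N) - l).
  move: k1 k2 c0.
  move: (nrm _) (nrm _) (nrm _) (nrm _) (nrm _) (nrm _) => *; nra.
suff -> : ext w = l by [].
rewrite /extension.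
have FF0 : Filter (filter_from (nbhs w) (fun N => j @^-1` N)).
  apply: filter_from_filter; first by exists setT; exact: filterT.
  by move=> A B hA hB; exists (A `&` B) => //; exact: filterI.
have PF : ProperFilter (within D (filter_from (nbhs w) (fun N => j @^-1` N))).
  split; last exact: within_filter.
  move=> [N Nw /= NF].
  have : nbhs w N by [].
  move: Nw => /nbhs_ballP[e /= e0 hN].
  have er : e = (complex.Re e)%:C by rewrite RRe_real // gtr0_real.
  have : 0 < complex.Re e by rewrite -(@ltcR R) -er.
  move=> /dw[v Dv hv] _; apply: (NF v) => //; apply: hN.
  by rewrite -ball_normE /ball_ /= distrC normE er ltcR.
apply/cvg_lim; first exact: norm_hausdorff.
apply/cvg_nrmP => e e0.
have e2 : 0 < e / (c + 1) by rewrite divr_gt0 // ltr_wpDl.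
exists (ball w (e / (c + 1))%:C); first by apply: nbhsx_ballx; rewrite ltcR.
move=> v; rewrite -ball_normE /ball_ /= distrC normE ltcR => hv Dv.
apply: le_lt_trans (key v Dv) _.
rewrite !ltr_pdivlMr ?ltr_wpDl // in hv.
by move: (nrm_ge0 (j v - w)) hv; lra.
Qed.

Lemma extension_dom v : D v -> ext (j v) = f v.
Proof.
move=> Dv; apply/eqP; rewrite eq_sym -subr_eq0; apply/eqP/nrm_le0.
have dv e : 0 < e -> exists2 v', D v' & nrm (j v' - j v) < e.
  by move=> e0; exists v => //; rewrite subrr nrm0.
by have := extension_near dv Dv; rewrite subrr nrm0 mulr0.
Qed.

Context (dW : forall w e, 0 < e -> exists2 v, D v & nrm (j v - w) < e).

Lemma extension_cvg (u : nat -> V) w : (forall n, D (u n)) ->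
  j (u n) @[n --> \oo] --> w -> f (u n) @[n --> \oo] --> ext w.
Proof.
move=> Du ju; apply: (@squeeze_nrm _ _ _ _ _ _ _ (fun n => c * nrm (j (u n) - w))).
  by apply: nearW => n; apply: extension_near => //; exact: dW.
by apply: cvg_mul0; apply/cvg_nrm0P.
Qed.

Context (lj : lin_op D j) (lf : lin_op D f).

Lemma extension_bounded : bounded_operator ext.
Proof.
split.
  move=> a w w'; have [u [Du ju]] := dense_seq (dW w).
  have [u' [Du' ju']] := dense_seq (dW w').
  have Du2 n : D (a *: u n + u' n) by have [_ h] := lj; case: (h a _ _ (Du n) (Du' n)).
  have c1 : f (a *: u n + u' n) @[n --> \oo] --> ext (a *: w + w').
    apply: extension_cvg => //.
    have -> : (fun n => j (a *: u n + u' n)) = (fun n => a *: j (u n) + j (u' n)).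
      by apply/funext => n; have [_ h] := lj; case: (h a _ _ (Du n) (Du' n)).
    by apply: cvgD ju'; apply: cvg_scale.
  have c2 : f (a *: u n + u' n) @[n --> \oo] --> a *: ext w + ext w'.
    have -> : (fun n => f (a *: u n + u' n)) = (fun n => a *: f (u n) + f (u' n)).
      by apply/funext => n; have [_ h] := lf; case: (h a _ _ (Du n) (Du' n)).
    by apply: cvgD; [apply: cvg_scale|]; apply: extension_cvg.
  exact: (cvg_unique _ c1 c2).
exists c => w; have [D0 _] := lj.
have := @extension_near w (dW w) 0 D0.
by rewrite (lin_op0 lj) (lin_op0 lf) !sub0r !nrmN.
Qed.

End Extension.

(** * Extrapolation space and extended output operator *)
Section Node.
Context {R : realType} {X U Y : hilbertType R} (S : system X U Y).
Local Notation A := (opA S).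
Local Notation Xm := (ext_space (extX S)).
Local Notation l0 := (lambda0 S).

Lemma rho0 : rho A l0. Proof. exact: base_pointP. Qed.

Lemma emb_lin : linear (emb S). Proof. by move=> a x y; rewrite /emb linearP. Qed.

Lemma nrm_emb x : nrm (emb S x) = nrm (resolvent A l0 x).
Proof. by rewrite /nrm /emb norm_embed. Qed.

Lemma emb_bounded : bounded_operator (emb S).
Proof.
split; first exact: emb_lin.
have [_ [M hM]] := res_bounded rho0.
by exists M => x; rewrite nrm_emb; exact: hM.
Qed.

Lemma emb_inj x y : emb S x = emb S y -> x = y.
Proof.
move=> e; apply/eqP; rewrite -subr_eq0; apply/eqP.
have : nrm (emb S (x - y)) = 0 by rewrite (linP_B emb_lin) e subrr nrm0.
rewrite nrm_emb => /eqP; rewrite nrm_eq0 => /eqP r0.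
by rewrite -(res_right rho0 (x - y)) r0 (lin_op0 (rho_lin rho0)) scaler0 subrr.
Qed.

Lemma restrictE x : Defs.restrict (emb S x) = x.
Proof.
apply: emb_inj; exact: (@xgetPex _ 0 [set y | emb S y = emb S x] (ex_intro _ x erefl)).
Qed.

Lemma emb_dense (w : Xm) e : 0 < e -> exists2 x, setT x & nrm (emb S x - w) < e.
Proof.
move=> e0; have o : open (ball w e%:C : set Xm).
  by apply: ball_open; rewrite ltcR.
have ne : (ball w e%:C : set Xm) !=set0 by exists w; apply: ballxx; rewrite ltcR.
have [v [bv [x _ xv]]] := @dense_embed _ _ _ (extX S) _ ne o.
by exists x => //; move: bv; rewrite /emb xv -ball_normE /ball_ /= distrC normE ltcR.
Qed.

Lemma lin_emb : lin_op setT (emb S).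
Proof. exact: (bounded_lin_op emb_lin). Qed.

Section Resolvent.
Context (l : R[i]) (rl : rho A l).

(** By the resolvent identity every resolvent is dominated by the one that
    defines the norm of the extrapolation space. *)
Lemma res_lip : exists2 c, 0 <= c & forall v v', setT v -> setT v' ->
  nrm (resolvent A l v - resolvent A l v') <= c * nrm (emb S v - emb S v').
Proof.
have [_ [M M1 hM]] := bounded_pos (res_bounded rl).
have M0 : 0 <= M by rewrite (le_trans _ M1).
exists (1 + cabs (l0 - l) * M); first by rewrite addr_ge0 // mulr_ge0.
move=> v v' _ _.
rewrite -(linP_B (res_lin rl)) -(linP_B emb_lin) nrm_emb.
rewrite (res_identity _ rl rho0); apply: le_trans (ler_nrmD _ _) _.
rewrite mulrDl mul1r lerD2l nrmZ -mulrA ler_wpM2l //; exact: hM.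
Qed.

Lemma R_ext_emb x : R_ext (S:=S) l (emb S x) = resolvent A l x.
Proof. by have [c c0 h] := res_lip; exact: (extension_dom c0 h). Qed.

Lemma R_ext_bounded : bounded_operator (R_ext (S:=S) l).
Proof.
have [c c0 h] := res_lip; apply: (extension_bounded c0 h).
- exact: emb_dense.
- exact: lin_emb.
- exact: (bounded_lin_op (res_lin rl)).
Qed.

Lemma R_ext_lin : linear (R_ext (S:=S) l). Proof. by case: R_ext_bounded. Qed.

Lemma R_ext_cvg (u : nat -> X) w : emb S (u n) @[n --> \oo] --> w ->
  resolvent A l (u n) @[n --> \oo] --> R_ext (S:=S) l w.
Proof.
move=> uw; have [c c0 h] := res_lip.
by apply: (extension_cvg c0 h) => //; exact: emb_dense.
Qed.

End Resolvent.

(** The extrapolation norm of [A v] is the norm of [l0 R v - v]. *)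
Lemma A_lip : exists2 c, 0 <= c & forall v v', dom A v -> dom A v' ->
  nrm (emb S (A v) - emb S (A v')) <= c * nrm (v - v').
Proof.
have [_ [M M1 hM]] := bounded_pos (res_bounded rho0).
have M0 : 0 <= M by rewrite (le_trans _ M1).
have lA := rho_lin rho0.
exists (1 + cabs l0 * M); first by rewrite addr_ge0 // mulr_ge0.
move=> v v' Dv Dv'; rewrite -(linP_B emb_lin); have [Dd <-] := lin_opB lA Dv Dv'.
rewrite nrm_emb.
have -> : resolvent A l0 (A (v - v')) = l0 *: resolvent A l0 (v - v') - (v - v').
  move: Dd; set d := v - v' => Dd.
  have := res_left rho0 Dd; rewrite (linP_B (res_lin rho0)) (linP_Z (res_lin rho0)) => e.
  by rewrite -[X in _ = _ - X]e; lmod.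
apply: le_trans (ler_nrmB _ _) _; rewrite nrmZ addrC mulrDl mul1r lerD2l.
by rewrite -mulrA ler_wpM2l //; exact: hM.
Qed.

Lemma A_ext_emb x : dom A x -> A_ext S x = emb S (A x).
Proof.
have [c c0 h] := A_lip.
exact: (@extension_dom R X X Xm (dom A) id (emb S \o A) c c0 h).
Qed.

Context (dD : forall (x : X) e, 0 < e -> exists2 v, dom A v & nrm (v - x) < e).

Lemma A_ext_bounded : bounded_operator (A_ext S).
Proof.
have [c c0 h] := A_lip; have lA := rho_lin rho0; have [D0 H] := lA.
apply: (@extension_bounded R X X Xm (dom A) id (emb S \o A) c c0 h dD).
  by split=> // a x y Dx Dy; split=> //; case: (H a x y Dx Dy).
split=> // a x y Dx Dy; have [D1 e] := H a x y Dx Dy.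
by split=> //=; rewrite e emb_lin.
Qed.

Lemma A_ext_lin : linear (A_ext S). Proof. by case: A_ext_bounded. Qed.

Lemma A_ext_cvg (u : nat -> X) x : (forall n, dom A (u n)) ->
  u n @[n --> \oo] --> x -> emb S (A (u n)) @[n --> \oo] --> A_ext S x.
Proof.
move=> Du ux; have [c c0 h] := A_lip.
exact: (@extension_cvg R X X Xm (dom A) id (emb S \o A) c c0 h dD u x Du ux).
Qed.

Section ResolventId.
Context (l : R[i]) (rl : rho A l).

(** Both identities hold for vectors of the domain, respectively of the
    embedded space, and pass to the limit. *)
Lemma R_ext_left x : R_ext (S:=S) l (l *: emb S x - A_ext S x) = x.
Proof.
have [u [Du ux]] := @dense_seq R X X (dom A) id x (dD x).
have c1 : emb S (l *: u n - A (u n)) @[n --> \oo] --> l *: emb S x - A_ext S x.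
  have -> : (fun n => emb S (l *: u n - A (u n))) =
      (fun n => l *: emb S (u n) - emb S (A (u n))).
    by apply/funext => n; rewrite (linP_B emb_lin) (linP_Z emb_lin).
  apply: cvgB; last exact: A_ext_cvg.
  by apply: cvg_scale; apply: (bounded_cvg emb_bounded).
have c2 := R_ext_cvg rl c1.
have e : (fun n => resolvent A l (l *: u n - A (u n))) = u.
  by apply/funext => n; exact: (res_left rl (Du n)).
by rewrite e in c2; exact: (cvg_unique _ c2 ux).
Qed.

Lemma R_ext_right w : A_ext S (R_ext (S:=S) l w) = l *: emb S (R_ext (S:=S) l w) - w.
Proof.
have [u [_ uw]] := @dense_seq R X Xm setT (emb S) w (@emb_dense w).
have c1 := R_ext_cvg rl uw.
have c2 : emb S (A (resolvent A l (u n))) @[n --> \oo] --> A_ext S (R_ext (S:=S) l w).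
  by apply: A_ext_cvg => // n; exact: res_dom.
have c3 : emb S (A (resolvent A l (u n))) @[n --> \oo] --> l *: emb S (R_ext (S:=S) l w) - w.
  have -> : (fun n => emb S (A (resolvent A l (u n)))) =
     (fun n => l *: emb S (resolvent A l (u n)) - emb S (u n)).
    by apply/funext => n; rewrite res_app // (linP_B emb_lin) (linP_Z emb_lin).
  by apply: cvgB => //; apply: cvg_scale; apply: (bounded_cvg emb_bounded).
exact: (cvg_unique _ c2 c3).
Qed.

End ResolventId.

(** The first resolvent identity on the extrapolation space. Its difference
    term lies in the domain of [A]. *)
Lemma R_ext_shift l m w : rho A l -> rho A m ->
  R_ext (S:=S) l w = R_ext (S:=S) m w + (m - l) *: resolvent A l (R_ext (S:=S) m w).
Proof.
move=> rl rm; rewrite -{1}(_ : l *: emb S (R_ext (S:=S) m w) - A_ext S (R_ext (S:=S) m w)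
   + (m - l) *: emb S (R_ext (S:=S) m w) = w); last by rewrite R_ext_right //; lmod.
rewrite (linP_D (R_ext_lin rl)) R_ext_left // (linP_Z (R_ext_lin rl)).
by rewrite R_ext_emb.
Qed.

Section COperator.
Context (dA : dissipative hil A) (a0 : R) (a0ge : 0 <= a0).
Context (ra : forall l : R, a0 < l -> rho A l%:C) (bC : bounded_output_operator S).

Local Notation approx := (fun x (l : R) => l%:C *: opC S (resolvent A l%:C x)).

Lemma C_lin : lin_op (dom A) (opC S).
Proof.
have [D0 H] := rho_lin rho0; have [lC _] := bC.
by split=> // a x y Dx Dy; split; [case: (H a x y Dx Dy)|exact: lC].
Qed.

Lemma res_contr (l : R) x : a0 < l -> l * nrm (resolvent A l%:C x) <= nrm x.
Proof. by move=> /ra rl; exact: (dissipative_contr x rl dA). Qed.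

Lemma near_rho : \forall l \near +oo, rho A l%:C.
Proof. by exists a0; split; [exact: num_real|exact: ra]. Qed.

(** On the domain of [A] this follows from [l R v - v = R (A v)]; contractivity
    of [l R] extends it by density. *)
Lemma res_strong x : l%:C *: resolvent A l%:C x @[l --> +oo] --> x.
Proof.
apply/cvg_nrmP => e e0; have e2 : 0 < e / 3 by rewrite divr_gt0.
have [v Dv hv] := dD x e2.
pose b := Num.max a0 (3 * nrm (A v) / e).
exists b; split; first exact: num_real.
move=> l; rewrite /b gt_max => /andP[al bl].
have rl := ra al; have l0' : 0 < l by exact: le_lt_trans al.
have -> : l%:C *: resolvent A l%:C x - x =
    l%:C *: resolvent A l%:C (x - v) + (v - x) + resolvent A l%:C (A v).
  rewrite (linP_B (res_lin rl)).
  have := res_left rl Dv; rewrite (linP_B (res_lin rl)) (linP_Z (res_lin rl)) => e1.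
  by rewrite -{2}e1; lmod.
apply: le_lt_trans (ler_nrmD _ _) _.
have h1 := ler_nrmD (l%:C *: resolvent A l%:C (x - v)) (v - x).
rewrite nrmZ cabs_real (gtr0_norm l0') in h1.
have h2 := res_contr (x - v) al; rewrite nrmBC in h2.
have h3 := res_contr (A v) al.
have h4 : nrm (resolvent A l%:C (A v)) < e / 3.
  rewrite -(ltr_pM2l l0'); apply: le_lt_trans h3 _.
  by rewrite ltr_pdivrMr // in bl; lra.
move: hv h1 h2 h4; move: (nrm _) (nrm _) (nrm _) (nrm _) => *; lra.
Qed.

Definition is_C_Lambda (x : X) (y : Y) := approx x l @[l --> +oo] --> y.

Lemma is_C_Lambda_dom x y : is_C_Lambda x y -> dom (C_Lambda S) x /\ C_Lambda S x = y.
Proof.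
by move=> h; split; [apply/cvg_ex; exists y|apply/cvg_lim => //; exact: norm_hausdorff].
Qed.

Lemma dom_is_C_Lambda x : dom (C_Lambda S) x -> is_C_Lambda x (C_Lambda S x).
Proof. by []. Qed.

Lemma is_C_Lambda_lin a x y x' y' :
  is_C_Lambda x x' -> is_C_Lambda y y' -> is_C_Lambda (a *: x + y) (a *: x' + y').
Proof.
move=> hx hy; rewrite /is_C_Lambda.
have c : a *: approx x l + approx y l @[l --> +oo] --> a *: x' + y'.
  by apply: cvgD hy; apply: cvg_scale.
apply: cvg_trans c; apply: near_eq_cvg.
have := near_rho; apply: filterS => l rl.
rewrite (res_lin rl); have [_ H] := C_lin.
by have [_ ->] := H a _ _ (res_dom rl x) (res_dom rl y); lmod.
Qed.

Lemma CL_lin : lin_op (dom (C_Lambda S)) (C_Lambda S).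
Proof.
split.
  apply: (@is_C_Lambda_dom 0 0 _).1; rewrite /is_C_Lambda.
  have c : (fun=> (0 : Y)) l @[l --> (+oo : set_system R)] --> (0 : Y) by exact: cvg_cst.
  apply: cvg_trans c; apply: near_eq_cvg.
  have := near_rho; apply: filterS => l rl.
  by rewrite (linP_0 (res_lin rl)) (lin_op0 C_lin) scaler0.
move=> a x y /dom_is_C_Lambda hx /dom_is_C_Lambda hy.
apply: is_C_Lambda_dom; exact: is_C_Lambda_lin.
Qed.

(** Apply [res_strong] to both [x] and [A x]: the convergence then holds in the
    graph norm, for which [opC S] is continuous. *)
Lemma CL_on_dom x : dom A x -> dom (C_Lambda S) x /\ C_Lambda S x = opC S x.
Proof.
move=> Dx; apply: is_C_Lambda_dom; rewrite /is_C_Lambda.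
have [_ [M hM]] := bC.
pose g (l : R) := `|M| * (nrm (l%:C *: resolvent A l%:C x - x) +
   nrm (l%:C *: resolvent A l%:C (A x) - A x)).
apply: (@squeeze_nrm _ _ _ _ _ _ _ g); last first.
  by apply: cvg_mul0; apply: cvg_add0; apply/cvg_nrm0P; exact: res_strong.
have := near_rho; apply: filterS => l rl.
have [D1 e1] := lin_opZ C_lin l%:C (res_dom rl x).
rewrite -e1; have [D2 <-] := lin_opB C_lin D1 Dx.
apply: le_trans (hM _ D2) _.
have lA := rho_lin rho0; have [_ ->] := lin_opB lA D1 Dx.
have [_ ->] := lin_opZ lA l%:C (res_dom rl x).
have -> : A (resolvent A l%:C x) = resolvent A l%:C (A x).
  have := res_left rl Dx; rewrite (linP_B (res_lin rl)) (linP_Z (res_lin rl)) => e.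
  rewrite res_app // -{2}e; lmod.
rewrite /g ler_wpM2r ?addr_ge0 //; exact: ler_norm.
Qed.

Context (rB : forall l u, rho A l -> dom (C_Lambda S) (R_ext (S:=S) l (opB S u))).
Context (bB : bounded_operator (opB S)) (bDD : bounded_operator (opD S)).

(** Two transfer values differ by an ordinary output of the resolvent, because
    [R_ext_shift] moves the difference into the domain of [A]. *)
Lemma transfer_shift l m u : rho A l -> rho A m ->
  transfer S l u = transfer S m u
     + (m - l) *: opC S (resolvent A l (R_ext (S:=S) m (opB S u))).
Proof.
move=> rl rm; rewrite /transfer.
have [D1 e1] := CL_on_dom (res_dom rl (R_ext (S:=S) m (opB S u))).
have [D2 e2] := lin_opZ CL_lin (m - l) D1.
rewrite (R_ext_shift (opB S u) rl rm).
by have [_ ->] := lin_opD CL_lin (@rB m u rm) D2; rewrite e2 e1; lmod.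
Qed.

Lemma CR_bounded l : rho A l -> bounded_operator (fun x => opC S (resolvent A l x)).
Proof.
move=> rl; split.
  move=> a x y; rewrite (res_lin rl); have [_ H] := C_lin.
  by have [_ ->] := H a _ _ (res_dom rl x) (res_dom rl y).
have [_ [M hM]] := bC; have [_ [N N1 hN]] := bounded_pos (res_bounded rl).
exists (`|M| * (N + (cabs l * N + 1))) => x.
apply: le_trans (hM _ (res_dom rl x)) _; rewrite res_app //.
apply: (@le_trans _ _ (`|M| * (nrm (resolvent A l x) + nrm (l *: resolvent A l x - x)))).
  by apply: ler_wpM2r; [rewrite addr_ge0|exact: ler_norm].
rewrite -mulrA ler_wpM2l // mulrDl lerD //; first exact: hN.
apply: le_trans (ler_nrmB _ _) _; rewrite mulrDl mul1r lerD2r nrmZ -mulrA.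
by apply: ler_wpM2l => //; exact: hN.
Qed.

Lemma RB_bounded l : rho A l -> bounded_operator (fun u => R_ext (S:=S) l (opB S u)).
Proof. by move=> rl; apply: bounded_comp bB; exact: R_ext_bounded. Qed.

Lemma transfer_lin l : rho A l -> linear (transfer S l).
Proof.
move=> rl a u v; have [lB _] := bB; have [lD _] := bDD; have [_ H] := CL_lin.
have [_ e] := H a _ _ (@rB l u rl) (@rB l v rl).
by rewrite /transfer lB (R_ext_lin rl) lD e scalerDr addrACA.
Qed.

Context (am M0 : R) (hM : forall l, am < complex.Re l ->
  rho A l /\ forall u, nrm (C_Lambda S (R_ext (S:=S) l (opB S u))) <= M0 * nrm u).

Lemma transfer_half_bounded : exists2 M, 1 <= M & forall l u, am < complex.Re l ->
   nrm (transfer S l u) <= M * nrm u.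
Proof.
have [_ [N N1 hN]] := bounded_pos bDD.
exists (`|M0| + N); first by rewrite (le_trans N1) // lerDr.
move=> l u /hM[_ h]; apply: le_trans (ler_nrmD _ _) _; rewrite mulrDl lerD //.
by apply: le_trans (h u) _; apply: ler_wpM2r => //; exact: ler_norm.
Qed.

(** Boundedness in the right half-plane is assumed; [transfer_shift] carries it
    to every point of the resolvent set. *)
Lemma transfer_bounded l : rho A l -> bounded_operator (transfer S l).
Proof.
move=> rl; split; first exact: transfer_lin.
pose m : R[i] := (`|am| + 1)%:C.
have am' : am < complex.Re m by rewrite /m /= (le_lt_trans (ler_norm _)) // ltrDl.
have [rm _] := hM am'; have [M M1 h1] := transfer_half_bounded.
have [_ [N hN]] := CR_bounded rl; have [_ [K hK]] := RB_bounded rm.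
exists (M + cabs (m - l) * (`|N| * K)) => u.
rewrite (transfer_shift u rl rm); apply: le_trans (ler_nrmD _ _) _.
rewrite mulrDl lerD //; first exact: h1.
rewrite nrmZ -mulrA ler_wpM2l //; apply: le_trans (hN _) _.
apply: (@le_trans _ _ (`|N| * nrm (R_ext (S:=S) m (opB S u)))).
  by apply: ler_wpM2r => //; exact: ler_norm.
by rewrite -mulrA ler_wpM2l.
Qed.

(** Regularity. Writing [x = R(mu) B u], the transfer function at [l] is
    [opD S u + C_Lambda x - (1 - mu / l) (l C R(l) x)], and the last factor tends to
    [C_Lambda x]. *)
Lemma transfer_limit u : transfer S l%:C u @[l --> +oo] --> opD S u.
Proof.
pose mu : R := a0 + 1; have rmu : rho A mu%:C by apply: ra; rewrite ltrDl.
set x := R_ext (S:=S) mu%:C (opB S u).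
have hx : is_C_Lambda x (C_Lambda S x) by apply: dom_is_C_Lambda; exact: rB.
apply/cvg_nrmP => e e0.
set y := C_Lambda S x in hx.
have d0 : 0 < e / 3 by rewrite divr_gt0.
have h1 := cvg_nrm_lt hx d0.
pose K := `|mu| * (nrm y + e / 3 + 1).
have h2 : \forall l \near +oo, a0 < l /\ K / (e / 3) < l.
  exists (Num.max a0 (K / (e / 3))); split; first exact: num_real.
  by move=> l; rewrite gt_max => /andP[].
near=> l.
have h1' : nrm (l%:C *: opC S (resolvent A l%:C x) - y) < e / 3 by near: l; exact: h1.
have [al hK] : a0 < l /\ K / (e / 3) < l by near: l; exact: h2.
have l0' : 0 < l by exact: le_lt_trans al.
rewrite (transfer_shift u (ra al) rmu) /transfer -/x -/y.
set c := opC S (resolvent A l%:C x) in h1' *.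
have lc : c = (l^-1)%:C *: (l%:C *: c).
  by rewrite scalerA -rmorphM /= mulVf ?gt_eqF // scale1r.
have -> : y + opD S u + (mu%:C - l%:C) *: c - opD S u = mu%:C *: c - (l%:C *: c - y).
  by lmod.
have h3 : nrm (mu%:C *: c) < e / 3.
  have nc : nrm c = l^-1 * nrm (l%:C *: c).
    by rewrite {1}lc nrmZ cabs_real ger0_norm // invr_ge0 ltW.
  rewrite nrmZ cabs_real nc.
  rewrite mulrCA ltr_pdivrMl //; apply: le_lt_trans (_ : _ <= K) _; last first.
    by rewrite ltr_pdivrMr // in hK.
  rewrite ler_wpM2l //; have := ler_nrmD (l%:C *: c - y) y; rewrite subrK.
  by move: h1'; lra.
apply: le_lt_trans (ler_nrmB _ _) _; by move: h1' h3; lra.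
Unshelve. all: by end_near. Qed.

End COperator.
End Node.

(** * Passive regular systems *)
Section PassiveSystem.
Context {R : realType} {X U : hilbertType R} (S : system X U U).
Context (rS : regular S) (pS : impedance_passive S).
Local Notation A := (opA S).

Lemma reg_B : bounded_operator (opB S). Proof. by case: rS => _ []. Qed.
Lemma reg_C : bounded_output_operator S. Proof. by case: rS => _ []. Qed.
Lemma reg_D : bounded_operator (opD S). Proof. by case: rS => _ []. Qed.
Lemma reg_ran l u : rho A l -> dom (C_Lambda S) (R_ext l (opB S u)).
Proof. by case: rS => _ _ _ h _; exact: h. Qed.

Lemma passive_dissipative : dissipative hil A.
Proof.
move=> x Dx; have [lB _] := reg_B.
have := pS (x := x) (u := 0) (w := A x); rewrite (linP_0 lB) addr0 A_ext_emb //.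
by move=> /(_ erefl); rewrite inner0r.
Qed.

Lemma reg_half : exists a M : R, [/\ 0 <= a, forall l, a < complex.Re l -> rho A l &
  forall l, a < complex.Re l ->
    rho A l /\ forall u, nrm (C_Lambda S (R_ext l (opB S u))) <= M * nrm u].
Proof.
have [_ _ _ _ [a [M h]]] := rS.
have ha l : `|a| < complex.Re l -> a < complex.Re l by apply: le_lt_trans; exact: ler_norm.
by exists `|a|, M; split=> // l /ha /h // [].
Qed.

Lemma reg_dense (x : X) e : 0 < e -> exists2 v, dom A v & nrm (v - x) < e.
Proof.
have [a [_ [a0 h _]]] := reg_half.
have r : rho A (a + 1)%:C by apply: h; rewrite /= ltrDl.
have ap : 0 < a + 1 by rewrite ltr_wpDl.
exact: (dissipative_dense ap r passive_dissipative).
Qed.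

Lemma reg_CL_lin : lin_op (dom (C_Lambda S)) (C_Lambda S).
Proof.
have [a [_ [a0 h _]]] := reg_half.
exact: (CL_lin (fun l (al : a < l) => h l%:C al) reg_C).
Qed.

Lemma reg_CL_dom x : dom A x -> dom (C_Lambda S) x /\ C_Lambda S x = opC S x.
Proof.
have [a [_ [a0 h _]]] := reg_half.
exact: (CL_on_dom reg_dense passive_dissipative a0 (fun l (al : a < l) => h l%:C al) reg_C).
Qed.

Lemma reg_transfer_shift l m u : rho A l -> rho A m ->
  transfer S l u = transfer S m u
     + (m - l) *: opC S (resolvent A l (R_ext m (opB S u))).
Proof.
have [a [_ [a0 h _]]] := reg_half.
exact: (transfer_shift reg_dense passive_dissipative a0
  (fun l (al : a < l) => h l%:C al) reg_C (@reg_ran)).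
Qed.

Lemma reg_CR l : rho A l -> bounded_operator (fun x => opC S (resolvent A l x)).
Proof. exact: (CR_bounded reg_C). Qed.

Lemma reg_RB l : rho A l -> bounded_operator (fun u => R_ext l (opB S u)).
Proof. exact: (RB_bounded reg_B). Qed.

Lemma reg_transfer l : rho A l -> bounded_operator (transfer S l).
Proof.
have [a [M [a0 h hM]]] := reg_half.
exact: (transfer_bounded reg_dense passive_dissipative a0
  (fun l (al : a < l) => h l%:C al) reg_C (@reg_ran) reg_B reg_D hM).
Qed.

(** The state driven by [v] and the input [u] at the frequency [l]. *)
Lemma node_solution l v u : rho A l ->
  let x := resolvent A l v + R_ext l (opB S u) in
  [/\ dom (C_Lambda S) x, A_ext S x + opB S u = emb S (l *: x - v) &
      C_Lambda S x + opD S u = opC S (resolvent A l v) + transfer S l u].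
Proof.
move=> rl x; have [D1 e1] := reg_CL_dom (res_dom rl v).
have [D2 e2] := lin_opD reg_CL_lin D1 (@reg_ran l u rl).
split=> //; last by rewrite e2 e1 /transfer addrA.
rewrite /x (linP_D (A_ext_lin reg_dense)) (A_ext_emb (res_dom rl v)) res_app //.
rewrite (R_ext_right reg_dense rl) !(linP_B (emb_lin S)) !(linP_Z (emb_lin S)).
by rewrite (linP_D (emb_lin S)); lmod.
Qed.

Lemma passive_ineq l v u : rho A l ->
  let x := resolvent A l v + R_ext l (opB S u) in
  complex.Re l * nrm x ^+ 2 - rp hil v x <=
    rp hil (opC S (resolvent A l v)) u + rp hil (transfer S l u) u.
Proof.
move=> rl /=; set x := resolvent A l v + _; have [_ e1 e2] := node_solution v u rl.
have := pS e1; rewrite e2 -/x => h.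
have -> : complex.Re l * nrm x ^+ 2 - rp hil v x = rp hil (l *: x - v) x.
  by rewrite rpBl rp_Zl rp_hil.
by rewrite -rpDl.
Qed.

(** The passivity inequality for the state [R B u], without the source [v]. *)
Lemma transfer_passive l u : rho A l ->
  complex.Re l * nrm (R_ext l (opB S u)) ^+ 2 <= rp hil (transfer S l u) u.
Proof.
move=> rl; have := passive_ineq 0 u rl.
by rewrite /= (linP_0 (res_lin rl)) (lin_op0 (C_lin reg_C)) !rp0l add0r subr0 add0r.
Qed.

Lemma transfer_accretive l u : rho A l -> 0 <= complex.Re l ->
  0 <= rp hil (transfer S l u) u.
Proof.
by move=> rl l0; apply: le_trans (transfer_passive u rl); rewrite mulr_ge0 // exprn_ge0.
Qed.

(** The feedthrough is the limit of accretive transfer values. *)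
Lemma opD_accretive u : 0 <= rp hil (opD S u) u.
Proof.
have [a [M [a0 h hM]]] := reg_half.
have := transfer_limit reg_dense passive_dissipative a0
  (fun l (al : a < l) => h l%:C al) reg_C (@reg_ran) (u := u).
move=> /(rp_cvgl (h := hil) (y := u)) c.
have c0 : (fun=> (0 : R)) l @[l --> (+oo : set_system R)] --> (0 : R) by exact: cvg_cst.
apply: (ler_cvg_to c0 c); exists a; split; first exact: num_real.
by move=> l al; apply: transfer_accretive; [exact: h|exact: le_trans (ltW al)].
Qed.

(** Everything is deduced from the bound on the transfer function. Passivity
    bounds [R B] by [transfer_passive], and then [C R] as the off-diagonal part
    of a nonnegative quadratic form in [v] and [u] whose other parts are
    bounded. *)
Lemma shifted_bounds : exists a K : R, [/\ 0 < a, 1 <= K &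
  forall l, complex.Re l = a -> [/\ rho A l,
    forall x, nrm (resolvent A l x) <= K * nrm x,
    forall u, nrm (R_ext l (opB S u)) <= K * nrm u,
    forall x, nrm (opC S (resolvent A l x)) <= K * nrm x &
    forall u, nrm (transfer S l u) <= K * nrm u]].
Proof.
have [a [M0 [a0 h hM]]] := reg_half.
have [M M1 hP] := transfer_half_bounded reg_D hM.
pose a1 := a + 1; have a11 : 1 <= a1 by rewrite lerDr.
have a1p : 0 < a1 by rewrite (lt_le_trans _ a11).
have M0' : 0 <= M by rewrite (le_trans _ M1).
pose K := 6 * M + 1.
exists a1, K; split=> //; first by rewrite /K lerDr mulr_ge0.
move=> l la; have al : a < complex.Re l by rewrite la ltrDl.
have rl := h _ al.
have hR x : nrm (resolvent A l x) <= nrm x.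
  have := dissipative_contr x rl passive_dissipative; rewrite la.
  by apply: le_trans; rewrite ler_peMl.
have hPl u := hP l u al.
have hB u : nrm (R_ext l (opB S u)) <= M * nrm u.
  rewrite -(@ler_pXn2r _ 2) ?nnegrE ?mulr_ge0 //.
  apply: (@le_trans _ _ (a1 * nrm (R_ext l (opB S u)) ^+ 2)).
    by rewrite ler_peMl // exprn_ge0.
  rewrite -la; apply: le_trans (transfer_passive u rl) _.
  apply: le_trans (rp_hil_le _ _) _.
  apply: (@le_trans _ _ (M * nrm u * nrm u)); first by apply: ler_wpM2r.
  rewrite -mulrA exprMn -expr2; apply: ler_wpM2r; first by rewrite exprn_ge0.
  by rewrite expr2 ler_peMl.
have wk (c : R) (t : R) : 0 <= t -> c <= K -> c * t <= K * t.
  by move=> t0 cK; apply: ler_wpM2r.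
split=> // [x|u|v|u].
- by apply: le_trans (hR x) _; rewrite -{1}[nrm x]mul1r wk // /K lerDr mulr_ge0.
- by apply: le_trans (hB u) _; apply: wk => //; rewrite /K; lra.
- set w := opC S _.
  have s0 : (0 : R) < (2 * M)^-1 by rewrite invr_gt0 mulr_gt0 // (lt_le_trans _ M1).
  (* The input that makes the form smallest, up to constants. *)
  pose s := (2 * M)^-1; pose u := - (s%:C *: w).
  have := passive_ineq v u rl; rewrite /= -/w la.
  set x := resolvent A l v + _.
  have b1 : rp hil v x <= nrm v * (nrm v + M * nrm u).
    apply: le_trans (rp_hil_le _ _) _; apply: ler_wpM2l => //.
    by apply: le_trans (ler_nrmD _ _) _; apply: lerD.
  have b2 : rp hil (transfer S l u) u <= M * nrm u * nrm u.
    by apply: le_trans (rp_hil_le _ _) _; apply: ler_wpM2r.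
  have b3 : rp hil w u = - (s * nrm w ^+ 2) by rewrite rpNr rpZr rp_hil.
  have nu : nrm u = s * nrm w by rewrite nrmN nrmZ cabs_real gtr0_norm.
  have b4 : 0 <= a1 * nrm x ^+ 2 by rewrite mulr_ge0 ?exprn_ge0 // ltW.
  rewrite b3 => b5.
  have sM : M * s = 2^-1 by rewrite /s; field; rewrite gt_eqF // (lt_le_trans _ M1).
  have b6 : nrm w ^+ 2 <= 2 * M * nrm v * nrm w + 4 * M * nrm v ^+ 2.
    rewrite nu in b1 b2.
    have e1 : nrm v * (nrm v + M * (s * nrm w)) = nrm v ^+ 2 + 2^-1 * nrm v * nrm w.
      by rewrite (mulrA M) sM; ring.
    have e2 : M * (s * nrm w) * (s * nrm w) = 2^-1 * (s * nrm w ^+ 2).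
      by rewrite (mulrA M) sM; ring.
    rewrite e1 in b1; rewrite e2 in b2.
    have b7 : 2^-1 * (s * nrm w ^+ 2) <= nrm v ^+ 2 + 2^-1 * nrm v * nrm w by lra.
    have := ler_wpM2l (_ : 0 <= 4 * M) b7; rewrite mulr_ge0 // => /(_ isT).
    have -> : 4 * M * (2^-1 * (s * nrm w ^+ 2)) = nrm w ^+ 2.
      have -> : 4 * M * (2^-1 * (s * nrm w ^+ 2)) = 2 * (M * s) * nrm w ^+ 2 by field.
      by rewrite sM; field.
    have -> : 4 * M * (nrm v ^+ 2 + 2^-1 * nrm v * nrm w) = 2 * M * nrm v * nrm w + 4 * M * nrm v ^+ 2.
      by field.
    by [].
  have [wv|vw] := leP (nrm w) (nrm v).
    by apply: le_trans wv _; rewrite -{1}[nrm v]mul1r wk // /K lerDr mulr_ge0.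
  have wp : 0 < nrm w by exact: le_lt_trans vw.
  apply: (@le_trans _ _ (6 * M * nrm v)); last by rewrite /K mulrDl mul1r; have := nrm_ge0 v; lra.
  rewrite -(ler_pM2r wp) -expr2; apply: le_trans b6 _.
  have : M * nrm v * nrm v <= M * nrm v * nrm w by rewrite ler_wpM2l ?mulr_ge0 // ltW.
  by rewrite expr2; lra.
- by apply: le_trans (hPl u) _; apply: wk => //; rewrite /K; lra.
Qed.

End PassiveSystem.

(** * Membership in the interconnection domain and bounds on the axis *)
Section NodeExtra.
Context {R : realType} {X U : hilbertType R} (S : system X U U).
Context (rS : regular S) (pS : impedance_passive S).
Local Notation A := (opA S).

Lemma X_B_lin a x y : X_B S x -> X_B S y -> X_B S (a *: x + y).
Proof.
move=> [x' [u [Dx ->]]] [y' [v [Dy ->]]]; have [_ H] := rho_lin (rho0 S).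
exists (a *: x' + y'), (a *: u + v); split; first by case: (H a _ _ Dx Dy).
by have [lB _] := reg_B rS; rewrite lB (R_ext_lin (rho0 S)); lmod.
Qed.

Lemma X_B_dom x : X_B S x -> dom (C_Lambda S) x.
Proof.
move=> [y [u [Dy ->]]]; have [D1 _] := reg_CL_dom rS pS Dy.
by case: (lin_opD (reg_CL_lin rS) D1 (@reg_ran _ _ _ S rS _ u (rho0 S))).
Qed.

Lemma X_B_res l v u : rho A l -> X_B S (resolvent A l v + R_ext l (opB S u)).
Proof.
move=> rl; set w := R_ext (lambda0 S) (opB S u).
exists (resolvent A l v + (lambda0 S - l) *: resolvent A l w), u; split.
  have [_ H] := rho_lin (rho0 S).
  by rewrite addrC; apply: (H _ _ _ _ _).1; exact: res_dom.
by rewrite (R_ext_shift (reg_dense rS pS) (opB S u) rl (rho0 S)) -/w; lmod.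
Qed.

(** Every solution of the state equation comes from [node_solution]. *)
Lemma node_state l x u w : rho A l -> A_ext S x + opB S u = emb S w ->
  x = resolvent A l (l *: x - w) + R_ext l (opB S u).
Proof.
move=> rl e; rewrite -[LHS](R_ext_left (reg_dense rS pS) rl).
have -> : l *: emb S x - A_ext S x = emb S (l *: x - w) + opB S u.
  by rewrite (linP_B (emb_lin S)) (linP_Z (emb_lin S)) -e; lmod.
by rewrite (linP_D (R_ext_lin rl)) R_ext_emb.
Qed.

Lemma node_output l x u w : rho A l -> A_ext S x + opB S u = emb S w ->
  C_Lambda S x + opD S u = opC S (resolvent A l (l *: x - w)) + transfer S l u.
Proof.
move=> rl e; have [_ _ e2] := node_solution rS pS (l *: x - w) u rl.
by rewrite -e2 -(node_state rl e).
Qed.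

(** The bounds of [shifted_bounds] are moved by the fixed distance [a], at the
    cost of one resolvent on the axis. *)
Lemma axis_bounds (N : R) : exists2 K : R, 1 <= K & forall w, rho A (imag w) ->
  (forall x, nrm (resolvent A (imag w) x) <= N * nrm x) ->
  [/\ forall u, nrm (R_ext (imag w) (opB S u)) <= K * nrm u,
      forall x, nrm (opC S (resolvent A (imag w) x)) <= K * nrm x &
      forall u, nrm (transfer S (imag w) u) <= K * nrm u].
Proof.
have [a [k [a0 k1 H]]] := shifted_bounds rS pS.
have k0 : 0 <= k by rewrite (le_trans _ k1).
have N0 : 0 <= `|N| by [].
pose K := k * (1 + a * `|N|) + k * (1 + a * `|N|) * (1 + a * k).
have aN : 0 <= a * `|N| by rewrite mulr_ge0 // ltW.
have ak : 0 <= a * k by rewrite mulr_ge0 // ltW.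
have kN : 1 <= k * (1 + a * `|N|) by rewrite mulr_ege1 // lerDl.
have kN0 : 0 <= k * (1 + a * `|N|) by rewrite (le_trans _ kN).
have K1 : k * (1 + a * `|N|) <= K by rewrite /K lerDl mulr_ge0 // addr_ge0.
exists K; first exact: le_trans K1.
move=> w rw hN; set l := imag w; pose m : R[i] := a%:C + l.
have ma : complex.Re m = a by rewrite /m /= addr0.
have [rm h1 h2 h3 h4] := H m ma.
have ml : m - l = a%:C by rewrite /m addrK.
have hN' x : nrm (resolvent A l x) <= `|N| * nrm x.
  by apply: le_trans (hN x) _; apply: ler_wpM2r => //; exact: ler_norm.
have wk (t : R) : 0 <= t -> k * (1 + a * `|N|) * t <= K * t.
  by move=> t0; exact: ler_wpM2r.
have ca (V : normedModType R[i]) (x : V) : nrm (a%:C *: x) = a * nrm x.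
  by rewrite nrmZ cabs_real gtr0_norm.
have hC x : nrm (opC S (resolvent A l x)) <= k * (1 + a * `|N|) * nrm x.
  have -> : resolvent A l x = resolvent A m (x + a%:C *: resolvent A l x).
    rewrite (linP_D (res_lin rm)) (linP_Z (res_lin rm)).
    have := res_identity x rm rw; rewrite -/l => ->.
    by rewrite -ml; lmod.
  apply: le_trans (h3 _) _; rewrite -mulrA ler_wpM2l //.
  apply: le_trans (ler_nrmD _ _) _; rewrite ca mulrDl mul1r lerD2l -mulrA.
  by apply: ler_wpM2l => //; exact: ltW.
split=> [u|x|u].
- apply: le_trans (wk _ (nrm_ge0 u)).
  rewrite (R_ext_shift (reg_dense rS pS) (opB S u) rw rm) ml.
  apply: le_trans (ler_nrmD _ _) _; rewrite ca.
  apply: (@le_trans _ _ (k * nrm u + a * (`|N| * (k * nrm u)))).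
    apply: lerD; first exact: h2.
    apply: ler_wpM2l; first exact: ltW.
    by apply: le_trans (hN' _) _; apply: ler_wpM2l.
  by rewrite le_eqVlt; apply/orP; left; apply/eqP; ring.
- by apply: le_trans (wk _ (nrm_ge0 x)).
- rewrite (reg_transfer_shift rS pS u rw rm) ml.
  apply: le_trans (ler_nrmD _ _) _; rewrite ca.
  apply: (@le_trans _ _ (k * nrm u + a * (k * (1 + a * `|N|) * (k * nrm u)))).
    apply: lerD; first exact: h4.
    apply: ler_wpM2l; first exact: ltW.
    by apply: le_trans (hC _) _; apply: ler_wpM2l.
  have u0 := nrm_ge0 u.
  have : k * nrm u <= k * (1 + a * `|N|) * nrm u.
    by rewrite ler_wpM2r // ler_peMr // lerDl.
  have : 0 <= k * (1 + a * `|N|) * nrm u by rewrite mulr_ge0.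
  by rewrite /K; lra.
Qed.

End NodeExtra.

(** * The closed loop off the spectrum of A_c *)
Section ClosedLoopResolvent.
Context {R : realType} {X Z U : hilbertType R} (S : system X U U) (Sc : system Z U U).
Context (rS : regular S) (pS : impedance_passive S).
Context (rSc : regular Sc) (pSc : impedance_passive Sc) (hDc : nonneg_op (opD Sc)).
Local Notation A := (opA S).
Local Notation Ac := (opA Sc).
Local Notation Ae := (closed_loop S Sc).
Local Notation D := (opD S).
Local Notation Dc := (opD Sc).

Let bD : bounded_operator D := reg_D rS.
Let bDc : bounded_operator Dc := reg_D rSc.
Let lD : linear D := proj1 bD.
Let lDc : linear Dc := proj1 bDc.
Let lB : linear (opB S) := proj1 (reg_B rS).
Let lBc : linear (opB Sc) := proj1 (reg_B rSc).

(** The second feedthrough is cocoercive and the first one is accretive. *)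
Lemma DDc_invertible : boundedly_invertible (fun u => u + D (Dc u)).
Proof.
have [g g0 hg] := nonneg_cocoercive bDc hDc.
by apply: loop_invertible g0 hg => // x; exact: opD_accretive.
Qed.

Lemma DcD_invertible : boundedly_invertible (fun u => u + Dc (D u)).
Proof. exact: swap_invertible DDc_invertible. Qed.

Local Notation Q1 := (inv_op (fun u => u + D (Dc u))).
Local Notation Q2 := (inv_op (fun u => u + Dc (D u))).

Lemma Q2E w : Q2 w = w - Dc (Q1 (D w)).
Proof.
rewrite -[RHS](inv_opK DcD_invertible); congr (Q2 _).
have e : Q1 (D w) + D (Dc (Q1 (D w))) = D w := inv_opVK DDc_invertible (D w).
set q := Q1 (D w) in e *; rewrite (linP_B lD) (linP_B lDc) -{1}e (linP_D lDc); lmod.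
Qed.

(** The interconnection in terms of its signals: [u] enters the first system and
    [- y] the second. *)
Definition loop_eqs (x : X) (z : Z) (u y : U) (w1 : X) (w2 : Z) :=
  [/\ y = C_Lambda S x + D u, u = C_Lambda Sc z - Dc y,
      A_ext S x + opB S u = emb S w1 & A_ext Sc z + opB Sc (- y) = emb Sc w2].

(** The rows of the closed-loop operator are the state equations of the two
    systems once the signals are eliminated by [Q1] and [Q2]. *)
Lemma loop_rows (x : X) (z : Z) (u y : U) :
  y = C_Lambda S x + D u -> u = C_Lambda Sc z - Dc y ->
  A_ext S x - opB S (Dc (Q1 (C_Lambda S x))) + opB S (Q2 (C_Lambda Sc z)) =
    A_ext S x + opB S u /\
  - opB Sc (Q1 (C_Lambda S x))
    + (A_ext Sc z - opB Sc (Q1 (D (C_Lambda Sc z)))) = A_ext Sc z + opB Sc (- y).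
Proof.
move=> ey eu; set c := C_Lambda S x in ey *; set d := C_Lambda Sc z in eu *.
have yQ : y = Q1 c + Q1 (D d).
  rewrite -(linP_D (inv_op_lin DDc_invertible)) -[LHS](inv_opK DDc_invertible).
  by congr (Q1 _); rewrite {1}ey eu (linP_B lD); lmod.
have uQ : u = Q2 d - Dc (Q1 c).
  by rewrite Q2E eu yQ (linP_D lDc); lmod.
split; first by rewrite uQ (linP_B lB); lmod.
by rewrite yQ (linP_N lBc) (linP_D lBc); lmod.
Qed.

Lemma loop_intro x z u y w1 w2 : X_B S x -> X_B Sc z ->
  loop_eqs x z u y w1 w2 -> dom Ae (x, z) /\ Ae (x, z) = (w1, w2).
Proof.
move=> Xx Xz [ey eu e1 e2]; have [r1 r2] := loop_rows ey eu.
rewrite e1 in r1; rewrite e2 in r2; split.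
  by split=> //=; [exists w1|exists w2].
by congr pair; rewrite /= ?r1 ?r2 restrictE.
Qed.

Lemma loop_elim x z : dom Ae (x, z) ->
  [/\ X_B S x, X_B Sc z & exists u y, loop_eqs x z u y (Ae (x, z)).1 (Ae (x, z)).2].
Proof.
move=> [/= Xx Xz [w1 _ e1] [w2 _ e2]]; split=> //.
pose y := Q1 (C_Lambda S x + D (C_Lambda Sc z)); pose u := C_Lambda Sc z - Dc y.
have ey : y = C_Lambda S x + D u.
  have e : y + D (Dc y) = C_Lambda S x + D (C_Lambda Sc z) := inv_opVK DDc_invertible _.
  rewrite /u (linP_B lD).
  have -> : C_Lambda S x + (D (C_Lambda Sc z) - D (Dc y)) =
    (C_Lambda S x + D (C_Lambda Sc z)) - D (Dc y) by lmod.
  by rewrite -e addrK.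
have [r1 r2] := loop_rows ey (erefl u).
exists u, y; split=> //=; first by rewrite -r1 -e1 restrictE.
by rewrite -r2 -e2 restrictE.
Qed.

Lemma closed_loop_lin : lin_op (dom Ae) Ae.
Proof.
have lCc := reg_CL_lin rSc; have lCS := reg_CL_lin rS.
have lA := A_ext_lin (reg_dense rS pS); have lAc := A_ext_lin (reg_dense rSc pSc).
have X0 (W V : hilbertType R) (T : system W V V) : regular T -> X_B T 0.
  move=> rT; exists 0, 0; split; first by case: (rho_lin (rho0 T)).
  have [lT _] := reg_B rT.
  by rewrite (linP_0 lT) (linP_0 (R_ext_lin (rho0 T))) addr0.
split.
  apply: (@loop_intro 0 0 0 0 0 0 (X0 _ _ _ rS) (X0 _ _ _ rSc) _).1.
  split.
  - by rewrite (lin_op0 lCS) (linP_0 lD) addr0.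
  - by rewrite (lin_op0 lCc) (linP_0 lDc) subr0.
  - by rewrite (linP_0 lA) (linP_0 lB) (linP_0 (emb_lin S)) addr0.
  - by rewrite (linP_0 lAc) oppr0 (linP_0 lBc) (linP_0 (emb_lin Sc)) addr0.
move=> a [x z] [x' z'] Dp Dp'.
have [Xx Xz [u [y [ey eu e1 e2]]]] := loop_elim Dp.
have [Xx' Xz' [u' [y' [ey' eu' e1' e2']]]] := loop_elim Dp'.
have := @loop_intro (a *: x + x') (a *: z + z') (a *: u + u') (a *: y + y')
  (a *: (Ae (x, z)).1 + (Ae (x', z')).1) (a *: (Ae (x, z)).2 + (Ae (x', z')).2).
case; [exact: X_B_lin|exact: X_B_lin| |by move=> ? ->].
have [_ H] := lCS; have [_ e3] := H a _ _ (X_B_dom rS pS Xx) (X_B_dom rS pS Xx').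
have [_ Hc] := lCc; have [_ e4] := Hc a _ _ (X_B_dom rSc pSc Xz) (X_B_dom rSc pSc Xz').
split.
- by rewrite e3 lD {1}ey {1}ey'; lmod.
- by rewrite e4 lDc {1}eu {1}eu'; lmod.
- by rewrite lA lB emb_lin -e1 -e1'; lmod.
- have -> : - (a *: y + y') = a *: (- y) + (- y') by lmod.
  by rewrite lAc lBc emb_lin -e2 -e2'; lmod.
Qed.

Section Axis.
Context (l : R[i]) (rl : rho A l).
Local Notation P := (transfer S l).

Section Regular.
Context (rlc : rho Ac l).
Local Notation G := (transfer Sc l).

Lemma loop_solvable : boundedly_invertible (fun u => u + P (G u)) ->
  forall q, exists2 p, dom Ae p & l *: p - Ae p = q.
Proof.
move=> inv [f g]; have lP := proj1 (reg_transfer rS pS rl).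
have lG := proj1 (reg_transfer rSc pSc rlc).
pose h := opC S (resolvent A l f); pose k := opC Sc (resolvent Ac l g).
pose y := inv_op (fun u => u + P (G u)) (h + P k).
have ey : y + P (G y) = h + P k := inv_opVK inv _.
pose u := k - G y.
pose x := resolvent A l f + R_ext l (opB S u).
pose z := resolvent Ac l g + R_ext l (opB Sc (- y)).
have [_ a1 b1] := node_solution rS pS f u rl; rewrite -/x in a1 b1.
have [_ a2 b2] := node_solution rSc pSc g (- y) rlc; rewrite -/z in a2 b2.
have [Dp ep] : dom Ae (x, z) /\ Ae (x, z) = (l *: x - f, l *: z - g).
  apply: (@loop_intro x z u y); [exact: X_B_res|exact: X_B_res|].
  split=> //.
  - rewrite b1 -/h /u (linP_B lP).
    have -> : h + (P k - P (G y)) = (h + P k) - P (G y) by lmod.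
    by rewrite -ey addrK.
  - by rewrite /u /k -(linP_N lDc) b2 (linP_N lG).
exists (x, z) => //; rewrite ep.
by congr pair; rewrite /=; lmod.
Qed.

(** The constant is explicit because it has to be uniform in the frequency. *)
Lemma loop_apriori (K k : R) : 1 <= K -> 1 <= k ->
  (forall x, nrm (resolvent A l x) <= K * nrm x) ->
  (forall x, nrm (resolvent Ac l x) <= K * nrm x) ->
  (forall u, nrm (R_ext l (opB S u)) <= K * nrm u) ->
  (forall u, nrm (R_ext l (opB Sc u)) <= K * nrm u) ->
  (forall x, nrm (opC S (resolvent A l x)) <= K * nrm x) ->
  (forall x, nrm (opC Sc (resolvent Ac l x)) <= K * nrm x) ->
  (forall u, nrm (P u) <= K * nrm u) ->
  (forall u, nrm (G u) <= K * nrm u) ->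
  (forall u, nrm u <= k * nrm (u + P (G u))) ->
  forall p, dom Ae p -> nrm p <= 4 * k * K ^+ 4 * nrm (l *: p - Ae p).
Proof.
move=> K1 k1 hR hRc hB hBc hC hCc hP hG hk [x z] Dp.
have [Xx Xz [u [y [ey eu e1 e2]]]] := loop_elim Dp.
have lP := proj1 (reg_transfer rS pS rl).
have lG := proj1 (reg_transfer rSc pSc rlc).
set f := l *: x - (Ae (x, z)).1; set g := l *: z - (Ae (x, z)).2.
have qE : l *: (x, z) - Ae (x, z) = (f, g) by rewrite /f /g; move: (Ae (x, z)) => [a b].
rewrite qE; set n := nrm (f, g).
have /andP[fn gn] : (nrm f <= n) && (nrm g <= n) by rewrite -[_ && _](nrm_pair_le (f, g)).
have n0 : 0 <= n by exact: nrm_ge0.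
have xE := node_state rS pS rl e1; rewrite -/f in xE.
have zE := node_state rSc pSc rlc e2; rewrite -/g in zE.
have yE := node_output rS pS rl e1; rewrite -/f -ey in yE.
have uE := node_output rSc pSc rlc e2; rewrite -/g (linP_N lDc) -eu (linP_N lG) in uE.
have hy : nrm (y + P (G y)) <= K * n + K * (K * n).
  have -> : y + P (G y) = opC S (resolvent A l f) + P (opC Sc (resolvent Ac l g)).
    by rewrite {1}yE uE (linP_B lP); lmod.
  apply: le_trans (ler_nrmD _ _) _; apply: lerD.
    by apply: le_trans (hC _) _; apply: ler_wpM2l => //; exact: le_trans K1.
  have K0 : 0 <= K by exact: le_trans K1.
  apply: le_trans (hP _) _; apply: ler_wpM2l => //.
  by apply: le_trans (hCc _) _; apply: ler_wpM2l.
have K0 : 0 <= K by exact: le_trans K1.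
have k0 : 0 <= k by exact: le_trans k1.
have b1 : nrm y <= k * (K * n + K * (K * n)).
  by apply: le_trans (hk y) _; apply: ler_wpM2l.
have b2 : nrm u <= K * n + K * nrm y.
  rewrite uE; apply: le_trans (ler_nrmB _ _) _; apply: lerD => //.
  by apply: le_trans (hCc _) _; apply: ler_wpM2l.
have b3 : nrm x <= K * n + K * nrm u.
  rewrite xE; apply: le_trans (ler_nrmD _ _) _; apply: lerD => //.
  by apply: le_trans (hR _) _; apply: ler_wpM2l.
have b4 : nrm z <= K * n + K * nrm y.
  rewrite zE; apply: le_trans (ler_nrmD _ _) _; apply: lerD => //.
    by apply: le_trans (hRc _) _; apply: ler_wpM2l.
  by rewrite -(nrmN y).
have Kn : 0 <= K * n by rewrite mulr_ge0.
have c1 : nrm y <= 2 * k * K ^+ 2 * n.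
  apply: le_trans b1 _.
  have : K * n <= K ^+ 2 * n by rewrite ler_wpM2r // expr2 ler_peMl.
  have -> : K * (K * n) = K ^+ 2 * n by ring.
  move=> h; have := ler_wpM2l k0 h.
  by lra.
have KK j : n <= k * K ^+ j * n.
  by rewrite ler_peMl // mulr_ege1 // exprn_ege1.
have c2 : nrm u <= 3 * k * K ^+ 3 * n.
  apply: le_trans b2 _; have := ler_wpM2l K0 c1; have := ler_wpM2l K0 (KK 2%N).
  rewrite !exprS expr0 !mulr1; lra.
have c3 : nrm x <= 4 * k * K ^+ 4 * n.
  apply: le_trans b3 _; have := ler_wpM2l K0 c2; have := ler_wpM2l K0 (KK 3%N).
  rewrite !exprS expr0 !mulr1; lra.
have c4 : nrm z <= 4 * k * K ^+ 4 * n.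
  apply: (@le_trans _ _ (3 * k * K ^+ 3 * n)).
    apply: le_trans b4 _; have := ler_wpM2l K0 c1; have := ler_wpM2l K0 (KK 2%N).
    rewrite !exprS expr0 !mulr1; lra.
  have : k * K ^+ 3 * n <= k * K ^+ 4 * n.
    by rewrite ler_wpM2r // ler_wpM2l // [X in _ <= X]exprS ler_peMl // exprn_ge0.
  have : 0 <= k * K ^+ 4 * n by rewrite !mulr_ge0 // exprn_ge0.
  by lra.
by rewrite nrm_pair_le /= c3 c4.
Qed.

Lemma loop_rho : boundedly_invertible (fun u => u + P (G u)) -> rho Ae l.
Proof.
move=> inv.
have gen (V W : normedModType R[i]) (T : V -> W) : bounded_operator T ->
   exists2 M, 1 <= M & forall x, nrm (T x) <= M * nrm x.
  by move=> /bounded_pos[].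
have [K1 K11 h1] := gen _ _ _ (res_bounded rl).
have [K2 K21 h2] := gen _ _ _ (res_bounded rlc).
have [K3 K31 h3] := gen _ _ _ (reg_RB rS rl).
have [K4 K41 h4] := gen _ _ _ (reg_RB rSc rlc).
have [K5 K51 h5] := gen _ _ _ (reg_CR rS rl).
have [K6 K61 h6] := gen _ _ _ (reg_CR rSc rlc).
have [K7 K71 h7] := gen _ _ _ (reg_transfer rS pS rl).
have [K8 K81 h8] := gen _ _ _ (reg_transfer rSc pSc rlc).
have [k k1 hk] := gen _ _ _ (inv_op_bounded inv).
pose K := K1 + K2 + K3 + K4 + K5 + K6 + K7 + K8.
have wk (t c : R) : 0 <= t -> c <= K -> c * t <= K * t.
  by move=> t0 cK; apply: ler_wpM2r.
apply: (@rho_intro _ _ _ _ (4 * k * K ^+ 4) closed_loop_lin); last exact: loop_solvable.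
apply: loop_apriori => //; first by rewrite /K; lra.
- by move=> x; apply: le_trans (h1 x) _; apply: wk => //; rewrite /K; lra.
- by move=> x; apply: le_trans (h2 x) _; apply: wk => //; rewrite /K; lra.
- by move=> x; apply: le_trans (h3 x) _; apply: wk => //; rewrite /K; lra.
- by move=> x; apply: le_trans (h4 x) _; apply: wk => //; rewrite /K; lra.
- by move=> x; apply: le_trans (h5 x) _; apply: wk => //; rewrite /K; lra.
- by move=> x; apply: le_trans (h6 x) _; apply: wk => //; rewrite /K; lra.
- by move=> x; apply: le_trans (h7 x) _; apply: wk => //; rewrite /K; lra.
- by move=> x; apply: le_trans (h8 x) _; apply: wk => //; rewrite /K; lra.
- by move=> u; rewrite -{1}(inv_opK inv u).
Qed.

End Regular.
End Axis.
End ClosedLoopResolvent.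

(** * The closed loop at an eigenfrequency of A_c *)
Section ResonantFrequency.
Context {R : realType} {X Z U : hilbertType R} (S : system X U U) (Sc : system Z U U).
Context (rS : regular S) (pS : impedance_passive S).
Context (rSc : regular Sc) (pSc : impedance_passive Sc) (hDc : nonneg_op (opD Sc)).
Local Notation A := (opA S).
Local Notation Ac := (opA Sc).
Local Notation Ae := (closed_loop S Sc).
Local Notation Dc := (opD Sc).
Context (l : R[i]) (rl : rho A l).
Local Notation P := (transfer S l).
Context (hP : exists2 c, 0 < c & forall u, c * nrm u ^+ 2 <= rp hil (P u) u).
Local Notation V := (inv_op (fun u => u + Dc (P u))).
Local Notation AF := (feedback Sc (P \o V)).
Context (rF : rho AF l).

Let bP : bounded_operator P := reg_transfer rS pS rl.
Let lP : linear P := proj1 bP.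
Let bDc : bounded_operator Dc := reg_D rSc.
Let lDc : linear Dc := proj1 bDc.
Let lBc : linear (opB Sc) := proj1 (reg_B rSc).
Let lAc : linear (A_ext Sc) := A_ext_lin (reg_dense rSc pSc).
Let lCc : lin_op (dom (C_Lambda Sc)) (C_Lambda Sc) := reg_CL_lin rSc.

Lemma DcP_invertible : boundedly_invertible (fun u => u + Dc (P u)).
Proof.
have [c c0 hc] := hP; have [g g0 hg] := strict_cocoercive bP c0 hc.
apply: loop_invertible g0 hg => // x.
by have := proj2 hDc x; rewrite lecE => /andP[].
Qed.

Context (mu : R[i]) (rmu : rho Ac mu) (mu0 : 0 <= complex.Re mu).
Local Notation G := (transfer Sc mu).
Let bG : bounded_operator G := reg_transfer rSc pSc rmu.
Let lG : linear G := proj1 bG.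

Lemma GP_invertible : boundedly_invertible (fun u => u + G (P u)).
Proof.
have [c c0 hc] := hP; have [g g0 hg] := strict_cocoercive bP c0 hc.
by apply: loop_invertible g0 hg => // x; exact: transfer_accretive.
Qed.

Lemma PG_invertible : boundedly_invertible (fun u => u + P (G u)).
Proof. exact: swap_invertible GP_invertible. Qed.

Local Notation W := (inv_op (fun u => u + P (G u))).
(** The state produced by the input [- v] at [mu]. Its state equation has the
    unbounded term [opB Sc v]; subtracting it from a state leaves a source in
    [Z]. *)
Definition input_lift (v : U) : Z := - R_ext mu (opB Sc v).

Lemma input_liftP v : [/\ X_B Sc (input_lift v),
  A_ext Sc (input_lift v) = mu *: emb Sc (input_lift v) + opB Sc v &
  C_Lambda Sc (input_lift v) = Dc v - G v].
Proof.
have e : input_lift v = resolvent Ac mu 0 + R_ext mu (opB Sc (- v)).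
  by rewrite (linP_0 (res_lin rmu)) (linP_N lBc) (linP_N (R_ext_lin rmu)) add0r.
have [_ e1 e2] := node_solution rSc pSc 0 (- v) rmu.
rewrite -e in e1 e2; split.
- by rewrite e; exact: X_B_res.
- move: e1; rewrite subr0 (linP_Z (emb_lin Sc)) (linP_N lBc) => <-; lmod.
- move: e2; rewrite (linP_0 (res_lin rmu)) (lin_op0 (C_lin (reg_C rSc))).
  rewrite (linP_N lDc) (linP_N lG) => e2.
  have -> : C_Lambda Sc (input_lift v) = (C_Lambda Sc (input_lift v) - Dc v) + Dc v by lmod.
  by rewrite e2; lmod.
Qed.

(** The variable [s] is the input of [P] in the feedback: it makes the inverse in
    the definition of the operator disappear. *)
Lemma AF_intro (z : Z) (s : U) (w : Z) : dom (C_Lambda Sc) z ->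
  s + Dc (P s) = C_Lambda Sc z -> A_ext Sc z - opB Sc (P s) = emb Sc w ->
  dom AF z /\ AF z = w.
Proof.
move=> Dz es ew.
have eV : V (C_Lambda Sc z) = s by rewrite -es (inv_opK DcP_invertible).
have ev : A_ext Sc z - opB Sc ((P \o V) (C_Lambda Sc z)) = emb Sc w.
  by rewrite /= eV.
split; first by split=> //; exists w.
by rewrite /= eV ew restrictE.
Qed.

Lemma AF_elim (z : Z) : dom AF z ->
  exists s, [/\ dom (C_Lambda Sc) z, s + Dc (P s) = C_Lambda Sc z &
    A_ext Sc z - opB Sc (P s) = emb Sc (AF z)].
Proof.
move=> [Dz [w _ ew]]; exists (V (C_Lambda Sc z)); split=> //.
  exact: (inv_opVK DcP_invertible).
by rewrite /= in ew *; rewrite -ew restrictE.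
Qed.

Lemma AF_X_B z : dom AF z -> X_B Sc z.
Proof.
move=> /AF_elim[s [_ _ e]].
have e' : A_ext Sc z + opB Sc (- P s) = emb Sc (AF z) by rewrite (linP_N lBc).
rewrite (node_state rSc pSc rmu e'); exact: X_B_res.
Qed.

(** The lift carries the source that the first system feeds through [opB Sc].
    The choice of [v] is the one for which the signals of the lift and of the
    feedback operator add up to signals of the closed loop. *)
Lemma resonant_solvable q : exists2 p, dom Ae p & l *: p - Ae p = q.
Proof.
case: q => f g.
pose h := opC S (resolvent A l f); pose v := W h.
have ev : v + P (G v) = h := inv_opVK PG_invertible h.
have [Xz0 Az0 Cz0] := input_liftP v; set z0 := input_lift v in Xz0 Az0 Cz0.
pose z1 := resolvent AF l (g - (l - mu) *: z0).
have Dz1 : dom AF z1 by exact: res_dom.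
have Xz1 := AF_X_B Dz1.
have AFz1 : AF z1 = l *: z1 - (g - (l - mu) *: z0) by rewrite res_app.
have [s [Dcz1 es e1]] := AF_elim Dz1; rewrite AFz1 in e1.
pose z := z0 + z1; pose y := v + P s; pose u := s - G v.
pose x := resolvent A l f + R_ext l (opB S u).
have [_ a1 b1] := node_solution rS pS f u rl; rewrite -/x -/h in a1 b1.
have Xz : X_B Sc z by rewrite /z -(scale1r z0); exact: X_B_lin.
have [_ Cz] := lin_opD lCc (X_B_dom rSc pSc Xz0) Dcz1.
have [Dp ep] : dom Ae (x, z) /\ Ae (x, z) = (l *: x - f, l *: z - g).
  apply: (@loop_intro _ _ _ _ _ _ rS pS rSc hDc x z u y) => //.
    exact: X_B_res.
  split=> //.
  - by rewrite b1 -ev /y /u (linP_B lP); lmod.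
  - by rewrite /z Cz Cz0 -es /y /u (linP_D lDc v (P s)); lmod.
  - rewrite /z (linP_D lAc) Az0 (linP_N lBc) /y (linP_D lBc).
    have -> : A_ext Sc z1 = emb Sc (l *: z1 - (g - (l - mu) *: z0)) + opB Sc (P s).
      by rewrite -e1; lmod.
    rewrite !(linP_B (emb_lin Sc)) !(linP_Z (emb_lin Sc)) (linP_D (emb_lin Sc)).
    by lmod.
exists (x, z) => //; rewrite ep.
by congr pair; rewrite /=; lmod.
Qed.

(** The same decomposition of a given solution. The resolvent of the feedback
    operator bounds its state; its signals are then bounded through the loop
    [1 + G P] at [mu], since at [l] there is no resolvent of [A_c]. *)
Lemma resonant_apriori : exists M, forall p, dom Ae p ->
  nrm p <= M * nrm (l *: p - Ae p).
Proof.
have [_ [kC kC1 hC]] := bounded_pos (reg_CR rS rl).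
have [_ [kW kW1 hW]] := bounded_pos (inv_op_bounded PG_invertible).
have [_ [kB kB1 hB]] := bounded_pos (reg_RB rSc rmu).
have [_ [kF kF1 hF]] := bounded_pos (res_bounded rF).
have [_ [kI kI1 hI]] := bounded_pos (inv_op_bounded GP_invertible).
have [_ [kD kD1 hD]] := bounded_pos (reg_CR rSc rmu).
have [_ [kG kG1 hG]] := bounded_pos bG.
have [_ [kR kR1 hR]] := bounded_pos (res_bounded rl).
have [_ [kE kE1 hE]] := bounded_pos (reg_RB rS rl).
have pos (t : R) : 1 <= t -> 0 <= t by exact: le_trans.
pose c0 := kB * (kW * kC).
pose c1 := kF * (1 + cabs (l - mu) * c0).
pose c2 := kI * (kD * (cabs (mu - l) * (c0 + c1) + 1) + kG * kC).
pose c3 := kR + kE * c2.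
have c00 : 0 <= c0 by do 2!(apply: mulr_ge0; first exact: pos); exact: pos.
have c10 : 0 <= c1.
  by apply: mulr_ge0; [exact: pos|rewrite addr_ge0 // mulr_ge0].
exists (Num.max c3 (c0 + c1)) => -[x z] Dp.
have [Xx Xz [u [y [ey eu e1 e2]]]] := loop_elim rS pS rSc hDc Dp.
set f := l *: x - (Ae (x, z)).1; set g := l *: z - (Ae (x, z)).2.
have qE : l *: (x, z) - Ae (x, z) = (f, g) by rewrite /f /g; move: (Ae (x, z)) => [a b].
rewrite qE; set n := nrm (f, g).
have /andP[fn gn] : (nrm f <= n) && (nrm g <= n) by rewrite -[_ && _](nrm_pair_le (f, g)).
have n0 : 0 <= n by exact: nrm_ge0.
have xE := node_state rS pS rl e1; rewrite -/f in xE.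
have yE := node_output rS pS rl e1; rewrite -/f -ey in yE.
have uE := node_output rSc pSc rmu e2.
rewrite (linP_N lDc) -eu (linP_N lG) in uE.
pose h := opC S (resolvent A l f); rewrite -/h in yE.
have hh : nrm h <= kC * n by apply: le_trans (hC _) _; apply: ler_wpM2l; rewrite ?pos.
pose v := W h.
have ev : v + P (G v) = h := inv_opVK PG_invertible h.
have [Xz0 Az0 Cz0] := input_liftP v; set z0 := input_lift v in Xz0 Az0 Cz0.
have b0 : nrm z0 <= c0 * n.
  rewrite /z0 nrmN; apply: le_trans (hB _) _; rewrite /c0 -!mulrA; apply: ler_wpM2l; rewrite ?pos //.
  by apply: le_trans (hW _) _; apply: ler_wpM2l; rewrite ?pos.
pose z1 := z - z0; pose s := u + G v.
have [Dz1 Cz1] := lin_opB lCc (X_B_dom rSc pSc Xz) (X_B_dom rSc pSc Xz0).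
have Ps : P s = y - v by rewrite /s (linP_D lP) yE -ev; lmod.
have [DF1 AF1] : dom AF z1 /\ AF z1 = l *: z1 - g + (l - mu) *: z0.
  apply: (@AF_intro _ s) => //.
    by rewrite Ps Cz1 Cz0 /s (linP_B lDc) eu; lmod.
  rewrite Ps /z1 (linP_B lAc) Az0 (linP_B lBc).
  have -> : A_ext Sc z = emb Sc (l *: z - g) + opB Sc y.
    have -> : l *: z - g = (Ae (x, z)).2 by rewrite /g; lmod.
    by rewrite -e2 (linP_N lBc); lmod.
  rewrite !(linP_D (emb_lin Sc)) !(linP_N (emb_lin Sc)) !(linP_Z (emb_lin Sc)).
  by rewrite !(linP_D (emb_lin Sc)) !(linP_N (emb_lin Sc)); lmod.
have z1E : z1 = resolvent AF l (g - (l - mu) *: z0).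
  by rewrite -[LHS](res_left rF DF1) AF1; congr resolvent; lmod.
have b1 : nrm z1 <= c1 * n.
  rewrite z1E; apply: le_trans (hF _) _; rewrite /c1 -mulrA; apply: ler_wpM2l; rewrite ?pos //.
  apply: le_trans (ler_nrmB _ _) _; rewrite mulrDl mul1r; apply: lerD => //.
  by rewrite nrmZ -mulrA; apply: ler_wpM2l.
have b2 : nrm z <= (c0 + c1) * n.
  have -> : z = z0 + z1 by rewrite /z1; lmod.
  by apply: le_trans (ler_nrmD _ _) _; rewrite mulrDl; apply: lerD.
have b3 : nrm u <= c2 * n.
  have -> : u = inv_op (fun u => u + G (P u)) (u + G (P u)).
    by rewrite (inv_opK GP_invertible).
  have -> : u + G (P u) = opC Sc (resolvent Ac mu ((mu - l) *: z + g)) - G h.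
    rewrite {1}uE yE (linP_D lG) /g.
    have -> : mu *: z - (Ae (x, z)).2 = (mu - l) *: z + (l *: z - (Ae (x, z)).2) by lmod.
    by lmod.
  apply: le_trans (hI _) _; rewrite /c2 -mulrA; apply: ler_wpM2l; rewrite ?pos //.
  apply: le_trans (ler_nrmB _ _) _; rewrite mulrDl; apply: lerD; last first.
    by apply: le_trans (hG _) _; rewrite -mulrA; apply: ler_wpM2l; rewrite ?pos.
  apply: le_trans (hD _) _; rewrite -mulrA; apply: ler_wpM2l; rewrite ?pos //.
  apply: le_trans (ler_nrmD _ _) _; rewrite mulrDl mul1r; apply: lerD => //.
  by rewrite nrmZ -mulrA; apply: ler_wpM2l.
have b4 : nrm x <= c3 * n.
  rewrite xE; apply: le_trans (ler_nrmD _ _) _; rewrite /c3 mulrDl; apply: lerD.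
    by apply: le_trans (hR _) _; apply: ler_wpM2l; rewrite ?pos.
  by apply: le_trans (hE _) _; rewrite -mulrA; apply: ler_wpM2l; rewrite ?pos.
rewrite nrm_pair_le /=; apply/andP; split.
  by apply: le_trans b4 _; apply: ler_wpM2r => //; rewrite le_max lexx.
by apply: le_trans b2 _; apply: ler_wpM2r => //; rewrite le_max lexx orbT.
Qed.

Lemma resonant_rho : rho Ae l.
Proof.
have [M hM] := resonant_apriori.
apply: (@rho_intro _ _ _ _ M) hM resonant_solvable.
exact: closed_loop_lin.
Qed.

End ResonantFrequency.

(** * Semigroups *)
Lemma cvg_near_eq T (U : topologicalType) (F : set_system T) {FF : Filter F}
    (f g : T -> U) (l : U) :
  (\forall t \near F, f t = g t) -> f t @[t --> F] --> l -> g t @[t --> F] --> l.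
Proof.
move=> fg fl N /fl; rewrite /fmap /=; apply: filterS2 fg => t /= -> //.
Qed.

Section Near.
Context {R : realType}.

Lemma near_right0 (P : R -> Prop) : (\forall h \near 0^'+, P h) ->
  exists2 d, 0 < d & forall h, 0 < h < d -> P h.
Proof.
move=> [d /= d0 hd]; exists d => // h /andP[h0 hd'].
by apply: hd => //=; rewrite sub0r normrN gtr0_norm.
Qed.

Lemma cvg_pinfty_shift (f : R -> R) (s l : R) : f t @[t --> +oo] --> l ->
  f (t + s) @[t --> +oo] --> l.
Proof.
move=> fl; apply/cvgrPdist_lt => e e0.
have [a [_ ha]] := (cvgrPdist_lt _ _).1 fl e e0.
exists (a - s); split; first exact: num_real.
by move=> t ht; apply: ha; rewrite -ltrBlDr.
Qed.

End Near.

Section Semigroup.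
Context {R : realType} {E : completeNormedModType R[i]} (A : operator E E)
  (T : R -> E -> E).
Context (gT : generates A T).

Lemma sg_c0 : c0_semigroup T. Proof. by case: gT. Qed.
Lemma sg_bounded t : 0 <= t -> bounded_operator (T t). Proof. by case: sg_c0 => h *; exact: h. Qed.
Lemma sg_lin t : 0 <= t -> linear (T t). Proof. by move=> /sg_bounded[]. Qed.
Lemma sg0 x : T 0 x = x. Proof. by case: sg_c0. Qed.
Lemma sgD s t x : 0 <= s -> 0 <= t -> T (s + t) x = T s (T t x).
Proof. by case: sg_c0 => _ _ h _; exact: h. Qed.
Lemma sgC s t x : 0 <= s -> 0 <= t -> T s (T t x) = T t (T s x).
Proof. by move=> s0 t0; rewrite -!sgD // addrC. Qed.
Lemma sg_cvg x : T t x @[t --> 0^'+] --> x. Proof. by case: sg_c0. Qed.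

Definition diff_quot x (h : R) := (h%:C)^-1 *: (T h x - x).

Lemma diff_quot_cvg x : dom A x -> diff_quot x h @[h --> 0^'+] --> A x.
Proof. by move=> Dx; have [_ dE aE] := gT; rewrite aE //; move: Dx; rewrite dE. Qed.

Lemma cvg_diff_quot x y : diff_quot x h @[h --> 0^'+] --> y -> dom A x /\ A x = y.
Proof.
move=> h; have [_ dE aE] := gT.
have Dx : dom A x by rewrite dE /=; apply/cvg_ex; exists y.
by split=> //; rewrite aE //=; apply/cvg_lim => //; exact: norm_hausdorff.
Qed.

(** The semigroup commutes with its difference quotients. *)
Lemma sg_dom t x : 0 <= t -> dom A x -> dom A (T t x) /\ A (T t x) = T t (A x).
Proof.
move=> t0 Dx; apply: cvg_diff_quot.
have c : T t (diff_quot x h) @[h --> 0^'+] --> T t (A x).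
  exact: bounded_cvg (sg_bounded t0) (diff_quot_cvg Dx).
apply: (cvg_near_eq _ c).
exists 1 => //= h _ h0; rewrite /diff_quot.
rewrite (linP_Z (sg_lin t0)) (linP_B (sg_lin t0)) sgC //; exact: ltW.
Qed.

Lemma sg_res t l y : 0 <= t -> rho A l -> T t (resolvent A l y) = resolvent A l (T t y).
Proof.
move=> t0 rl; have [D1 e1] := sg_dom t0 (res_dom rl y).
rewrite -[LHS](res_left rl D1) e1 res_app // (linP_B (sg_lin t0)) (linP_Z (sg_lin t0)).
by congr resolvent; lmod.
Qed.

(** With [c = 1 / (1 + i w h)], the vector [x - c^N T(N h) x] is a telescoping sum
    of [N] terms, each at most [M h |i w x - A x|] up to a small error. For
    [N h = t] the subtracted vector has norm at most half that of [x]. *)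
Lemma axis_lower (M t : R) : 1 <= M -> 0 < t ->
  (forall s x, 0 <= s -> nrm (T s x) <= M * nrm x) ->
  (forall x, nrm (T t x) <= 2^-1 * nrm x) ->
  forall w x, dom A x -> nrm x <= 2 * M * t * nrm (imag w *: x - A x).
Proof.
move=> M1 t0 hM ht w x Dx; have M0 : 0 < M by rewrite (lt_le_trans _ M1).
set b := nrm (imag w *: x - A x).
have Mt : 0 < M * t by rewrite mulr_gt0.
apply/ler_addgt0Pr => e e0.
have e1 : 0 < e / (2 * M * t) by rewrite divr_gt0 // !mulr_gt0.
have [d d0 hd] := near_right0 (cvg_nrm_lt (diff_quot_cvg Dx) e1).
have [N _ hN] := near_infty_natSinv_lt (PosNum (divr_gt0 d0 t0)).
have {hN} := hN N (leqnn _) => /= hN; have n0 : (0 : R) < N.+1%:R by rewrite ltr0n.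
pose h := t / N.+1%:R; have h0 : 0 < h by rewrite divr_gt0.
have hd' : h < d by rewrite /h mulrC -ltr_pdivlMr.
have := hd h; rewrite h0 hd' => /(_ isT) hq.
pose c : R[i] := (1 + h%:C * imag w)^-1.
have cn : 1 <= cabs (1 + h%:C * imag w).
  rewrite -(@ler_pXn2r _ 2) ?nnegrE // expr1n sqr_cabs /=.
  by rewrite !mul0r !mulr0 ?subr0 ?addr0 ?add0r expr1n lerDl sqr_ge0.
have cn0 : 1 + h%:C * imag w != 0 by rewrite -cabs_eq0 gt_eqF // (lt_le_trans _ cn).
have c1 : cabs c <= 1 by rewrite cabsV invf_le1 // (lt_le_trans _ cn).
have cj j : cabs (c ^+ j) <= 1.
  elim: j => [|j IH]; first by rewrite expr0 (cabs_real 1) normr1.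
  by rewrite exprS cabsM mulr_ile1.
pose dd := x - c *: T h x.
have hdd : nrm dd <= h * (b + e / (2 * M * t)).
  have -> : dd = c *: (h%:C *: (imag w *: x - diff_quot x h)).
    have hC : h%:C != 0 :> R[i] by rewrite -cabs_eq0 cabs_real gt_eqF // gtr0_norm.
    have cE : c * (1 + h%:C * imag w) = 1 by rewrite mulVf.
    have eT : T h x = x + h%:C *: diff_quot x h.
      by rewrite /diff_quot scalerA divff // scale1r; lmod.
    rewrite /dd eT; move: (diff_quot x h) => q.
    have ex : x = (c * (1 + h%:C * imag w)) *: x by rewrite cE scale1r.
    by rewrite {1}ex; lmod.
  rewrite nrmZ; apply: (@le_trans _ _ (1 * nrm (h%:C *: (imag w *: x - diff_quot x h)))).
    exact: ler_wpM2r.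
  rewrite mul1r nrmZ cabs_real gtr0_norm // ler_pM2l //.
  apply: le_trans (ler_nrm_dist _ (A x) _) _; rewrite lerD2l nrmBC; exact: ltW.
have key j : nrm (x - c ^+ j *: T (j%:R * h) x) <= j%:R * (M * (h * (b + e / (2 * M * t)))).
  elim: j => [|j IH].
    by rewrite mul0r sg0 expr0 scale1r subrr nrm0 mul0r.
  have jh : 0 <= j%:R * h by rewrite mulr_ge0 // ltW.
  have -> : x - c ^+ j.+1 *: T (j.+1%:R * h) x =
     (x - c ^+ j *: T (j%:R * h) x) + c ^+ j *: T (j%:R * h) dd.
    rewrite /dd (linP_B (sg_lin jh)) (linP_Z (sg_lin jh)) -sgD // ?ltW //.
    by rewrite -natr1 mulrDl mul1r exprSr; lmod.
  apply: le_trans (ler_nrmD _ _) _; rewrite -natr1 mulrDl mul1r; apply: lerD => //.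
  rewrite nrmZ; apply: (@le_trans _ _ (1 * nrm (T (j%:R * h) dd))).
    exact: ler_wpM2r.
  rewrite mul1r; apply: le_trans (hM _ _ jh) _; apply: ler_wpM2l => //; exact: ltW.
have := key N.+1; have -> : N.+1%:R * h = t by rewrite /h mulrCA divff ?mulr1 // gt_eqF.
move=> k1; have k2 : N.+1%:R * (M * (h * (b + e / (2 * M * t)))) = M * t * b + e / 2.
  rewrite /h; field; rewrite !gt_eqF //; lra.
rewrite k2 in k1.
have k3 : nrm (c ^+ N.+1 *: T t x) <= 2^-1 * nrm x.
  rewrite nrmZ; apply: le_trans (ht x); rewrite ler_piMl //.
have := ler_nrmD (x - c ^+ N.+1 *: T t x) (c ^+ N.+1 *: T t x); rewrite subrK.
by move: k1 k3; rewrite -/b; lra.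
Qed.

End Semigroup.

(** * Strong stability of contraction semigroups *)
Section StrongStability.
Context {R : realType} {E : completeNormedModType R[i]} (hf : hform E)
  (A : operator E E) (T : R -> E -> E) (gT : generates A T).
Local Notation rp := (rp hf).
Context (cT : forall t x, 0 <= t -> rp (T t x) (T t x) <= rp x x).

Lemma contr_nrm t x : 0 <= t -> nrm (T t x) <= 2 * nrm x.
Proof.
move=> t0; rewrite -(@ler_pXn2r _ 2) ?nnegrE ?mulr_ge0 //.
apply: le_trans (rp_lb hf _) _; apply: le_trans (cT x t0) _.
apply: le_trans (rp_ub hf _) _; rewrite exprMn ler_wpM2r ?exprn_ge0 //.
by rewrite expr2; lra.
Qed.

Lemma contr_dissipative : dissipative hf A.
Proof.
move=> x Dx; have c : rp (diff_quot T x h) x @[h --> 0^'+] --> rp (A x) x.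
  exact: rp_cvgl (diff_quot_cvg gT Dx).
have c0 : (fun=> (0 : R)) h @[h --> (0^'+ : set_system R)] --> (0 : R) by exact: cvg_cst.
apply: (ler_cvg_to c c0); exists 1 => //= h _ h0.
rewrite /diff_quot -fmorphV rpZl pmulr_rle0 ?invr_gt0 // rpBl subr_le0.
have := rp_ge0 hf (T h x - x); have := cT x (ltW h0).
by rewrite !rpE (rpC _ x (T h x)); lra.
Qed.

(** The squared norms along an orbit decrease; polarization does the rest. *)
Lemma Q_exists x y : exists q : R, rp (T t x) (T t y) @[t --> +oo] --> q.
Proof.
have N z : exists q : R, rp (T t z) (T t z) @[t --> +oo] --> q.
  pose B := [set rp (T t z) (T t z) | t in [set t : R | 0 <= t]].
  have hB : has_inf B.
    split; first by exists (rp (T 0 z) (T 0 z)), 0 => //=.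
    by exists 0 => _ [t _ <-]; exact: rp_ge0.
  exists (inf B); apply/cvgrPdist_lt => e e0.
  have [_ [s /= s0 <-] hs] := inf_adherent e0 hB.
  exists s; split; first exact: num_real.
  move=> t st; have t0 : 0 <= t by rewrite (le_trans s0) // ltW.
  have h1 : inf B <= rp (T t z) (T t z) by apply: inf_lbound; [case: hB|exists t].
  have h2 : rp (T t z) (T t z) <= rp (T s z) (T s z).
    have -> : t = (t - s) + s by rewrite subrK.
    have ts : 0 <= t - s by rewrite subr_ge0 ltW.
    by rewrite (sgD gT) //; exact: cT.
  by rewrite distrC ger0_norm ?subr_ge0 // ltrBlDl (le_lt_trans h2).
have [p hp] := N (x + y); have [q hq] := N (x - y).
exists (4^-1 * (p - q)).
have c : 4^-1 * (rp (T t (x + y)) (T t (x + y)) - rp (T t (x - y)) (T t (x - y)))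
    @[t --> +oo] --> 4^-1 * (p - q).
  by apply: cvgM; [exact: cvg_cst|apply: cvgB].
apply: (cvg_near_eq _ c); exists 0; split; first exact: num_real.
move=> t t0; have t0' := ltW t0.
rewrite (linP_D (sg_lin gT t0')) (linP_B (sg_lin gT t0')) !rpE (rpC _ (T t y) (T t x)).
by field.
Qed.

Definition Q x y : R := xget 0 [set q : R | rp (T t x) (T t y) @[t --> +oo] --> q].

Lemma Q_cvg x y : rp (T t x) (T t y) @[t --> +oo] --> Q x y.
Proof. exact: (@xgetPex _ 0 [set q : R | rp (T t x) (T t y) @[t --> +oo] --> q] (Q_exists x y)). Qed.

Lemma Q_eq x y q : rp (T t x) (T t y) @[t --> +oo] --> q -> Q x y = q.
Proof. by move=> h; apply: (cvg_unique _ _ h); first exact: norm_hausdorff; exact: Q_cvg. Qed.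

Lemma near_pos : \forall t \near +oo, (0 : R) <= t.
Proof. by exists 0; split; [exact: num_real|move=> t /ltW]. Qed.

Lemma Q_sym x y : Q x y = Q y x.
Proof.
apply: Q_eq; have c := @Q_cvg y x; apply: (cvg_near_eq _ c).
by apply: nearW => t; rewrite rpC.
Qed.

Lemma Q_lin (a : R) x y z : Q (a%:C *: x + y) z = a * Q x z + Q y z.
Proof.
apply: Q_eq; have c : a * rp (T t x) (T t z) + rp (T t y) (T t z) @[t --> +oo]
   --> a * Q x z + Q y z.
  by apply: cvgD (@Q_cvg _ _); apply: cvgM (@Q_cvg _ _); exact: cvg_cst.
apply: (cvg_near_eq _ c); apply: filterS near_pos => t t0.
by rewrite (sg_lin gT t0) rpDl rpZl.
Qed.

Lemma Q_Dl x y z : Q (x + y) z = Q x z + Q y z.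
Proof. by have := Q_lin 1 x y z; rewrite scale1r mul1r. Qed.
Lemma Q_0l z : Q 0 z = 0.
Proof. by apply: (addrI (Q 0 z)); rewrite -Q_Dl !addr0. Qed.
Lemma Q_Zl (a : R) x z : Q (a%:C *: x) z = a * Q x z.
Proof. by have := Q_lin a x 0 z; rewrite Q_0l !addr0. Qed.
Lemma Q_Nl x z : Q (- x) z = - Q x z.
Proof. by apply/eqP; rewrite -addr_eq0 -Q_Dl addNr Q_0l. Qed.
Lemma Q_Dr x y z : Q x (y + z) = Q x y + Q x z.
Proof. by rewrite !(Q_sym x) Q_Dl. Qed.
Lemma Q_Nr x z : Q x (- z) = - Q x z.
Proof. by rewrite !(Q_sym x) Q_Nl. Qed.
Lemma Q_Zr (a : R) x z : Q x (a%:C *: z) = a * Q x z.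
Proof. by rewrite !(Q_sym x) Q_Zl. Qed.

Lemma Q_ge0 x : 0 <= Q x x.
Proof.
have c0 : (fun=> (0 : R)) h @[h --> (+oo : set_system R)] --> (0 : R) by exact: cvg_cst.
by apply: (ler_cvg_to c0 (@Q_cvg x x)); apply: nearW => t; exact: rp_ge0.
Qed.

Lemma Q_sub x y : Q (x - y) (x - y) <= 2 * (Q x x + Q y y).
Proof.
by have := Q_ge0 (x + y); rewrite !Q_Dl !Q_Dr !Q_Nl !Q_Nr (Q_sym y x); lra.
Qed.

Lemma Q_bound x y : `|Q x y| <= 2 * nrm x * nrm y.
Proof.
have c0 : (fun=> 2 * nrm x * nrm y) h @[h --> (+oo : set_system R)] --> 2 * nrm x * nrm y
  by exact: cvg_cst.
have c1 : `|rp (T t x) (T t y)| @[t --> +oo] --> `|Q x y| by apply: cvg_norm; exact: Q_cvg.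
apply: (ler_cvg_to c1 c0); apply: filterS near_pos => t t0.
rewrite -(@ler_pXn2r _ 2) ?nnegrE ?mulr_ge0 // real_normK ?num_real //.
apply: le_trans (rp_CS _ _ _) _.
apply: le_trans (ler_pM (rp_ge0 _ _) (rp_ge0 _ _) (cT x t0) (cT y t0)) _.
apply: le_trans (ler_pM (rp_ge0 _ _) (rp_ge0 _ _) (rp_ub _ x) (rp_ub _ y)) _.
by rewrite le_eqVlt; apply/orP; left; apply/eqP; ring.
Qed.

Lemma Q_T s x y : 0 <= s -> Q (T s x) (T s y) = Q x y.
Proof.
move=> s0; apply: Q_eq; have c := cvg_pinfty_shift s (@Q_cvg x y).
apply: (cvg_near_eq _ c); apply: filterS near_pos => t t0.
by rewrite !(sgD gT).
Qed.

(** The semigroup preserves [Q]; differentiate at 0. *)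
Lemma Q_skew x y : dom A x -> dom A y -> Q (A x) y + Q x (A y) = 0.
Proof.
move=> Dx Dy; apply/eqP; rewrite -normr_le0; apply/ler_addgt0Pr => e e0; rewrite add0r.
pose g h := (4 * nrm y) * nrm (diff_quot T x h - A x) + 
  ((2 * nrm (A x)) * nrm (T h y - y) + (2 * nrm x) * nrm (diff_quot T y h - A y)).
have cg : g h @[h --> 0^'+] --> (0 : R).
  apply: cvg_add0; first by apply: cvg_mul0; apply/cvg_nrm0P; exact: diff_quot_cvg.
  apply: cvg_add0; apply: cvg_mul0; apply/cvg_nrm0P; first exact: sg_cvg gT y.
  exact: diff_quot_cvg.
have [d d0 hd] := near_right0 ((cvgrPdist_lt _ _).1 cg e e0).
have h2 : 0 < d / 2 < d by rewrite divr_gt0 //= ltr_pdivrMr // ltr_pMr // ltr1n.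
have := hd _ h2; set h := d / 2; rewrite sub0r normrN => /(le_lt_trans (ler_norm _)) hg.
have h0 : 0 < h by case/andP: h2.
have eq : Q (diff_quot T x h) (T h y) + Q x (diff_quot T y h) = 0.
  rewrite /diff_quot -fmorphV Q_Zl Q_Zr -mulrDr Q_Dl Q_Dr Q_Nl Q_Nr (Q_T _ _ (ltW h0)).
  by rewrite [X in _ * X](_ : _ = 0) ?mulr0 //; ring.
have -> : Q (A x) y + Q x (A y) = - (Q (diff_quot T x h - A x) (T h y) +
    (Q (A x) (T h y - y) + Q x (diff_quot T y h - A y))).
  by rewrite !Q_Dl !Q_Dr !Q_Nl !Q_Nr; move: eq; lra.
rewrite normrN; apply: le_trans (ltW hg).
apply: le_trans (ler_normD _ _) _; apply: lerD.
  apply: le_trans (Q_bound _ _) _.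
  have := ler_wpM2l (_ : 0 <= 2 * nrm (diff_quot T x h - A x)) (contr_nrm y (ltW h0)).
  by rewrite mulr_ge0 // => /(_ isT); lra.
apply: le_trans (ler_normD _ _) _; apply: lerD; exact: Q_bound.
Qed.

(** An operator that commutes with the semigroup acts on whole orbits, so its
    bound survives in the limit. *)
Lemma Q_commute (B : E -> E) (k : R) x : 0 <= k -> (forall x, nrm (B x) <= k * nrm x) ->
  (forall t x, 0 <= t -> T t (B x) = B (T t x)) -> Q (B x) (B x) <= 2 * k ^+ 2 * Q x x.
Proof.
move=> k0 hB cB.
have c : (2 * k ^+ 2) * rp (T t x) (T t x) @[t --> +oo] --> 2 * k ^+ 2 * Q x x.
  by apply: cvgM (@Q_cvg _ _); exact: cvg_cst.
apply: (ler_cvg_to (@Q_cvg _ _) c); apply: filterS near_pos => t t0.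
rewrite cB //; apply: le_trans (rp_ub _ _) _; rewrite -mulrA ler_pM2l //.
apply: (@le_trans _ _ ((k * nrm (T t x)) ^+ 2)).
  by rewrite ler_pXn2r ?nnegrE ?mulr_ge0.
by rewrite exprMn ler_wpM2l ?exprn_ge0 // rp_lb.
Qed.

Context (axis : forall w : R, rho A (imag w)).

Lemma res_Q w : exists2 k, 0 < k &
  forall x, Q (resolvent A (imag w) x) (resolvent A (imag w) x) <= k * Q x x.
Proof.
have [_ [k k1 hk]] := bounded_pos (res_bounded (axis w)).
have k0 : 0 < k by rewrite (lt_le_trans _ k1).
exists (2 * k ^+ 2); first by rewrite mulr_gt0 // exprn_gt0.
move=> x; apply: Q_commute => //; first exact: ltW.
by move=> t y t0; exact: (sg_res gT y t0 (axis w)).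
Qed.

Local Notation K := (resolvent A (imag 0)).
Let r0 : rho A (imag 0) := axis 0.
Let lK : linear K := res_lin r0.

Lemma A_resolvent0 x : A (K x) = - x.
Proof.
rewrite res_app //; have -> : imag 0 = 0 :> R[i] by apply/eqP; rewrite eq_complex /= !eqxx.
by rewrite scale0r sub0r.
Qed.

(** Here [K] is minus the inverse of [A], which is skew for [Q]. *)
Lemma QKK x : Q (K (K x)) x = - Q (K x) (K x).
Proof.
have := Q_skew (res_dom r0 (K x)) (res_dom r0 x).
by rewrite !A_resolvent0 Q_Nl Q_Nr; lra.
Qed.

(** Since [k = w^-2], one has [w^2 (K^2 + k) = (w^2 + A^2) K^2], and
    [w^2 + A^2] is the product of [i w - A] and [- i w - A]. *)
Lemma resolvent_K2 (w k : R) x : w ^+ 2 * k = 1 ->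
  K (K x) = resolvent A (imag (- w)) (resolvent A (imag w)
     ((w ^+ 2)%:C *: (K (K x) + k%:C *: x))).
Proof.
move=> wk; set v := K (K x).
have lA := rho_lin r0.
have Dv : dom A v by exact: res_dom.
have DKx : dom A (K x) by exact: res_dom.
pose u := imag (- w) *: v - A v.
have Du : dom A u.
  have [D1 _] := lin_opZ lA (imag (- w)) Dv.
  by rewrite /u A_resolvent0; apply: (lin_opB lA D1 _).1; rewrite -scaleN1r; case: (lin_opZ lA (-1) DKx).
have eu : u = imag (- w) *: v + K x by rewrite /u A_resolvent0 opprK.
rewrite -[LHS](res_left (axis (- w)) Dv) -/u; congr resolvent.
rewrite -[LHS](res_left (axis w) Du); congr resolvent.
have [D1 e1] := lin_opZ lA (imag (- w)) Dv.
have [_ ->] : dom A u /\ A u = imag (- w) *: (- K x) + - x.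
  by rewrite eu; have [D2 ->] := lin_opD lA D1 DKx; rewrite e1 !A_resolvent0.
rewrite eu.
have i2 : imag w * imag (- w) = (w ^+ 2)%:C :> R[i].
  by apply/eqP; rewrite eq_complex /=; apply/andP; split; apply/eqP; ring.
have iN : imag (- w) = - imag w :> R[i].
  by apply/eqP; rewrite eq_complex /= oppr0 !eqxx.
have kk : (w ^+ 2)%:C * k%:C = 1 :> R[i] by rewrite -rmorphM /= wk.
have -> : (w ^+ 2)%:C *: (v + k%:C *: x) = (w ^+ 2)%:C *: v + x.
  by rewrite scalerDr scalerA kk scale1r.
by rewrite -i2 iN; lmod.
Qed.

(** Let [kap] be the squared [Q]-norm of [K]. Skewness gives
    [Q g g <= kap (kap - Q (K y) (K y))] for [g = K^2 y + kap y] and [Q y y <= 1], which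
    is small when [y] almost attains the norm, while [resolvent_K2] bounds [Q (K y) (K y)] by a
    multiple of [Q g g]. *)
Lemma Q_resolvent0 x : Q (K x) (K x) = 0.
Proof.
have [k0 k0p hk0] := res_Q 0.
pose B := [set Q (K x) (K x) | x in [set x | Q x x <= 1]].
have hB : has_sup B.
  split; first by exists (Q (K 0) (K 0)), 0 => //=; rewrite Q_0l.
  exists k0 => _ [y /= y1 <-]; apply: le_trans (hk0 y) _.
  by rewrite ger_pMr.
pose kap := sup B.
have kap_ub y : Q y y <= 1 -> Q (K y) (K y) <= kap.
  by move=> y1; apply: sup_ubound; [case: hB|exists y].
have kap0 : 0 <= kap.
  apply: le_trans (kap_ub 0 _); first exact: Q_ge0.
  by rewrite Q_0l.
have hom y : Q (K y) (K y) <= kap * Q y y.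
  have [y0|y0] := eqVneq (Q y y) 0.
    by have := hk0 y; rewrite y0 !mulr0.
  have yp : 0 < Q y y by rewrite lt_neqAle eq_sym y0 Q_ge0.
  pose s := Num.sqrt (Q y y); have s0 : 0 < s by rewrite sqrtr_gt0.
  have ss : s * s = Q y y by rewrite -expr2 sqr_sqrtr // ltW.
  have := kap_ub ((s^-1)%:C *: y); rewrite (linP_Z lK) !Q_Zl !Q_Zr.
  have -> : s^-1 * (s^-1 * Q y y) = 1 by rewrite -ss; field; rewrite gt_eqF.
  move=> /(_ (lexx _)); rewrite -ss.
  have -> : s^-1 * (s^-1 * Q (K y) (K y)) = Q (K y) (K y) / (s * s) by field; rewrite gt_eqF.
  by rewrite ler_pdivrMr // mulr_gt0.
suff kap_le0 : kap <= 0.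
  apply/eqP; rewrite eq_le Q_ge0 andbT; apply: le_trans (hom x) _.
  by rewrite mulr_le0_ge0 ?Q_ge0.
rewrite leNgt; apply/negP => kp.
pose w := (Num.sqrt kap)^-1; have w0 : 0 < w by rewrite invr_gt0 sqrtr_gt0.
have wk : w ^+ 2 * kap = 1.
  by rewrite /w exprVn sqr_sqrtr ?ltW // mulVf // gt_eqF.
have [k1 k1p hk1] := res_Q w; have [k2 k2p hk2] := res_Q (- w).
pose C := k2 * (k1 * (w ^+ 2 * w ^+ 2)).
have Cp : 0 < C by rewrite !mulr_gt0 // exprn_gt0.
pose C2 := k0 * ((w ^+ 2 * w ^+ 2) * (2 * (1 + C))).
have C2p : 0 < C2 by rewrite !mulr_gt0 ?exprn_gt0 // addr_gt0.
have key y : Q (K y) (K y) <= C2 * Q (K (K y) + kap%:C *: y) (K (K y) + kap%:C *: y).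
  set g := K (K y) + kap%:C *: y; set v := K (K y).
  have hv : Q v v <= C * Q g g.
    rewrite /v (resolvent_K2 y wk) -/g; apply: le_trans (hk2 _) _.
    rewrite /C -mulrA ler_pM2l //; apply: le_trans (hk1 _) _.
    by rewrite Q_Zl Q_Zr -mulrA ler_pM2l // mulrA.
  have hy : Q y y <= (w ^+ 2 * w ^+ 2) * (2 * (1 + C)) * Q g g.
    have -> : y = (w ^+ 2)%:C *: (g - v).
      have e : (w ^+ 2)%:C * kap%:C = 1 :> R[i] by rewrite -rmorphM /= wk.
      have -> : g - v = kap%:C *: y by rewrite /g /v; lmod.
      by rewrite scalerA e scale1r.
    rewrite Q_Zl Q_Zr mulrA -[X in _ <= X]mulrA.
    apply: ler_wpM2l; first by rewrite mulr_ge0 // exprn_ge0 // ltW.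
    by have := Q_sub g v; move: hv; lra.
  apply: le_trans (hk0 y) _; rewrite /C2 -mulrA ler_pM2l //.
pose e := kap / (2 * (C2 * kap + 1)).
have den : 0 < 2 * (C2 * kap + 1) by rewrite mulr_gt0 // addr_gt0 // mulr_gt0.
have e0 : 0 < e by rewrite divr_gt0.
have [_ [y /= y1 <-] hy] := sup_adherent e0 hB; rewrite -/kap in hy.
have hg : Q (K (K y) + kap%:C *: y) (K (K y) + kap%:C *: y) <= kap * e.
  rewrite !Q_Dl !Q_Dr !Q_Zl !Q_Zr (Q_sym y) QKK.
  have h1 := hom (K y); have h2 : kap * (kap * Q y y) <= kap * kap.
    by rewrite ler_pM2l // -[X in _ <= X]mulr1 ler_pM2l.
  have h3 : kap * (kap - e) <= kap * Q (K y) (K y) by rewrite ler_pM2l // ltW.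
  by move: h1 h2 h3; lra.
have h4 := le_trans (key y) (ler_wpM2l (ltW C2p) hg).
have h5 : kap < e * (C2 * kap + 1) by move: hy h4; lra.
have h6 : e * (C2 * kap + 1) = kap / 2.
  by rewrite /e; field; rewrite gt_eqF // addr_gt0 // mulr_gt0.
by move: h5; rewrite h6; lra.
Qed.

Context (l1 : R) (l10 : 0 < l1) (rl1 : rho A l1%:C).

Lemma strong_stability x : T t x @[t --> +oo] --> 0.
Proof.
apply/cvg_nrmP => e e0.
have e4 : 0 < e / 4 by rewrite divr_gt0.
have [v Dv hv] := dissipative_dense l10 rl1 contr_dissipative x e4.
have Qv : Q v v = 0.
  by rewrite -(res_left r0 Dv) Q_resolvent0.
have c := @Q_cvg v v; rewrite Qv in c.
have e2 : 0 < (e / 2) ^+ 2 by rewrite exprn_gt0 // divr_gt0.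
have [a [_ ha]] : \forall t \near +oo, `|0 - rp (T t v) (T t v)| < (e / 2) ^+ 2.
  exact: ((cvgrPdist_lt _ _).1 c _ e2).
exists (Num.max a 0); split; first exact: num_real.
move=> t; rewrite gt_max => /andP[at_ t0]; rewrite subr0.
have := ha t at_; rewrite sub0r normrN ger0_norm ?rp_ge0 // => h1.
have h2 : nrm (T t v) < e / 2.
  rewrite -(@ltr_pXn2r _ 2) ?nnegrE ?divr_ge0 // ?(ltW e0) //.
  exact: le_lt_trans (rp_lb hf _) h1.
have -> : T t x = T t (x - v) + T t v by rewrite (linP_B (sg_lin gT (ltW t0))); lmod.
have h3 := contr_nrm (x - v) (ltW t0); rewrite nrmBC in h3.
apply: le_lt_trans (ler_nrmD _ _) _.
by move: hv h2 h3; lra.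
Qed.

End StrongStability.

(** * The discrete Fourier transform *)
Section RootsOfUnity.
Context {R : realType}.

Definition cis (t : R) : R[i] := Complex (cos t) (sin t).

Lemma cisD s t : cis (s + t) = cis s * cis t.
Proof. by apply/eqP; rewrite eq_complex /= cosD sinD; apply/andP; split; apply/eqP; ring. Qed.

Lemma cis0 : cis 0 = 1.
Proof. by rewrite /cis cos0 sin0. Qed.

Lemma cisX t n : cis t ^+ n = cis (n%:R * t).
Proof.
elim: n => [|n IH]; first by rewrite expr0 mul0r cis0.
by rewrite exprS IH -cisD -natr1 mulrDl mul1r addrC.
Qed.

Lemma cisJ t : conjc (cis t) = cis (- t).
Proof. by rewrite /cis /= cosN sinN. Qed.

Lemma cabs_cis t : cabs (cis t) = 1.
Proof.
have : cabs (cis t) ^+ 2 == 1 by rewrite sqr_cabs /= cos2Dsin2.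
by rewrite pexprn_eq1 //= => /eqP.
Qed.

(** The half angle has a positive sine. *)
Lemma cis_neq1 t : 0 < t < 2 * pi -> cis t != 1.
Proof.
move=> /andP[t0 tp]; rewrite eq_complex /= negb_and; apply/orP; left.
have -> : t = (t / 2) *+ 2 by rewrite mulr2n; field.
rewrite cos_mulr2n; have s0 : 0 < sin (t / 2).
  by apply: sin_gt0_pi; rewrite divr_gt0 //= ltr_pdivrMr // mulrC.
have := cos2Dsin2 (t / 2) => cs.
apply/eqP => h; have : sin (t / 2) ^+ 2 = 0 by move: h cs; rewrite mulr2n; lra.
by move/eqP; rewrite expf_eq0 /= gt_eqF.
Qed.

Lemma geom_cis (N j l : nat) : (j < N)%N -> (l < N)%N ->
  \sum_(k < N) cis (k%:R * ((j%:R - l%:R) * (2 * pi / N%:R))) = (N * (j == l))%:R.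
Proof.
move=> jN lN; have N0 : (0 : R) < N%:R by rewrite ltr0n (leq_ltn_trans _ jN).
have [->|jl] := eqVneq j l.
  rewrite muln1 subrr mul0r; under eq_bigr do rewrite mulr0 cis0.
  by rewrite sumr_const card_ord.
rewrite muln0; set t := _ * (2 * pi / _); under eq_bigr do rewrite -cisX.
have tn : cis t != 1.
  have key (a b : nat) : (a < b)%N -> (b < N)%N ->
      cis ((b%:R - a%:R) * (2 * pi / N%:R)) != 1.
    move=> ab bN; apply: cis_neq1.
    have ba : (0 : R) < b%:R - a%:R by rewrite subr_gt0 ltr_nat.
    rewrite mulr_gt0 ?divr_gt0 ?mulr_gt0 ?pi_gt0 //=.
    rewrite mulrA ltr_pdivrMr // [X in _ < X]mulrC ltr_pM2r ?mulr_gt0 ?pi_gt0 //.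
    have : (b%:R : R) < N%:R by rewrite ltr_nat.
    by have : (0 : R) <= a%:R by []; lra.
  case: (ltngtP j l) jl => // h _; last exact: key.
  have := key j l h lN; rewrite /t; apply: contra => /eqP e.
  have -> : (l%:R - j%:R : R) * (2 * pi / N%:R) = - ((j%:R - l%:R) * (2 * pi / N%:R)) by ring.
  by rewrite -cisJ e conjc1.
have := subrX1 (cis t) N; rewrite cisX.
have -> : N%:R * t = (j%:R - l%:R) * (2 * pi) :> R by rewrite /t; field; rewrite gt_eqF.
have p2 (n : nat) : cis (n%:R * (2 * pi) : R) = 1.
  rewrite -cisX /cis mulr_natl cos2pi sin2pi.
  by rewrite (_ : Complex 1 0 = 1) ?expr1n.
have -> : cis ((j%:R - l%:R) * (2 * pi) : R) = 1.
  by rewrite mulrBl cisD p2 mul1r -cisJ p2 conjc1.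
rewrite subrr => /esym/eqP; rewrite mulf_eq0 subr_eq0 (negbTE tn) /= => /eqP //.
Qed.

End RootsOfUnity.

Section PowerDecay.
Context {R : realType} {E : normedModType R[i]} (hf : hform E).
Local Notation rp := (rp hf).

Lemma Re_sum n (f : 'I_n -> R[i]) : complex.Re (\sum_i f i) = \sum_i complex.Re (f i).
Proof. by apply: (big_morph (@complex.Re R)) => // -[a b] [c d]. Qed.

Lemma parseval (N : nat) (v : nat -> E) :
  let th k := k%:R * (2 * pi / N%:R) : R in
  let y k := \sum_(j < N) cis (j%:R * th k) *: v j in
  \sum_(k < N) rp (y k) (y k) = N%:R * \sum_(j < N) rp (v j) (v j).
Proof.
move=> th y.
have e : \sum_(k < N) hf (y k) (y k) = N%:R * \sum_(j < N) hf (v j) (v j).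
  have -> : \sum_(k < N) hf (y k) (y k) = \sum_(k < N) \sum_(j < N) \sum_(l < N)
     cis (k%:R * ((j%:R - l%:R) * (2 * pi / N%:R))) * hf (v j) (v l).
    apply: eq_bigr => k _; rewrite ip_suml; apply: eq_bigr => j _.
    rewrite ip_sumr; apply: eq_bigr => l _; rewrite ipZl ipZr cisJ [LHS]mulrA -cisD.
    by congr (cis _ * _); rewrite /th; ring.
  rewrite exchange_big mulr_sumr; apply: eq_bigr => j _.
  rewrite exchange_big (bigD1 j) //= [X in _ + X]big1 ?addr0 => [|l lj].
    by rewrite -mulr_suml geom_cis // eqxx muln1.
  rewrite -mulr_suml geom_cis // (_ : (_ == _ :> nat) = false) ?muln0 ?mul0r //.
  by apply/negbTE; rewrite eq_sym.
have := congr1 (@complex.Re R) e; rewrite Re_sum => ->.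
have -> : (N%:R : R[i]) = (N%:R : R)%:C by rewrite rmorph_nat.
have -> : complex.Re ((N%:R : R)%:C * \sum_(j < N) hf (v j) (v j)) =
   N%:R * complex.Re (\sum_(j < N) hf (v j) (v j)).
  by case: (\sum_(j < N) hf (v j) (v j)) => a b /=; rewrite mul0r subr0.
by rewrite Re_sum.
Qed.

Context (J : E -> E) (lJ : linear J) (cJ : forall x, rp (J x) (J x) <= rp x x).
Context (d : R) (d0 : 0 < d).
Context (lowJ : forall z y, cabs z = 1 ->
  d * rp y y <= rp (z *: y - J y) (z *: y - J y)).

Lemma iterJ_le j k x : (j <= k)%N ->
  rp (iter k J x) (iter k J x) <= rp (iter j J x) (iter j J x).
Proof.
move=> jk; rewrite -(subnK jk) iterD; elim: (k - j)%N => [|m IH] //=.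
exact: le_trans (cJ _) IH.
Qed.

(** Rises with slope 1, stays at [n] for a third of the time, and falls with slope
    -1: it vanishes at 0 and at [3 n]. *)
Definition trapezoid (n j : nat) : R := (minn (minn j n) (3 * n - j))%:R.

Lemma trapezoid_step n j : (trapezoid n j.+1 - trapezoid n j) ^+ 2 <= 1.
Proof.
have key (a b : nat) : (a <= b.+1)%N -> (b <= a.+1)%N -> (a%:R - b%:R : R) ^+ 2 <= 1.
  move=> h1 h2; rewrite -(ler_nat R) -natr1 in h1; rewrite -(ler_nat R) -natr1 in h2.
  by nra.
by apply: key; lia.
Qed.

(** For a root of unity [z], apply the lower bound to the sum of the
    [z^-j phi_j J^j x], with [phi] the trapezoid. Summation by parts replaces
    [phi] by its increments, as the boundary terms vanish. Summing over the roots
    with Parseval's identity compares [n] weights of size [n] with [3 n] increments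
    of size at most 1. *)
Lemma power_decay n x : (0 < n)%N ->
  d * n%:R ^+ 2 * rp (iter (3 * n) J x) (iter (3 * n) J x) <= 3 * rp x x.
Proof.
move=> n0; set N := (3 * n)%N; have N0 : (0 < N)%N by rewrite muln_gt0.
pose a j := rp (iter j J x) (iter j J x).
pose v j := (trapezoid n j)%:C *: iter j J x.
pose v' j := (trapezoid n j.+1 - trapezoid n j)%:C *: iter j.+1 J x.
pose th k := k%:R * (2 * pi / N%:R) : R.
pose y k := \sum_(j < N) cis (j%:R * th k) *: v j.
have lK k : J (y k) = \sum_(j < N) cis (j%:R * th k) *: J (v j).
  rewrite /y (big_morph J (linP_D lJ) (linP_0 lJ)).
  by apply: eq_bigr => j _; rewrite (linP_Z lJ).
have shift k : cis (- th k) *: y k - J (y k) = \sum_(j < N) cis (j%:R * th k) *: v' j.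
  pose F j := (cis (- th k) * cis (j%:R * th k)) *: v j.
  have e1 : cis (- th k) *: y k = \sum_(j < N) F j.+1.
    have -> : cis (- th k) *: y k = \sum_(j < N) F j.
      by rewrite scaler_sumr; apply: eq_bigr => j _; rewrite scalerA.
    have F0 : F 0%N = 0 by rewrite /F /v /trapezoid min0n min0n scale0r scaler0.
    have FN : F N = 0 by rewrite /F /v /trapezoid subnn minn0 scale0r scaler0.
    have h1 : \sum_(j < N.+1) F j = F 0%N + \sum_(j < N) F j.+1 by rewrite big_ord_recl.
    have h2 : \sum_(j < N.+1) F j = \sum_(j < N) F j + F N by rewrite big_ord_recr.
    by move: h2; rewrite h1 F0 FN add0r addr0.
  rewrite e1 lK -sumrB; apply: eq_bigr => j _.
  rewrite /F -cisD /v' /v (linP_Z lJ) /= rmorphB /=.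
  have -> : - th k + j.+1%:R * th k = j%:R * th k by rewrite -natr1; ring.
  by lmod.
have low k : d * rp (y k) (y k) <=
    rp (\sum_(j < N) cis (j%:R * th k) *: v' j) (\sum_(j < N) cis (j%:R * th k) *: v' j).
  by rewrite -shift; apply: lowJ; exact: cabs_cis.
have sum : d * (N%:R * \sum_(j < N) rp (v j) (v j)) <= N%:R * \sum_(j < N) rp (v' j) (v' j).
  rewrite -!parseval mulr_sumr; apply: ler_sum => k _; exact: low.
have NR : (0 : R) < N%:R by rewrite ltr0n.
have {}sum : d * \sum_(j < N) rp (v j) (v j) <= \sum_(j < N) rp (v' j) (v' j).
  by rewrite -(ler_pM2l NR) mulrCA.
have up : \sum_(j < N) rp (v' j) (v' j) <= N%:R * rp x x.
  rewrite mulr_natl -[X in _ *+ X](card_ord N) -sumr_const; apply: ler_sum => j _.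
  rewrite /v' rpZl rpZr mulrA -expr2.
  apply: (@le_trans _ _ (1 * a j.+1)); first by apply: ler_wpM2r; [exact: rp_ge0|exact: trapezoid_step].
  by rewrite mul1r; exact: (@iterJ_le 0).
have lo : n%:R * (n%:R ^+ 2 * a N) <= \sum_(j < N) rp (v j) (v j).
  have -> : \sum_(j < N) rp (v j) (v j) = \sum_(0 <= j < N) rp (v j) (v j) by rewrite big_mkord.
  rewrite (@big_cat_nat _ _ _ n) //=; last by rewrite /N; lia.
  rewrite (@big_cat_nat _ _ _ (2 * n) n) //=; [|lia|rewrite /N; lia].
  have p0 p q : 0 <= \sum_(p <= j < q) rp (v j) (v j) by apply: sumr_ge0 => j _; exact: rp_ge0.
  apply: (@le_trans _ _ (\sum_(n <= j < 2 * n) rp (v j) (v j))); last first.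
    by have := p0 0%N n; have := p0 (2 * n)%N N; lra.
  have -> : n%:R * (n%:R ^+ 2 * a N) = \sum_(n <= j < 2 * n) n%:R ^+ 2 * a N.
    by rewrite sumr_const_nat -[RHS]mulr_natl; congr (_%:R * _); lia.
  rewrite big_nat_cond [X in _ <= X]big_nat_cond; apply: ler_sum => j /andP[/andP[j1 j2] _].
  rewrite /v rpZl rpZr mulrA -expr2.
  have -> : trapezoid n j = n%:R by rewrite /trapezoid; congr (_%:R); lia.
  by apply: ler_wpM2l; [exact: exprn_ge0|apply: iterJ_le; rewrite /N; lia].
have nR : (0 : R) < n%:R by rewrite ltr0n.
have := le_trans (ler_wpM2l (ltW d0) lo) (le_trans sum up).
rewrite /N natrM => h; rewrite -(ler_pM2l nR) -/N -/(a N).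
by move: h; lra.
Qed.

End PowerDecay.

(** * Exponential stability of contraction semigroups *)
Section FormNorm.
Context {R : realType} {E : normedModType R[i]} (hf : hform E).
Local Notation rp := (rp hf).

Definition fnorm (x : E) : R := Num.sqrt (rp x x).

Lemma fnorm_ge0 x : 0 <= fnorm x. Proof. exact: sqrtr_ge0. Qed.
Lemma fnorm_sqr x : fnorm x ^+ 2 = rp x x. Proof. by rewrite sqr_sqrtr ?rp_ge0. Qed.
Lemma ler_fnorm x y : rp x x <= rp y y -> fnorm x <= fnorm y.
Proof. by move=> h; rewrite ler_wsqrtr. Qed.
Lemma nrm_le_fnorm x : nrm x <= fnorm x.
Proof. by rewrite -(@ler_pXn2r _ 2) ?nnegrE ?fnorm_ge0 // fnorm_sqr rp_lb. Qed.
Lemma fnorm_le_nrm x : fnorm x <= 2 * nrm x.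
Proof.
rewrite -(@ler_pXn2r _ 2) ?nnegrE ?fnorm_ge0 ?mulr_ge0 // fnorm_sqr.
by apply: le_trans (rp_ub _ _) _; rewrite exprMn ler_wpM2r ?exprn_ge0 // expr2; lra.
Qed.
Lemma ler_fnormD x y : fnorm (x + y) <= fnorm x + fnorm y.
Proof.
rewrite -(@ler_pXn2r _ 2) ?nnegrE ?addr_ge0 ?fnorm_ge0 // fnorm_sqr sqrrD !fnorm_sqr !rpE (rpC _ y x).
have : rp x y <= fnorm x * fnorm y.
  apply: le_trans (ler_norm _) _.
  rewrite -(@ler_pXn2r _ 2) ?nnegrE ?mulr_ge0 ?fnorm_ge0 // real_normK ?num_real //.
  by rewrite exprMn !fnorm_sqr rp_CS.
by rewrite -mulr_natl; lra.
Qed.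
Lemma fnormZ a x : fnorm (a *: x) = cabs a * fnorm x.
Proof.
by rewrite /fnorm rpZZ sqrtrM ?exprn_ge0 // sqrtr_sqr ger0_norm.
Qed.
End FormNorm.

Section DissipativeResolvent.
Context {R : realType} {E : completeNormedModType R[i]} (hf : hform E)
  (A : operator E E) (dA : dissipative hf A).
Local Notation rp := (rp hf).

(** Moving to the right by [r] adds to the squared norm the nonnegative terms
    [r^2 |x|^2] and [- 2 r <A x, x>]. *)
Lemma half_plane_low M l x : 0 <= M -> 0 <= complex.Re l -> dom A x ->
  nrm x <= M * nrm (imag (complex.Im l) *: x - A x) ->
  rp x x <= 2 * M ^+ 2 * rp (l *: x - A x) (l *: x - A x).
Proof.
move=> M0; case: l => r w /= r_ge0 Dx low.
pose v := imag w *: x - A x.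
have -> : Complex r w *: x - A x = r%:C *: x + v.
  rewrite /v; have -> : Complex r w = r%:C + imag w.
    by rewrite /imag; apply/eqP; rewrite eq_complex /= addr0 add0r !eqxx.
  by lmod.
have par (u : E) : 0 <= rp u x -> rp u u <= rp (r%:C *: x + u) (r%:C *: x + u).
  move=> h2; rewrite !rpE (rpC _ x u); have h4 := rp_ge0 hf x.
  have h5 := mulr_ge0 r_ge0 h2; have h6 := mulr_ge0 r_ge0 (mulr_ge0 r_ge0 h4).
  by move: h5 h6; lra.
have h1 : rp v v <= rp (r%:C *: x + v) (r%:C *: x + v).
  by apply: par; rewrite rpBl rp_Zl /= mul0r sub0r oppr_ge0; exact: dA.
apply: le_trans (rp_ub _ _) _; rewrite -mulrA ler_pM2l //.
apply: (@le_trans _ _ ((M * nrm v) ^+ 2)).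
  by rewrite ler_pXn2r ?nnegrE ?mulr_ge0.

rewrite exprMn ler_wpM2l ?exprn_ge0  //.
exact: le_trans (rp_lb _ _) h1.
Qed.

(** The bound at 0 persists to its right by [half_plane_low], so the continuity
    method applies. *)
Lemma dissipative_rho_pos (l : R) : rho A (imag 0) -> 0 < l -> rho A l%:C.
Proof.
move=> r0 l0; have lA := rho_lin r0; have [M M1 lowM] := rho_lower r0.
have M0 : 0 < M by rewrite (lt_le_trans _ M1).
have low s x : 0 <= s -> dom A x -> nrm x <= 2 * M * nrm (s%:C *: x - A x).
  move=> s0 Dx; have h := @half_plane_low M s%:C x (ltW M0) s0 Dx (lowM x Dx).
  rewrite -(@ler_pXn2r _ 2) ?nnegrE ?mulr_ge0 ?(ltW M0) //.
  apply: le_trans (rp_lb hf _) _; apply: le_trans h _.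
  apply: (@le_trans _ _ (2 * M ^+ 2 * (2 * nrm (s%:C *: x - A x) ^+ 2))).
    by apply: ler_wpM2l; [rewrite mulr_ge0 ?exprn_ge0 ?(ltW M0)|exact: rp_ub].
  by rewrite !exprMn le_eqVlt; apply/orP; left; apply/eqP; ring.
have i0 : imag 0 = 0 :> R[i] by apply/eqP; rewrite eq_complex /= !eqxx.
apply: (@rho_intro _ _ _ _ (2 * M) lA); first by move=> x; apply: low; exact: ltW.
move=> y.
have c1 : lin_op (dom A) (fun x => - A x).
  split; first by case: lA.
  by move=> a x z Dx Dz; have [_ H] := lA; have [D1 ->] := H a x z Dx Dz; split=> //; lmod.
have c3 s x : 0 <= s <= 1 -> dom A x -> nrm x <= 2 * M * nrm (- A x + s%:C *: (l%:C *: x)).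
  move=> /andP[s0 _] Dx.
  have -> : - A x + s%:C *: (l%:C *: x) = (s * l)%:C *: x - A x.
    by rewrite rmorphM /=; lmod.
  by apply: low => //; rewrite mulr_ge0 // ltW.
have c4 z : exists2 x, dom A x & - A x = z.
  exists (resolvent A (imag 0) z); first exact: res_dom.
  by rewrite res_app // i0 scale0r sub0r opprK.
have [x Dx e] := continuity_method c1 (bounded_scale l%:C (bounded_id E)) c3 c4 y.
by exists x => //; rewrite -e addrC.
Qed.

End DissipativeResolvent.

Section Gearhart.
Context {R : realType} {E : completeNormedModType R[i]} (hf : hform E)
  (A : operator E E) (T : R -> E -> E) (gT : generates A T).
Local Notation rp := (rp hf).
Local Notation fnorm := (fnorm hf).
Context (cT : forall t x, 0 <= t -> rp (T t x) (T t x) <= rp x x).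
Context (r0 : rho A (imag 0)) (M : R) (M1 : 1 <= M).
Context (axis_low : forall w x, dom A x -> nrm x <= M * nrm (imag w *: x - A x)).

Let dA : dissipative hf A := contr_dissipative gT cT.
Let lA : lin_op (dom A) A := rho_lin r0.
Let M0 : 0 < M := lt_le_trans ltr01 M1.

Lemma rho_pos (l : R) : 0 < l -> rho A l%:C.
Proof. exact: (dissipative_rho_pos dA r0). Qed.

(** The implicit Euler step, that is, the inverse of [1 - h A]. *)
Definition euler (h : R) (y : E) : E := (h^-1)%:C *: resolvent A (h^-1)%:C y.

Section Euler.
Context (h : R) (h0 : 0 < h).
Let rh : rho A (h^-1)%:C. Proof. by apply: rho_pos; rewrite invr_gt0. Qed.
Let hV : h%:C * (h^-1)%:C = 1 :> R[i].
Proof. by rewrite -rmorphM /= divff // gt_eqF. Qed.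

Lemma euler_lin : linear (euler h).
Proof. by move=> a x y; rewrite /euler (res_lin rh); lmod. Qed.

Lemma euler_dom y : dom A (euler h y).
Proof. by case: (lin_opZ lA (h^-1)%:C (res_dom rh y)). Qed.

Lemma eulerE y : euler h y - h%:C *: A (euler h y) = y.
Proof.
have [_ e] := lin_opZ lA (h^-1)%:C (res_dom rh y).
rewrite /euler e res_app // scalerA hV scale1r; lmod.
Qed.

Lemma euler_dual x : dom A x -> euler h (x - h%:C *: A x) = x.
Proof.
move=> Dx; have -> : x - h%:C *: A x = h%:C *: ((h^-1)%:C *: x - A x).
  by rewrite scalerBr scalerA hV scale1r.
by rewrite (linP_Z euler_lin) /euler res_left // scalerA hV scale1r.
Qed.

Lemma euler_contr y : rp (euler h y) (euler h y) <= rp y y.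
Proof.
have := dA (euler_dom y); have := eulerE y; move: (euler h y) => w e d.
rewrite -e !rpE (rpC _ w (A w)).
have h1 := mulr_ge0 (ltW h0) (mulr_ge0 (ltW h0) (rp_ge0 hf (A w))).
by have h2 := mulr_ge0_le0 (ltW h0) d; move: h1 h2; lra.
Qed.

(** For [|z| = 1] one has [z y - J y = z h (l w - A w)] with [w = J y] and
    [l = (1 - conj z) / h], a point of the closed right half-plane. *)
Lemma euler_low z y : cabs z = 1 ->
  (h ^+ 2 / (2 * h ^+ 2 + 4 * M ^+ 2)) * rp y y <= rp (z *: y - euler h y) (z *: y - euler h y).
Proof.
move=> z1; have Dw := euler_dom y; have ew := eulerE y.
move: (euler h y) Dw ew => w Dw ew.
have [s sdef] : exists s, s = z *: y - w by exists (z *: y - w).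
rewrite -sdef.
have zz : z * conjc z = 1.
  have : (cabs z ^+ 2)%:C = 1 :> R[i] by rewrite z1 expr1n.
  by rewrite sqr_cabs add_Re2_Im2 sqr_normc.
have zn : cabs (conjc z) = 1.
  have : cabs (conjc z) ^+ 2 == 1.
    rewrite sqr_cabs; have := sqr_cabs z; rewrite z1 expr1n.
    by case: (z) => p q /= ->; rewrite sqrrN.
  by rewrite pexprn_eq1 //= => /eqP.
pose l := (h^-1)%:C * (1 - conjc z).
have Rel : 0 <= complex.Re l.
  have : complex.Re z <= 1.
    have := sqr_cabs z; rewrite z1 expr1n => e; have := sqr_ge0 (complex.Im z).
    by move: e; move: (complex.Re z) (complex.Im z) => a b; nra.
  rewrite /l; case: (z) => a b /= a1.
  by rewrite mul0r subr0 mulr_ge0 ?invr_ge0 ?(ltW h0) // subr_ge0.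
have sE : s = (z * h%:C) *: (l *: w - A w).
  rewrite sdef -{1}ew.
  have e : z * h%:C * l = z - 1.
    rewrite /l (_ : z * h%:C * _ = (h%:C * (h^-1)%:C) * (z - z * conjc z)); last by ring.
    by rewrite hV zz mul1r.
  have -> : (z * h%:C) *: (l *: w - A w) = (z * h%:C * l) *: w - (z * h%:C) *: A w by lmod.
  by rewrite e; lmod.
have hs : h ^+ 2 * rp w w <= 2 * M ^+ 2 * rp s s.
  rewrite sE rpZZ cabsM z1 mul1r cabs_real gtr0_norm // mulrCA.
  apply: ler_wpM2l; first by rewrite exprn_ge0 // ltW.
  exact: (half_plane_low dA (ltW M0) Rel Dw (axis_low _ Dw)).
have hy : rp y y <= 2 * (rp s s + rp w w).
  have -> : y = conjc z *: (s + w).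
    by rewrite sdef subrK scalerA mulrC zz scale1r.
  rewrite rpZZ zn expr1n mul1r.
  by have := rp_ge0 hf (s - w); rewrite !rpE (rpC _ w s); lra.
rewrite mulrAC ler_pdivrMr; last by rewrite addr_gt0 // mulr_gt0 // exprn_gt0.
have := ler_wpM2l (exprn_ge0 2 (ltW h0)) hy.
by move: hs; lra.
Qed.

End Euler.

Lemma sg_euler t h y : 0 <= t -> 0 < h -> T t (euler h y) = euler h (T t y).
Proof.
move=> t0 h0; rewrite /euler (linP_Z (sg_lin gT t0)) (sg_res gT) //.
by apply: rho_pos; rewrite invr_gt0.
Qed.

Lemma sg_dense (x : E) e : 0 < e -> exists2 v, dom A v & nrm (v - x) < e.
Proof. exact: dissipative_dense ltr01 (rho_pos ltr01) dA x e. Qed.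

Lemma euler_strong y e : 0 < e -> exists2 d, 0 < d & forall h, 0 < h < d ->
  fnorm (euler h y - y) < e.
Proof.
move=> e0; have e8 : 0 < e / 8 by rewrite divr_gt0.
have [v Dv hv] := sg_dense y e8.
pose d := e / (4 * (fnorm (A v) + 1)).
have p0 : 0 < 4 * (fnorm (A v) + 1) by rewrite mulr_gt0 // ltr_wpDl // fnorm_ge0.
exists d; first by rewrite divr_gt0.
move=> h /andP[h0 hd].
have -> : euler h y - y = euler h (y - v) + (h%:C *: euler h (A v) + (v - y)).
  have := euler_dual h0 Dv.
  rewrite !(linP_B (euler_lin h0)) (linP_Z (euler_lin h0)) => e1.
  by rewrite -{3}e1; lmod.
apply: le_lt_trans (ler_fnormD _ _ _) _.
have h1 : fnorm (euler h (y - v)) <= 2 * nrm (v - y).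
  apply: le_trans (ler_fnorm (euler_contr h0 _)) _.
  by rewrite nrmBC; exact: fnorm_le_nrm.
have h2 := ler_fnormD hf (h%:C *: euler h (A v)) (v - y).
have h3 : fnorm (h%:C *: euler h (A v)) <= h * fnorm (A v).
  rewrite fnormZ cabs_real gtr0_norm // ler_pM2l //.
  exact: ler_fnorm (euler_contr h0 _).
have h4 : h * fnorm (A v) <= e / 4.
  have : h * (4 * (fnorm (A v) + 1)) < e by rewrite -ltr_pdivlMr.
  by have := mulr_ge0 (ltW h0) (fnorm_ge0 hf (A v)); lra.
have h5 := fnorm_le_nrm hf (v - y).
by move: hv h1 h2 h3 h4 h5; lra.
Qed.

(** Both one-step differences, divided by [h], tend to [A x]. *)
Lemma euler_local x e : dom A x -> 0 < e -> exists2 d, 0 < d & forall h, 0 < h < d ->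
  fnorm (euler h x - T h x) <= h * e.
Proof.
move=> Dx e0; have e4 : 0 < e / 4 by rewrite divr_gt0.
have [d1 d10 h1] := near_right0 (cvg_nrm_lt (diff_quot_cvg gT Dx) e4).
have e2 : 0 < e / 2 by rewrite divr_gt0.
have [d2 d20 h2] := euler_strong (A x) e2.
exists (Num.min d1 d2); first by rewrite lt_min d10.
move=> h; rewrite lt_min => /and3P[h0 hd1 hd2].
have hh1 : 0 < h < d1 by rewrite h0. have hh2 : 0 < h < d2 by rewrite h0.
have {}h1 := h1 h hh1; have {}h2 := h2 h hh2.
have hC : h%:C != 0 :> R[i] by rewrite -cabs_eq0 cabs_real gt_eqF // gtr0_norm.
have -> : euler h x - T h x = h%:C *: ((euler h (A x) - A x) + (A x - diff_quot T x h)).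
  have e1 := euler_dual h0 Dx.
  rewrite (linP_B (euler_lin h0)) (linP_Z (euler_lin h0)) in e1.
  have e3 : h%:C *: diff_quot T x h = T h x - x by rewrite /diff_quot scalerA divff // scale1r.
  have -> : T h x = x + h%:C *: diff_quot T x h by rewrite e3; lmod.
  by rewrite -{2}e1; lmod.
rewrite fnormZ cabs_real gtr0_norm // ler_pM2l //.
apply: le_trans (ler_fnormD _ _ _) _.
have := fnorm_le_nrm hf (A x - diff_quot T x h); rewrite nrmBC.
by move: h1 h2; lra.
Qed.

(** Errors of single steps add up, as neither scheme amplifies them. *)
Lemma euler_global x h e n : 0 < h -> fnorm (euler h x - T h x) <= e ->
  fnorm (iter n (euler h) x - T (n%:R * h) x) <= n%:R * e.
Proof.
move=> h0 he; elim: n => [|n IH].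
  by rewrite !mul0r (sg0 gT) /= subrr /fnorm rp0l sqrtr0.
have nh : 0 <= n%:R * h by rewrite mulr_ge0 // ltW.
have -> : iter n.+1 (euler h) x - T (n.+1%:R * h) x =
    euler h (iter n (euler h) x - T (n%:R * h) x) + T (n%:R * h) (euler h x - T h x).
  rewrite (linP_B (euler_lin h0)) (linP_B (sg_lin gT nh)) -(sgD gT) ?(ltW h0) //.
  by rewrite sg_euler // -natr1 mulrDl mul1r /=; lmod.
apply: le_trans (ler_fnormD _ _ _) _; rewrite -natr1 mulrDl mul1r; apply: lerD.
  exact: le_trans (ler_fnorm (euler_contr h0 _)) IH.
exact: le_trans (ler_fnorm (cT _ nh)) he.
Qed.

(** Apply [power_decay] to Euler steps of length [h = t / (3 n)] and let [n] grow. *)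
Lemma strict_time : exists2 t, 0 < t & forall x, nrm (T t x) <= (9 / 10) * nrm x.
Proof.
(* With this t and h <= M the factor of power_decay is at least 24, so the squared
   form norm drops to 1/8, and the squared norm to 1/4 <= (9/10)^2. *)
pose t := 36 * M; have t0 : 0 < t by rewrite mulr_gt0.
exists t => //.
have dom_case x : dom A x -> nrm (T t x) <= (9 / 10) * nrm x.
  move=> Dx; apply/ler_addgt0Pr => e e0.
  have et : 0 < e / t by rewrite divr_gt0.
  have [d d0 hd] := euler_local Dx et.
  pose d' := Num.min d M; have d'0 : 0 < d' by rewrite lt_min d0.
  have [n _ hn] := near_infty_natSinv_lt (PosNum (divr_gt0 d'0 t0)).
  have {hn} := hn n (leqnn _) => /= hn.
  have n0 : (0 : R) < n.+1%:R by rewrite ltr0n.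
  have N0 : (0 : R) < (3 * n.+1)%:R by rewrite ltr0n.
  pose h := t / (3 * n.+1)%:R; have h0 : 0 < h by rewrite divr_gt0.
  have hd' : h < d'.
    rewrite /h mulrC -ltr_pdivlMr //; apply: le_lt_trans hn.
    by rewrite lef_pV2 ?posrE // ler_nat leq_pmull.
  have := hd'; rewrite lt_min => /andP[hd1 hM].
  have hh : 0 < h < d by rewrite h0.
  have g := euler_global (3 * n.+1) h0 (hd h hh).
  have Nh : (3 * n.+1)%:R * h = t by rewrite /h mulrCA divff ?mulr1 // gt_eqF.
  have Ne : (3 * n.+1)%:R * (h * (e / t)) = e by rewrite mulrA Nh mulrCA divff ?mulr1 // gt_eqF.
  rewrite Nh Ne in g.
  pose dl := h ^+ 2 / (2 * h ^+ 2 + 4 * M ^+ 2).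
  have den : 0 < 2 * h ^+ 2 + 4 * M ^+ 2 by rewrite addr_gt0 // mulr_gt0 // exprn_gt0.
  have dl0 : 0 < dl by rewrite divr_gt0 // exprn_gt0.
  have dec := @power_decay R E hf (euler h) (euler_lin h0) (euler_contr h0) dl dl0
     (euler_low h0) n.+1 x (ltn0Sn n).
  set y := iter (3 * n.+1) (euler h) x in g dec.
  have dn : 24 <= dl * n.+1%:R ^+ 2.
    rewrite /dl mulrAC ler_pdivlMr // -exprMn.
    have -> : h * n.+1%:R = 12 * M by rewrite /h natrM /t; field; rewrite gt_eqF.
    have hM2 : h ^+ 2 <= M ^+ 2 by rewrite ler_pXn2r ?nnegrE ?ltW.
    have -> : (12 * M) ^+ 2 = 144 * M ^+ 2 by ring.
    by lra.
  have dec2 : 8 * rp y y <= rp x x.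
    have := rp_ge0 hf y => y0; have := ler_wpM2r y0 dn; lra.
  have ny : nrm y <= (9 / 10) * nrm x.
    rewrite -(@ler_pXn2r _ 2) ?nnegrE ?mulr_ge0 //.
    have := rp_lb hf y; have := rp_ub hf x; have := sqr_ge0 (nrm x).
    by rewrite exprMn; lra.
  have := nrm_le_fnorm hf (y - T t x); have := ler_nrm_dist (T t x) y 0; rewrite !subr0 (nrmBC _ y).
  by move: g ny; lra.
move=> x; apply/ler_addgt0Pr => e e0; have e3 : 0 < e / 3 by rewrite divr_gt0.
have [v Dv hv] := sg_dense x e3.
have h1 := dom_case v Dv.
have h2 := contr_nrm cT (v - x) (ltW t0).
have -> : T t x = T t v - T t (v - x) by rewrite (linP_B (sg_lin gT (ltW t0))); lmod.
have h3 := ler_nrmB (T t v) (T t (v - x)).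
have h4 : nrm v <= nrm (v - x) + nrm x.
  by have := ler_nrmD (v - x) x; rewrite subrK.
by move: hv h1 h2 h3 h4; lra.
Qed.

Lemma exp_stability : exponentially_stable T.
Proof.
have [t0 t0p ht0] := strict_time.
pose q : R := 9 / 10.
have q0 : 0 < q by rewrite divr_gt0.
pose a := - ln q / t0.
have lnq : ln q < 0 by rewrite ln_lt0 // q0 /=; rewrite /q; lra.
exists (2 / q), a; split; first by rewrite divr_gt0 // oppr_gt0.
move=> t x tge.
have /andP[k1 k2] := truncn_itv (divr_ge0 tge (ltW t0p)).
set k := Num.truncn (t / t0) in k1 k2.
rewrite ler_pdivlMr // in k1; rewrite ltr_pdivrMr // in k2.
have kt : 0 <= k%:R * t0 by rewrite mulr_ge0 // ltW.
have it j y : nrm (T (j%:R * t0) y) <= q ^+ j * nrm y.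
  elim: j => [|j IH]; first by rewrite mul0r (sg0 gT) expr0 mul1r.
  have jt : 0 <= j%:R * t0 by rewrite mulr_ge0 // ltW.
  rewrite -natr1 mulrDl mul1r addrC (sgD gT) ?(ltW t0p) //.
  apply: le_trans (ht0 _) _; rewrite exprS -[X in _ <= X]mulrA.
  by apply: ler_wpM2l => //; exact: ltW.
have -> : t = k%:R * t0 + (t - k%:R * t0) by lra.
have r_ge : 0 <= t - k%:R * t0 by rewrite subr_ge0.
rewrite (sgD gT) //; apply: le_trans (it _ _) _.
have h1 := contr_nrm cT x r_ge.
have qk : q ^+ k <= q^-1 * expR (- (a * t)).
  have -> : q ^+ k = expR (k%:R * ln q) by rewrite expRM_natl lnK.
  have {1}-> : q^-1 = expR (- ln q) by rewrite expRN lnK.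
  rewrite -expRD ler_expR /a.
  have -> : - ln q + - (- ln q / t0 * t) = ln q * (t / t0 - 1) by field; rewrite gt_eqF.
  rewrite mulrC ler_nM2l // lerBlDr natr1 ler_pdivrMr //; exact: ltW.
have e1 : k%:R * t0 + (t - k%:R * t0) = t by lra.
rewrite e1; apply: le_trans (ler_wpM2l (exprn_ge0 k (ltW q0)) h1) _.
have h2 : 0 <= 2 * nrm x by rewrite mulr_ge0.
apply: le_trans (ler_wpM2r h2 qk) _.
by rewrite le_eqVlt; apply/orP; left; apply/eqP; ring.
Qed.

End Gearhart.

(** * Uniform bounds on the imaginary axis *)
Lemma rho_local_bound (R : realType) (V : completeNormedModType R[i]) (A : operator V V)
    (w0 : R) : rho A (imag w0) ->
  exists2 d, 0 < d & exists2 M, 0 <= M & forall w x, `|w0 - w| < d -> dom A x ->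
    nrm x <= M * nrm (imag w *: x - A x).
Proof.
move=> r0; have [M M1 hM] := rho_lower r0.
have M0 : 0 < M by rewrite (lt_le_trans _ M1).
exists (2 * M)^-1; first by rewrite invr_gt0 mulr_gt0.
exists (2 * M); first by rewrite mulr_ge0 // ltW.
move=> w x dw Dx; have h1 := hM x Dx.
have iB : imag w0 = imag w + imag (w0 - w) :> R[i].
  by apply/eqP; rewrite eq_complex /= addr0 eqxx addrC subrK eqxx.
have ci : cabs (imag (w0 - w)) = `|w0 - w|.
  have e : cabs (imag (w0 - w)) ^+ 2 = `|w0 - w| ^+ 2.
    by rewrite sqr_cabs /= expr0n add0r real_normK ?num_real.
  by apply/eqP; rewrite -(@eqrXn2 _ 2) ?e.
have h2 : nrm (imag w0 *: x - A x) <= nrm (imag w *: x - A x) + `|w0 - w| * nrm x.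
  rewrite -ci -nrmZ; apply: le_trans (ler_nrmD _ _).
  by rewrite iB le_eqVlt; apply/orP; left; apply/eqP; congr nrm; lmod.
have h3 : M * (`|w0 - w| * nrm x) <= 2^-1 * nrm x.
  rewrite mulrA ler_wpM2r // mulrC -ler_pdivlMr //.
  by apply: ltW; rewrite -invfM.
have h4 := ler_wpM2l (ltW M0) h2.
by move: h1 h3 h4; rewrite mulrDr; lra.
Qed.

Lemma rho_compact_bound (R : realType) (V : completeNormedModType R[i])
    (A : operator V V) (r : R) : (forall w, rho A (imag w)) ->
  exists M, forall w x, `|w| <= r -> dom A x -> nrm x <= M * nrm (imag w *: x - A x).
Proof.
move=> rA.
have /compact_near_coveringP cov := @segment_compact R (- r) r.
have [M [_ hM]] : \forall M \near +oo, `[- r, r]%classic `<=`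
    [set w | forall x, dom A x -> nrm x <= M * nrm (imag w *: x - A x)].
  apply: (cov R (+oo) (fun M w => forall x, dom A x -> nrm x <= M * nrm (imag w *: x - A x))) => w0 _.
  have [d d0 [M M0 h]] := rho_local_bound (rA w0).
  exists (ball w0 d, [set M' : R | M < M']).
    split=> /=; first exact: nbhsx_ballx.
    by exists M; split; first exact: num_real.
  move=> [w M'] [/= bw MM'] x Dx.
  apply: le_trans (h w x bw Dx) _; apply: ler_wpM2r => //; exact: ltW.
exists (M + 1) => w x wr Dx; apply: (hM (M + 1)) => //; first by rewrite ltrDl.
by rewrite /= in_itv /= -ler_norml.
Qed.

Lemma opnorm_bound (R : realType) (V W : normedModType R[i]) (f : V -> W) (M : R) :
  linear f -> (opnorm f <= M%:E)%E -> forall x, nrm (f x) <= M * nrm x.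
Proof.
move=> lf fM x; have [x0|x0] := eqVneq (nrm x) 0.
  have -> : x = 0 by apply: nrm_le0; rewrite x0.
  by rewrite (linP_0 lf) !nrm0 mulr0.
have xp : 0 < nrm x by rewrite lt_neqAle eq_sym x0 nrm_ge0.
pose y := ((nrm x)^-1)%:C *: x.
have ny : nrm y = 1.
  by rewrite nrmZ cabs_real ger0_norm ?invr_ge0 // mulVf.
have : ((nrm (f y))%:E <= M%:E)%E.
  apply: le_trans fM; apply: ereal_sup_ubound; exists y => //=; by rewrite ny.
rewrite lee_fin (linP_Z lf) nrmZ cabs_real ger0_norm ?invr_ge0 //.
by rewrite mulrC ler_pdivrMr.
Qed.

Lemma abs_inftyP (R : realType) (V : set R) : abs_infty V ->
  exists b : R, forall w, b < `|w| -> V w.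
Proof. by move=> [N [b [_ hb]] NV]; exists b => w bw; apply: NV; exact: hb. Qed.

(** Exponential decay provides a time at which [axis_lower] applies. *)
Lemma exp_stable_axis (R : realType) (E : completeNormedModType R[i]) (A : operator E E)
    (T : R -> E -> E) : generates A T -> exponentially_stable T ->
  (forall w, rho A (imag w)) ->
  exists N, forall w y, nrm (resolvent A (imag w) y) <= N * nrm y.
Proof.
move=> gT [M [a [a0 hM]]] rA.
pose M' := Num.max 1 M; have M1 : 1 <= M' by rewrite le_max lexx.
have M0 : 0 < M' by rewrite (lt_le_trans _ M1).
have hM1 s x : 0 <= s -> nrm (T s x) <= M' * expR (- (a * s)) * nrm x.
  move=> s0; apply: le_trans (hM s x s0) _; apply: ler_wpM2r => //.
  by apply: ler_wpM2r; [exact: expR_ge0|rewrite le_max lexx orbT].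
(* 1 + a t <= exp (a t) makes this time large enough. *)
pose t := 2 * M' / a; have t0 : 0 < t by rewrite divr_gt0 // mulr_gt0.
exists (2 * M' * t) => w y.
have := axis_lower gT M1 t0 _ _ w (res_dom (rA w) y); rewrite (res_right (rA w)); apply.
- move=> s x s0; apply: le_trans (hM1 s x s0) _; apply: ler_wpM2r => //.
  rewrite ger_pMr // -expR0 ler_expR oppr_le0 mulr_ge0 //; exact: ltW.
- move=> x; apply: le_trans (hM1 t x (ltW t0)) _; apply: ler_wpM2r => //.
  rewrite expRN ler_pdivrMr ?expR_gt0 //.
  have := expR_ge1Dx (a * t); have -> : a * t = 2 * M' by rewrite /t; field; rewrite gt_eqF.
  by lra.
Qed.

(** * Stability of the closed loop *)
Section ClosedLoopStability.
Context {R : realType} {X Z U : hilbertType R} (S : system X U U) (Sc : system Z U U).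
Context (I : set int) (omega : int -> R).
Context (rS : regular S) (pS : impedance_passive S).
Context (axA : imaginary_axis `<=` rho (opA S)).
Context (rSc : regular Sc) (pSc : impedance_passive Sc) (hDc : nonneg_op (opD Sc)).
Context (spec : sigma (opA Sc) `&` imaginary_axis = [set imag (omega k) | k in I]).
Context (hP : forall k, I k -> pos_op (re_op (transfer S (imag (omega k))))).
Context (hPG : forall w : R, ~ (omega @` I) w ->
    ~ boundedly_invertible (re_op (transfer Sc (imag w))) ->
    boundedly_invertible (fun u => u + transfer S (imag w) (transfer Sc (imag w) u))).
Context (hF : forall D0 : U -> U, bounded_operator D0 -> pos_op (re_op D0) ->
    [set imag (omega k) | k in I] `<=`
    rho (feedback Sc (D0 \o inv_op (fun u => u + opD Sc (D0 u))))).
Local Notation Ae := (closed_loop S Sc).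

Lemma axis_S w : rho (opA S) (imag w).
Proof. by apply: axA; exists w. Qed.

Lemma closed_loop_axis w : rho Ae (imag w).
Proof.
have rl := axis_S w; have bP := reg_transfer rS pS rl.
have accP u : 0 <= rp hil (transfer S (imag w) u) u by apply: transfer_accretive.
have [[k Ik kw]|nk] := pselect ((omega @` I) w).
  have posP := hP Ik; rewrite kw in posP.
  have rF := hF bP posP; have {}rF := rF (imag w) (ex_intro2 _ _ k Ik (congr1 _ kw)).
  have cP : exists2 c, 0 < c & forall u, c * nrm u ^+ 2 <= rp hil (transfer S (imag w) u) u.
    by have [c c0 hc] := posP; exists c => //; exact: ge_scalar_re_op.
  have [a [_ [a0 h _]]] := reg_half rSc.
  have rmu : rho (opA Sc) (a + 1)%:C by apply: h; rewrite /= ltrDl.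
  have mu0 : 0 <= complex.Re (a + 1)%:C by rewrite /= addr_ge0.
  exact: (resonant_rho rS pS rSc pSc hDc rl cP rF rmu mu0).
have rlc : rho (opA Sc) (imag w).
  apply: contrapT => nr; apply: nk.
  have : (sigma (opA Sc) `&` imaginary_axis) (imag w) by split=> //; exists w.
  by rewrite spec => -[k Ik /(congr1 (@complex.Im R)) /= e]; exists k.
apply: (loop_rho rS pS rSc pSc hDc rl rlc).
have [ri|nri] := pselect (boundedly_invertible (re_op (transfer Sc (imag w)))); last exact: hPG.
have bG := reg_transfer rSc pSc rlc.
have accG u : 0 <= rp hil (transfer Sc (imag w) u) u by apply: transfer_accretive.
have [c c0 hc] := accretive_inv bG accG ri.
have [g g0 hg] := strict_cocoercive bG c0 hc.
exact: (loop_invertible bP bG accP g0 hg).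
Qed.

Context (Te : R -> X * Z -> X * Z) (gT : generates Ae Te) (cT : contractive Te).

Lemma contractive_form t p : 0 <= t ->
  rp prodform (Te t p) (Te t p) <= rp prodform p p.
Proof. by move=> t0; rewrite !rp_prodE !rp_hil; exact: cT. Qed.

Lemma closed_loop_strong : strongly_stable Te.
Proof.
have dA := contr_dissipative gT contractive_form.
move=> p; apply: (strong_stability gT contractive_form closed_loop_axis ltr01).
exact: (dissipative_rho_pos dA (closed_loop_axis 0)).
Qed.

Context (expS : exponentially_stable (sgT S)).
Context (r : R) (rrho : forall w : R, r <= `|w| -> rho (opA Sc) (imag w)).
Context (rsup : (ereal_sup [set opnorm (resolvent (opA Sc) (imag w)) |
                     w in [set w : R | (r <= `|w|)%R]] < +oo)%E).
Local Notation P w := (transfer S (imag w)).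
Local Notation G w := (transfer Sc (imag w)).

Lemma uniform_bounds : exists2 K, 1 <= K & forall w,
  [/\ forall x, nrm (resolvent (opA S) (imag w) x) <= K * nrm x,
      forall u, nrm (R_ext (imag w) (opB S u)) <= K * nrm u,
      forall x, nrm (opC S (resolvent (opA S) (imag w) x)) <= K * nrm x &
      forall u, nrm (P w u) <= K * nrm u] /\
  (r <= `|w| -> [/\ forall x, nrm (resolvent (opA Sc) (imag w) x) <= K * nrm x,
      forall u, nrm (R_ext (imag w) (opB Sc u)) <= K * nrm u,
      forall x, nrm (opC Sc (resolvent (opA Sc) (imag w) x)) <= K * nrm x &
      forall u, nrm (G w u) <= K * nrm u]).
Proof.
have gS : generates (opA S) (sgT S) by case: rS.
have [N hN] := exp_stable_axis gS expS axis_S.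
have [K1 K11 h1] := axis_bounds rS pS N.
have [Nc hNc] : exists Nc, forall w x, r <= `|w| ->
    nrm (resolvent (opA Sc) (imag w) x) <= Nc * nrm x.
  pose s := ereal_sup [set opnorm (resolvent (opA Sc) (imag w)) |
                     w in [set w : R | (r <= `|w|)%R]].
  exists (fine s) => w x rw; apply: opnorm_bound; first exact: (res_lin (rrho rw)).
  have le : (opnorm (resolvent (opA Sc) (imag w)) <= s)%E.
    by apply: ereal_sup_ubound; exists w.
  have ge0 : (0 <= opnorm (resolvent (opA Sc) (imag w)))%E.
    apply: ereal_sup_ubound; exists 0 => /=; first by rewrite nrm0.
    by rewrite (linP_0 (res_lin (rrho rw))) nrm0.
  rewrite fineK // ge0_fin_numE //; exact: le_trans le.
have [K2 K21 h2] := axis_bounds rSc pSc Nc.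
pose K := `|N| + `|Nc| + K1 + K2.
have N0 : 0 <= `|N| by []. have Nc0 : 0 <= `|Nc| by [].
have wk (t c : R) : 0 <= t -> c <= K -> c * t <= K * t.
  by move=> t0 cK; apply: ler_wpM2r.
have NK : N <= K by have := ler_norm N; rewrite /K; lra.
have NcK : Nc <= K by have := ler_norm Nc; rewrite /K; lra.
have K1K : K1 <= K by rewrite /K; lra.
have K2K : K2 <= K by rewrite /K; lra.
exists K; first by rewrite /K; lra.
move=> w; split=> [|rw].
  have [b1 b2 b3] := h1 w (axis_S w) (hN w).
  split=> [x|u|x|u]; [apply: le_trans (hN w x) _|apply: le_trans (b1 u) _|
    apply: le_trans (b2 x) _|apply: le_trans (b3 u) _]; exact: wk.
have [b1 b2 b3] := h2 w (rrho rw) (fun x => hNc w x rw).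
split=> [x|u|x|u]; [apply: le_trans (hNc w x rw) _|apply: le_trans (b1 u) _|
  apply: le_trans (b2 x) _|apply: le_trans (b3 u) _]; exact: wk.
Qed.

(** The estimate that both high-frequency alternatives provide. *)
Definition loop_bounded_below (b k : R) :=
  forall w u, b < `|w| -> nrm u <= k * nrm (u + P w (G w u)).

(** [loop_apriori] covers high frequencies and compactness the others. *)
Lemma closed_loop_exponential b k : 1 <= k -> loop_bounded_below b k ->
  exponentially_stable Te.
Proof.
move=> k1 gap; have [K K1 hK] := uniform_bounds.
pose r2 := Num.max r (b + 1).
have [M hM] := rho_compact_bound r2 closed_loop_axis.
pose M2 := Num.max 1 (Num.max M (4 * k * K ^+ 4)).
have M21 : 1 <= M2 by rewrite le_max lexx.
apply: (@exp_stability _ _ prodform Ae Te gT contractive_form (closed_loop_axis 0) M2 M21).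
move=> w p Dp; have [wr|rw] := leP `|w| r2.
  apply: le_trans (hM w p wr Dp) _; apply: ler_wpM2r => //.
  by rewrite !le_max lexx !orbT.
have rw' : r <= `|w| by apply: ltW; apply: le_lt_trans rw; rewrite le_max lexx.
have bw : b < `|w| by apply: le_lt_trans rw; rewrite le_max; apply/orP; right; lra.
have [[c1 c2 c3 c4] /(_ rw') [d1 d2 d3 d4]] := hK w.
apply: (@le_trans _ _ (4 * k * K ^+ 4 * nrm (imag w *: p - Ae p))).
  apply: (loop_apriori rS pS rSc pSc hDc (axis_S w) (rrho rw') K1 k1) => //.
  by move=> u; exact: gap.
by apply: ler_wpM2r => //; rewrite !le_max lexx !orbT.
Qed.

(** For [f = u + P (G u)], the vector [v = G u] solves [v + G (P v) = G f], where [G P]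
    is a strict contraction; then [u = f - P v]. *)
Lemma gap_limsup :
  (limf_esup (fun w => opnorm (G w \o P w)) abs_infty < 1)%E ->
  exists b k, 1 <= k /\ loop_bounded_below b k.
Proof.
move=> lim1; have [K K1 hK] := uniform_bounds.
have K0 : 0 <= K by exact: le_trans K1.
move: lim1; rewrite /limf_esup => /ereal_inf_lt[_ [V FV <-]] sV.
have [b hb] := abs_inftyP FV.
have [q /andP[q0 q1] hq] : exists2 q : R, 0 <= q < 1 & forall w, V w -> (opnorm (G w \o P w) <= q%:E)%E.
  have [s [s1 up]] : exists s : \bar R, (s < 1)%E /\
      forall w, V w -> (opnorm (G w \o P w) <= s)%E.
    exists (ereal_sup [set opnorm (G w \o P w) | w in V]); split=> // w Vw.
    by apply: ereal_sup_ubound; exists w.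
  case: s s1 up => [t t1 up|//|_ up].
    exists (Num.max 0 t); first by rewrite le_max lexx /= gt_max ltr01 -lte_fin.
    by move=> w /up /le_trans; apply; rewrite lee_fin le_max lexx orbT.
  exists 0; first by rewrite lexx ltr01.
  by move=> w /up /le_trans; apply; exact: leNye.
pose k := 1 + K * (K / (1 - q)).
have q1' : 0 < 1 - q by rewrite subr_gt0.
have kq : 0 <= K / (1 - q) by rewrite divr_ge0 // ltW.
exists (Num.max b r), k; split; first by rewrite lerDl mulr_ge0.
move=> w u; rewrite gt_max => /andP[bw rw].
have [[_ _ _ hP'] /(_ (ltW rw)) [_ _ _ hG']] := hK w.
have lP := proj1 (reg_transfer rS pS (axis_S w)).
have lG := proj1 (reg_transfer rSc pSc (rrho (ltW rw))).
have lGP : linear (G w \o P w) by move=> a x y /=; rewrite lP lG.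
have hq' := opnorm_bound lGP (hq w (hb w bw)).
set f := u + P w (G w u); set v := G w u.
have uE : u = f - P w v by rewrite /f /v; lmod.
have vb : nrm v <= K / (1 - q) * nrm f.
  have : nrm v <= K * nrm f + q * nrm v.
    have {1}-> : v = G w f - G w (P w v) by rewrite -(linP_B lG) -uE.
    by apply: le_trans (ler_nrmB _ _) _; apply: lerD; [exact: hG'|exact: hq'].
  rewrite mulrAC ler_pdivlMr //; lra.
rewrite {1}uE; apply: le_trans (ler_nrmB _ _) _; rewrite /k mulrDl mul1r lerD2l.
apply: le_trans (hP' _) _; rewrite -mulrA; exact: ler_wpM2l.
Qed.

(** As [G] is bounded by [K], coercivity of [G] with constant [dc] is
    cocoercivity with constant [dc / K^2]; [loop_bound] adds the two constants. *)
Lemma gap_passive : (exists (eta dc : R -> R) (eta0 : R), 0 < eta0 /\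
    \forall w \near abs_infty,
      [/\ 0 <= eta w, ge_scalar (re_op (P w)) (eta w),
          0 <= dc w, ge_scalar (re_op (G w)) (dc w) &
          eta0 <= eta w + dc w]) ->
  exists b k, 1 <= k /\ loop_bounded_below b k.
Proof.
move=> [eta [dc [e0 [e0p near]]]]; have [K K1 hK] := uniform_bounds.
have K0 : 0 < K by exact: lt_le_trans K1.
have [b hb] := abs_inftyP near.
pose e := e0 / K ^+ 2; have ep : 0 < e by rewrite divr_gt0 // exprn_gt0.
exists (Num.max b r), (1 + K / e); split; first by rewrite lerDl divr_ge0 // ltW.
move=> w u; rewrite gt_max => /andP[bw rw].
have [[_ _ _ hP'] /(_ (ltW rw)) [_ _ _ hG']] := hK w.
have bP := reg_transfer rS pS (axis_S w).
have bG := reg_transfer rSc pSc (rrho (ltW rw)).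
have [eta_ge pP dc_ge pG sum] := hb w bw.
have K2 : 0 < K ^+ 2 by rewrite exprn_gt0.
apply: (@loop_bound _ _ _ _ (eta w) (dc w / K ^+ 2)) => //.
- exact: (proj1 bP).
- exact: (proj1 bG).
- exact: ltW.
- by move=> x; exact: ge_scalar_re_op.
- move=> x; apply: le_trans (ge_scalar_re_op bG pG x).
  rewrite -mulrA; apply: ler_wpM2l => //; rewrite ler_pdivrMl //.
  rewrite -exprMn ler_pXn2r ?nnegrE ?mulr_ge0 ?(ltW K0) //; exact: hG'.
- rewrite /e; apply: (@le_trans _ _ ((eta w + dc w) / K ^+ 2)).
    by rewrite ler_pM2r ?invr_gt0.
  rewrite mulrDl lerD2r ler_pdivrMr // ler_peMr //.
  by rewrite exprn_ege1.
Qed.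

End ClosedLoopStability.

Theorem theorem3p2 (R : realType) (X Z U : hilbertType R)
    (S : system X U U) (Sc : system Z U U) (I : set int) (omega : int -> R)
    (P := transfer S) (G := transfer Sc) (Ae := closed_loop S Sc) :
  regular S -> impedance_passive S -> strongly_stable (sgT S) ->
  imaginary_axis `<=` rho (opA S) ->
  regular Sc -> impedance_passive Sc -> nonneg_op (opD Sc) ->
  sigma (opA Sc) `&` imaginary_axis = [set imag (omega k) | k in I] ->
  (forall k, I k -> pos_op (re_op (P (imag (omega k))))) ->
  (forall w : R, ~ (omega @` I) w ->
    ~ boundedly_invertible (re_op (G (imag w))) ->
    boundedly_invertible (fun u => u + P (imag w) (G (imag w) u))) ->
  (forall D0 : U -> U, bounded_operator D0 -> pos_op (re_op D0) ->
    [set imag (omega k) | k in I] `<=`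
    rho (feedback Sc (D0 \o inv_op (fun u => u + opD Sc (D0 u))))) ->
  imaginary_axis `<=` rho Ae /\
  forall Te : R -> X * Z -> X * Z, generates Ae Te -> contractive Te ->
    strongly_stable Te /\
    (finite_set I -> exponentially_stable (sgT S) ->
     (exists r : R, [/\ 0 < r,
        forall w : R, r <= `|w| -> rho (opA Sc) (imag w) &
        (ereal_sup [set opnorm (resolvent (opA Sc) (imag w)) |
                     w in [set w : R | (r <= `|w|)%R]] < +oo)%E]) ->
     (limf_esup (fun w => opnorm (G (imag w) \o P (imag w))) abs_infty < 1)%E \/
     (exists (eta dc : R -> R) (eta0 : R), 0 < eta0 /\
        \forall w \near abs_infty,
          [/\ 0 <= eta w, ge_scalar (re_op (P (imag w))) (eta w),
              0 <= dc w, ge_scalar (re_op (G (imag w))) (dc w) &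
              eta0 <= eta w + dc w]) ->
     exponentially_stable Te).
Proof.
move=> rS pS _ axA rSc pSc hDc spec hP hPG hF.
have axis := closed_loop_axis rS pS axA rSc pSc hDc spec hP hPG hF.
split; first by move=> _ [w _ <-]; exact: axis.
move=> Te gT cT; split.
  exact: (closed_loop_strong rS pS axA rSc pSc hDc spec hP hPG hF gT cT).
move=> _ expS [r [_ rrho rsup]] alt.
have [b [k [k1 gap]]] : exists b k, 1 <= k /\ loop_bounded_below S Sc b k.
  case: alt => [|]; first exact: (gap_limsup rS pS axA rSc pSc expS rrho rsup).
  exact: (gap_passive rS pS axA rSc pSc expS rrho rsup).
exact: (closed_loop_exponential rS pS axA rSc pSc hDc spec hP hPG hF gT cT
  expS rrho rsup k1 gap).
Qed.
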